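(* Let $k \ge 3$ and let $\mathbf{a} = (a_0, a_1, \dots, a_{n-1})$ be a billiard sequence for ideal hyperbolic $k$-gons. Then the average length function $\mathbf{P} \mapsto L_{av}(\mathbf{P}, \mathbf{a})$ of the family of cyclically related closed billiard trajectories corresponding to $\mathbf{a}$, defined on all anti-clockwise labelled ideal hyperbolic $k$-gons $\mathbf{P}$, is uniquely minimised by the regular polygon. That is, if $\mathbf{P}_0$ denotes a regular ideal hyperbolic $k$-gon with anti-clockwise labelling, then for every anti-clockwise labelled ideal hyperbolic $k$-gon $\mathbf{P}$, $$L_{av}(\mathbf{P}, \mathbf{a}) \ge L_{av}(\mathbf{P}_0, \mathbf{a}),$$ with equality if and only if $\mathbf{P}$ is regular.
   Context: An ideal hyperbolic $k$-gon $\mathbf{P}$ is the geodesic polygon in the hyperbolic plane $\mathbb{D}^2$ (Poincaré disc, curvature $-1$) whose $k$ distinct vertices $x_1,\dots,x_k$, listed in anti-clockwise cyclic order, all lie on the boundary at infinity $\partial\mathbb{D}^2$; its sides are the complete geodesics $(x_i,x_{i+1})$ (indices modulo $k$). It is anti-clockwise labelled: the side $(x_i,x_{i+1})$ has label $i \in \{1,\dots,k\}$ (labels are taken modulo $k$). The polygon is regular if its symmetry group (isometries of $\mathbb{D}^2$ preserving $\mathbf{P}$) is the full dihedral group of order $2k$; all regular ideal $k$-gons are isometric. A billiard trajectory in $\mathbf{P}$ moves along geodesics at constant speed inside $\mathbf{P}$ and, on hitting a side, is reflected so that the angle of incidence equals the angle of reflection. It is closed if after a finite time it returns to the same point with the same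 direction. The billiard sequence of a closed billiard trajectory is the finite sequence of labels of the sides which it hits, in the order in which they are hit during one period (the trajectory may also be regarded as traversed several times, in which case the sequence is repeated accordingly). A finite sequence $\mathbf{a}=(a_0,\dots,a_{n-1})$ with entries in $\{1,\dots,k\}$ is called a billiard sequence if it is the billiard sequence of a closed billiard trajectory. It is known that $\mathbf{a}$ is a billiard sequence if and only if (a) consecutive entries $a_j,a_{j+1}$ (indices modulo $n$) are different, and (b) if $\mathbf{a}$ contains only two different labels, then these two labels do not differ by $\pm1$ modulo $k$. This condition does not depend on the ideal $k$-gon, and in each labelled ideal $k$-gon there is exactly one closed billiard trajectory with a given billiard sequence. Two closed billiard trajectories in $\mathbf{P}$ are cyclically related if they yield the same billiard sequence under (possibly) different anti-clockwise enumerations of the sides of $\mathbf{P}$. For $t = 0,1,\dots,k-1$ let $\gamma_t$ be the unique closed billiard trajectory in $\mathbf{P}$ with billiard sequence $(a_0+t, a_1+t,\dots,a_{n-1}+t)$ (entries modulo $k$); these form the family of all closed billiard trajectories cyclically related to the one with billiard sequence $\mathbf{a}$. The average length is $$L_{av}(\mathbf{P},\mathbf{a}) = \frac1k\sum_{t=0}^{k-1} \mathrm{length}(\gamma_t),$$ where length is hyperbolic length. *)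

(* Defs.v *)
From HB Require Import structures.
From mathcomp Require Import all_boot all_order all_algebra.
From mathcomp Require Import fingroup extremal.
From mathcomp Require Import all_classical all_reals all_analysis.

Set Implicit Arguments.
Unset Strict Implicit.
Unset Printing Implicit Defensive.

Import Order.TTheory GRing.Theory Num.Theory.
Import numFieldNormedType.Exports.

Local Open Scope classical_set_scope.
Local Open Scope ring_scope.

Section HyperbolicPlane.
Variable R : realType.

Definition dot (u v : R * R) : R := u.1 * v.1 + u.2 * v.2.
Definition cross (u v : R * R) : R := u.1 * v.2 - u.2 * v.1.
Definition normsq (u : R * R) : R := dot u u.

(* The open unit disc, with the metric of curvature -1. *)
Definition hplane := {p : R * R | normsq p < 1}.

Definition arcosh (t : R) : R := ln (t + Num.sqrt (t ^+ 2 - 1)).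

Definition hdist (p q : hplane) : R :=
  arcosh (1 + 2 * normsq ((sval p).1 - (sval q).1, (sval p).2 - (sval q).2)
              / ((1 - normsq (sval p)) * (1 - normsq (sval q)))).

(* Complete geodesics, parametrised by arc length.  The ends are points of
   the unit circle and the limits are taken in the Euclidean plane. *)
Definition geodesic_line (c : R -> hplane) : Prop :=
  forall s t, hdist (c s) (c t) = `|s - t|.

Definition joins (c : R -> hplane) (x y : R * R) : Prop :=
  geodesic_line c /\
  (sval (c s) @[s --> -oo] --> x) /\ (sval (c s) @[s --> +oo] --> y).

(* A set is convex if it contains the geodesic segment between any two of its
   points; z is on the segment [p, q] iff the triangle inequality is an
   equality. *)
Definition hconvex (C : set hplane) : Prop :=
  forall p q z, C p -> C q -> hdist p z + hdist z q = hdist p q -> C z.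

Definition isometry (f : hplane -> hplane) : Prop :=
  bijective f /\ forall p q, hdist (f p) (f q) = hdist p q.

(* Velocity of a curve at time t: two-sided for F = 0^', incoming for
   F = 0^'-, outgoing for F = 0^'+. *)
Definition velocity (F : set_system R) (c : R -> hplane) (t : R) (v : R * R) :
    Prop :=
  (h^-1 * ((sval (c (t + h))).1 - (sval (c t)).1) @[h --> F] --> v.1) /\
  (h^-1 * ((sval (c (t + h))).2 - (sval (c t)).2) @[h --> F] --> v.2).

End HyperbolicPlane.

Section IdealPolygons.
Variables (R : realType) (k : nat).

(* An anti-clockwise labelled ideal k-gon is given by its vertices
   x_0, ..., x_(k-1).  Labels are elements of 'I_k, i.e. 0, ..., k-1 instead
   of 1, ..., k; [ordS] is the successor modulo k. *)
Definition ideal_polygon (x : 'I_k -> R * R) : Prop :=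
  exists theta : 'I_k -> R,
    [/\ forall i, x i = (cos (theta i), sin (theta i)),
        forall i j : 'I_k, (i < j)%N -> theta i < theta j
      & forall i j : 'I_k, theta j < theta i + 2 * pi].

Variable x : 'I_k -> R * R.

Definition side (i : 'I_k) : set (hplane R) :=
  [set p | exists c, joins c (x i) (x (ordS i)) /\ range c p].

Definition boundary : set (hplane R) := [set p | exists i, side i p].

(* The closed region bounded by the sides, as their convex hull. *)
Definition polygon : set (hplane R) :=
  [set p | forall C, hconvex C -> boundary `<=` C -> C p].

Definition symmetries : set (hplane R -> hplane R) :=
  [set f | isometry f /\ f @` polygon = polygon].

(* The group of symmetries is isomorphic to the dihedral group of order 2k. *)
Definition regular : Prop :=
  exists Phi : gsort 'D_(k.*2) -> (hplane R -> hplane R),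
    [/\ injective Phi, range Phi = symmetries
      & forall g h, Phi (g * h)%g = Phi g \o Phi h].

(* The disc model is conformal, so the angles of incidence and reflection are
   Euclidean angles: the outgoing velocity w is the mirror image of the
   incoming velocity v in the tangent line (spanned by u) of the side. *)
Definition reflects (gamma : R -> hplane R) (t : R) (i : 'I_k) : Prop :=
  exists c s u v w,
    [/\ joins c (x i) (x (ordS i)) /\ c s = gamma t,
        velocity 0^' c s u, velocity 0^'- gamma t v, velocity 0^'+ gamma t w
      & dot w u = dot v u /\ cross u w = - cross u v].

(* Billiard trajectories, with unit speed and defined for all times. *)
Definition billiard_trajectory (gamma : R -> hplane R) : Prop :=
  [/\ forall t, polygon (gamma t),
      forall s t, s < t -> (forall u, s < u < t -> ~ boundary (gamma u)) ->
        hdist (gamma s) (gamma t) = t - s,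
      forall s t, finite_set [set u | s <= u <= t /\ boundary (gamma u)]
    & forall t i, side i (gamma t) -> reflects gamma t i].

(* T is a period, not necessarily the least one: a trajectory may be regarded
   as traversed several times. *)
Definition closed_billiard_trajectory (gamma : R -> hplane R) (T : R) : Prop :=
  [/\ billiard_trajectory gamma, 0 < T & forall t, gamma (t + T) = gamma t].

(* The sides hit in the period [s, s + T[ are a_0, ..., a_(n-1), hit at the
   times tau_0 < ... < tau_(n-1). *)
Definition hits_in_period (gamma : R -> hplane R) (T : R) n
    (a : n.-tuple 'I_k) : Prop :=
  exists (s : R) (tau : 'I_n -> R),
    [/\ forall i j : 'I_n, (i < j)%N -> tau i < tau j,
        forall t, (s <= t < s + T /\ boundary (gamma t)) <->
                  (exists j, t = tau j)
      & forall j, side (tnth a j) (gamma (tau j))].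

(* As the speed is 1, the length of a closed trajectory traversed over the
   period T is T.  There is exactly one such T if a is a billiard sequence. *)
Definition billiard_length n (a : n.-tuple 'I_k) : R :=
  xget 0 [set T | exists gamma,
    closed_billiard_trajectory gamma T /\ hits_in_period gamma T a].

Definition shift_labels n (t : nat) (a : n.-tuple 'I_k) : n.-tuple 'I_k :=
  [tuple iter t (@ordS k) (tnth a j) | j < n].

Definition average_length n (a : n.-tuple 'I_k) : R :=
  k%:R^-1 * \sum_(t < k) billiard_length (shift_labels t a).

End IdealPolygons.

Definition billiard_sequence (R : realType) (k n : nat) (a : n.-tuple 'I_k) :
    Prop :=
  exists (x : 'I_k -> R * R) (gamma : R -> hplane R) (T : R),
    [/\ ideal_polygon x, closed_billiard_trajectory x gamma T
      & hits_in_period x gamma T a].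

(* Main.v *)
Require Import Defs.
From mathcomp Require Import all_boot all_order all_algebra.
From mathcomp Require Import fingroup extremal.
From mathcomp Require Import ring lra zify.
From mathcomp Require Import all_classical all_reals all_analysis.

(** In the hyperboloid model, the ideal vertices of a polygon are light vectors
    Y p, chosen up to a positive factor, and lam (Y p) (Y q), the square root of
    the Lorentz product, is a lambda length.  Four ideal points in cyclic order
    satisfy Ptolemy's theorem (ptolemy).

    A closed billiard trajectory is a chain of geodesics, each the mirror image
    of the previous one in the side that is hit.  Let u j and v j be the lambda
    lengths from the forward end of the j-th geodesic to the two ends of the side
    that it hits.  Reflecting and applying Ptolemy's theorem gives a linear
    recursion (the record family) that expresses u j and v j by u j.+1 and
    v j.+1, with nonnegative coefficients formed from the lambda lengths between
    vertices; over one period of length T a solution is divided by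
    mu = exp (T / 2).  Conversely, the Perron eigenvector of the recursion over
    one period yields a trajectory (trajectory_exists), and mu is unique
    (family_unique), so that the length of a trajectory is determined by an
    eigenvalue.

    Minimality of the regular polygon follows by taking geometric means over the
    k shifts of the labels.  The geometric mean is superadditive, so the means of
    the solutions for a polygon w satisfy the recursion with the mean weights D,
    up to an inequality, and its factor is exp (L_av / 2).  The weights D depend
    only on the difference d of the indices, and the mean of Ptolemy's relations
    is the inequality D(1)^2 + D(d+1) D(d-1) <= D(d)^2.  For the lambda lengths s
    of the regular polygon it is an equation, and a discrete minimum principle
    yields s(d) / s(1) <= D(d) / D(1) (min_principle).  Hence the means are a
    supersolution of the recursion of the regular polygon, and following the
    minimal ratio between them and the true solution gives the inequality
    (mean_family_le).

    In the case of equality, the minimal ratio is constant.  The sequence of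
    labels cannot just turn around one vertex, because mu > 1, so for k > 3 some
    interior diagonal satisfies s(d) / s(1) = D(d) / D(1).  The equality descends
    to d = 2, where superadditivity is an equality as well, and this fixes the cross ratio
    of any four consecutive vertices (mean_family_eq).  Equal cross ratios give a
    linear isometry between the polygons (cross_ratio_congruent), which transports
    the group of symmetries (congruent_regular); for k = 3 there is no cross ratio
    and any two polygons are congruent.

    The regular polygon enters through a rotation that moves each vertex to the
    next one: a symmetry permutes the vertices by a dihedral permutation and is
    determined by it, and the group has 2k elements, so that all dihedral
    permutations occur (regular_rotation). *)

Set Implicit Arguments.
Unset Strict Implicit.
Unset Printing Implicit Defensive.

Import Order.TTheory GRing.Theory Num.Theory.
Import numFieldNormedType.Exports.

Local Open Scope classical_set_scope.
Local Open Scope ring_scope.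

(** * Lorentz space and lambda lengths *)

(** Vectors of Lorentz space, with the form ip of signature (1, 2). *)
Record v3 (R : Type) := V3 {v0 : R; v1 : R; v2 : R}.

Section LorentzSpace.
Variable R : rcfType.
Implicit Types (X Y Z A B C D E : v3 R) (a b c : R).

Definition vadd X Y := V3 (v0 X + v0 Y) (v1 X + v1 Y) (v2 X + v2 Y).
Definition vscale a X := V3 (a * v0 X) (a * v1 X) (a * v2 X).
Definition ip X Y := v0 X * v0 Y - v1 X * v1 Y - v2 X * v2 Y.
Definition det3 X Y Z :=
  v0 X * (v1 Y * v2 Z - v2 Y * v1 Z) - v1 X * (v0 Y * v2 Z - v2 Y * v0 Z)
  + v2 X * (v0 Y * v1 Z - v1 Y * v0 Z).
(** Forward light vectors represent ideal points, up to a positive factor, and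
    the sheet hyp of the hyperboloid represents the points of the plane. *)
Definition light X := ip X X = 0 /\ 0 < v0 X.
Definition hyp X := ip X X = 1 /\ 0 < v0 X.

Lemma ipC X Y : ip X Y = ip Y X.
Proof. by rewrite /ip; ring. Qed.
Lemma ipDl X Y Z : ip (vadd X Y) Z = ip X Z + ip Y Z.
Proof. by rewrite /ip /=; ring. Qed.
Lemma ipDr X Y Z : ip Z (vadd X Y) = ip Z X + ip Z Y.
Proof. by rewrite /ip /=; ring. Qed.
Lemma ipZl a X Y : ip (vscale a X) Y = a * ip X Y.
Proof. by rewrite /ip /=; ring. Qed.
Lemma ipZr a X Y : ip X (vscale a Y) = a * ip X Y.
Proof. by rewrite /ip /=; ring. Qed.
Lemma det3D A B X Y : det3 A B (vadd X Y) = det3 A B X + det3 A B Y.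
Proof. by rewrite /det3 /=; ring. Qed.
Lemma det3Z A B a X : det3 A B (vscale a X) = a * det3 A B X.
Proof. by rewrite /det3 /=; ring. Qed.
Lemma det3_rot A B C : det3 A B C = det3 B C A.
Proof. by rewrite /det3; ring. Qed.
Lemma det3_swap A B C : det3 A C B = - det3 A B C.
Proof. by rewrite /det3; ring. Qed.
Lemma det3_swap12 A B C : det3 B A C = - det3 A B C.
Proof. by rewrite /det3; ring. Qed.
Lemma det3_aba A B : det3 A B A = 0.
Proof. by rewrite /det3; ring. Qed.
Lemma det3_aab A B : det3 A A B = 0.
Proof. by rewrite /det3; ring. Qed.
Lemma det3_abb A B : det3 A B B = 0.
Proof. by rewrite /det3; ring. Qed.
Lemma vscaleA a b X : vscale a (vscale b X) = vscale (a * b) X.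
Proof. by rewrite /vscale /= !mulrA. Qed.
Lemma vscale1 X : vscale 1 X = X.
Proof. by case: X => *; rewrite /vscale /= !mul1r. Qed.
(** The Gram identity; the form has determinant 1, whence no sign. *)
Lemma det3_gram X Y Z : det3 X Y Z ^+ 2 =
  ip X X * (ip Y Y * ip Z Z - ip Y Z ^+ 2)
  - ip X Y * (ip X Y * ip Z Z - ip Y Z * ip X Z)
  + ip X Z * (ip X Y * ip Y Z - ip Y Y * ip X Z).
Proof. by rewrite /det3 /ip; ring. Qed.

Lemma det3_light X Y Z : ip X X = 0 -> ip Y Y = 0 -> ip Z Z = 0 ->
  det3 X Y Z ^+ 2 = 2 * ip X Y * ip Y Z * ip X Z.
Proof. by move=> x y z; rewrite det3_gram x y z; ring. Qed.

(** The linear relation between four vectors of a space of dimension three,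
    paired with E. *)
Lemma four_vectors A B C D E :
  det3 B C D * ip A E - det3 A C D * ip B E + det3 A B D * ip C E
  - det3 A B C * ip D E = 0.
Proof. by rewrite /det3 /ip; ring. Qed.

Lemma basis_coord A B C X : det3 A B C != 0 ->
  X = vadd (vadd (vscale (det3 X B C / det3 A B C) A)
                 (vscale (det3 A X C / det3 A B C) B))
           (vscale (det3 A B X / det3 A B C) C).
Proof.
case: A B C X => [a0 a1 a2] [b0 b1 b2] [c0 c1 c2] [x0 x1 x2].
rewrite /det3 /vadd /vscale /= => d; congr V3; field; exact: d.
Qed.

Lemma basis_ext A B C X Y : det3 A B C != 0 ->
  ip X A = ip Y A -> ip X B = ip Y B -> ip X C = ip Y C -> X = Y.
Proof.
move=> d eA eB eC.
have key Z : ip X Z = ip Y Z.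
  by rewrite (basis_coord Z d) !ipDr !ipZr eA eB eC.
have := (key (V3 1 0 0), key (V3 0 1 0), key (V3 0 0 1)).
case: X Y {eA eB eC key} => [x0 x1 x2] [y0 y1 y2].
rewrite /ip /= => -[[k0 k1] k2]; congr V3; lra.
Qed.

Lemma light_scale a X : 0 < a -> light X -> light (vscale a X).
Proof.
move=> a0 [x x0]; split; first by rewrite ipZl ipZr x !mulr0.
by rewrite /= mulr_gt0.
Qed.

Lemma ip_light_ge0 X Y : light X -> light Y -> 0 <= ip X Y.
Proof.
move=> [x x0] [y y0].
have : (v1 X * v1 Y + v2 X * v2 Y) ^+ 2 <= (v0 X * v0 Y) ^+ 2.
  have -> : (v0 X * v0 Y) ^+ 2 = (v1 X * v1 Y + v2 X * v2 Y) ^+ 2 +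
      (v1 X * v2 Y - v2 X * v1 Y) ^+ 2.
    have ex : v0 X ^+ 2 = v1 X ^+ 2 + v2 X ^+ 2.
      by move: x; rewrite /ip => x; apply/eqP; rewrite -subr_eq0 -{}x; apply/eqP; ring.
    have ey : v0 Y ^+ 2 = v1 Y ^+ 2 + v2 Y ^+ 2.
      by move: y; rewrite /ip => y; apply/eqP; rewrite -subr_eq0 -{}y; apply/eqP; ring.
    by rewrite exprMn ex ey; ring.
  by rewrite lerDl sqr_ge0.
move=> h; have := ler_norm (v1 X * v1 Y + v2 X * v2 Y).
have : `|v1 X * v1 Y + v2 X * v2 Y| <= v0 X * v0 Y.
  have px := ltW x0; have py := ltW y0.
  rewrite -(@ler_pXn2r _ 2) // ?nnegrE ?normr_ge0 ?mulr_ge0 //.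
  by rewrite real_normK ?num_real.
by move=> h1 h2; rewrite /ip; lra.
Qed.

(** The case of equality in the Cauchy-Schwarz inequality. *)
Lemma light_ip0 X Y : light X -> light Y -> ip X Y = 0 ->
  Y = vscale (v0 Y / v0 X) X.
Proof.
case: X Y => [x0 x1 x2] [y0 y1 y2] [] /=; rewrite /ip /= => x px [/=].
rewrite /ip /= => y py xy.
have ne : x0 != 0 by lra.
have : (x0 * y1 - y0 * x1) ^+ 2 + (x0 * y2 - y0 * x2) ^+ 2 = 0.
  transitivity (- x0 ^+ 2 * (y0 * y0 - y1 * y1 - y2 * y2)
    - y0 ^+ 2 * (x0 * x0 - x1 * x1 - x2 * x2)
    + 2 * x0 * y0 * (x0 * y0 - x1 * y1 - x2 * y2)); first by ring.
  by rewrite x y xy; ring.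
move/eqP; rewrite paddr_eq0 ?sqr_ge0 // !sqrf_eq0 => /andP[/eqP e1 /eqP e2].
rewrite /vscale /=; congr V3.
- by field.
- by apply: (mulfI ne); rewrite -[LHS](subrK (y0 * x1)) e1; field.
- by apply: (mulfI ne); rewrite -[LHS](subrK (y0 * x2)) e2; field.
Qed.

(** Up to a positive factor, the product is a sum of squares. *)
Lemma ip_hyp_light X Y : hyp X -> light Y -> 0 < ip X Y.
Proof.
move=> [x px] [y py].
have e : 2 * v0 Y * v0 X * ip X Y = v0 Y ^+ 2 * ip X X + (v1 X * v0 Y - v0 X * v1 Y) ^+ 2
   + (v2 X * v0 Y - v0 X * v2 Y) ^+ 2 + v0 X ^+ 2 * ip Y Y.
  by rewrite /ip; ring.
rewrite x y mulr0 mulr1 addr0 in e.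
have h : 0 < 2 * v0 Y * v0 X * ip X Y.
  rewrite e; apply: ltr_wpDr; first exact: sqr_ge0.
  by apply: ltr_wpDr; rewrite ?sqr_ge0 ?exprn_gt0.
by move: h; rewrite pmulr_rgt0 // !mulr_gt0.
Qed.

(** The orthogonal complement of a timelike vector is negative definite. *)
Lemma hyp_orth X Z : hyp X -> ip Z X = 0 -> ip Z Z = 0 -> Z = V3 0 0 0.
Proof.
case: X Z => [x0 x1 x2] [z0 z1 z2] [] /=; rewrite /ip /= => x px o z.
have ne : x0 != 0 by lra.
have h : z1 ^+ 2 + z2 ^+ 2 + (x1 * z2 - x2 * z1) ^+ 2 = 0.
  have e0 : z0 = (z1 * x1 + z2 * x2) / x0.
    by apply: (mulIf ne); rewrite divfK //; lra.
  have : x0 ^+ 2 * (z0 * z0 - z1 * z1 - z2 * z2) = 0 by rewrite z mulr0.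
  rewrite e0 => zz; rewrite -[RHS]oppr0 -[in RHS]zz.
  have xx : x0 ^+ 2 = 1 + x1 * x1 + x2 * x2 by lra.
  transitivity (- ((z1 * x1 + z2 * x2) ^+ 2 - x0 ^+ 2 * (z1 * z1 + z2 * z2))).
    by rewrite xx; ring.
  by congr (- _); field.
have p1 := sqr_ge0 z1; have p2 := sqr_ge0 z2; have p3 := sqr_ge0 (x1 * z2 - x2 * z1).
have /eqP : z1 ^+ 2 = 0 by lra.
have /eqP : z2 ^+ 2 = 0 by lra.
rewrite !sqrf_eq0 => /eqP e2 /eqP e1; congr V3 => //.
by apply: (mulIf ne); move: o; rewrite e1 e2; lra.
Qed.

Lemma light_forward X Y : light Y -> ip X X = 0 -> 0 < ip X Y -> light X.
Proof.
move=> ly x xy; split => //; rewrite ltNge; apply/negP => h.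
have [e|ne] := eqVneq (v0 X) 0.
  move: x; rewrite /ip e mul0r => x.
  have /eqP : v1 X ^+ 2 + v2 X ^+ 2 = 0 by rewrite -oppr0 -x; ring.
  rewrite paddr_eq0 ?sqr_ge0 // !sqrf_eq0 => /andP[/eqP e1 /eqP e2].
  by move: xy; rewrite /ip e e1 e2; lra.
have lx : light (vscale (-1) X).
  split; first by rewrite ipZl ipZr x !mulr0.
  by rewrite /= mulN1r oppr_gt0 lt_neqAle ne.
by have := ip_light_ge0 lx ly; rewrite ipZl; lra.
Qed.

(** The lambda length.  For light vectors with first coordinate 1 it is the
    Euclidean distance of the ideal points, divided by the square root of 2;
    scaling the vectors corresponds to moving horocycles. *)
Definition lam X Y := Num.sqrt (ip X Y).

Lemma lamC X Y : lam X Y = lam Y X.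
Proof. by rewrite /lam ipC. Qed.
Lemma lam_sqr X Y : light X -> light Y -> lam X Y ^+ 2 = ip X Y.
Proof. by move=> lx ly; rewrite sqr_sqrtr ?ip_light_ge0. Qed.
Lemma lam_gt0 X Y : (0 < lam X Y) = (0 < ip X Y).
Proof. exact: sqrtr_gt0. Qed.
Lemma lamXX X : light X -> lam X X = 0.
Proof. by case=> x _; rewrite /lam x sqrtr0. Qed.

(** Determinants of light vectors are products of lambda lengths; this turns
    linear relations into relations between lambda lengths. *)
Lemma det3_lam X Y Z : light X -> light Y -> light Z -> 0 <= det3 X Y Z ->
  det3 X Y Z = Num.sqrt 2 * lam X Y * lam Y Z * lam X Z.
Proof.
move=> lx ly lz d; rewrite -[LHS]ger0_norm // -sqrtr_sqr.
case: (lx) (ly) (lz) => [x _] [y _] [z _].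
by rewrite det3_light // !sqrtrM ?mulr_ge0 ?ip_light_ge0.
Qed.

Lemma det3_ip_gt0 X Y Z : light X -> light Y -> light Z -> det3 X Y Z != 0 ->
  [/\ 0 < ip X Y, 0 < ip Y Z & 0 < ip X Z].
Proof.
move=> lx ly lz d; case: (lx) (ly) (lz) => [x _] [y _] [z _].
have := det3_light x y z; move: d; rewrite -sqrf_eq0 => d e.
move: d; rewrite e !mulf_eq0 !negb_or => /andP[/andP[/andP[_ a] b] c].
by split; rewrite lt0r ?a ?b ?c ip_light_ge0.
Qed.

(** Ptolemy's theorem for ideal points in cyclic order: pair the linear relation
    between the four vectors with D, and cancel the common factor of the
    determinants. *)
Lemma ptolemy A B C D : light A -> light B -> light C -> light D ->
  0 < det3 A B D -> 0 < det3 B C D -> 0 < det3 A C D ->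
  lam A C * lam B D = lam A B * lam C D + lam B C * lam A D.
Proof.
move=> la lb lc ld dabd dbcd dacd.
have /(_ D) := four_vectors A B C D; case: (ld) => -> _.
rewrite mulr0 subr0 -(lam_sqr la ld) -(lam_sqr lb ld) -(lam_sqr lc ld).
rewrite (det3_lam la lb ld (ltW dabd)) (det3_lam lb lc ld (ltW dbcd)).
rewrite (det3_lam la lc ld (ltW dacd)).
have [_ bd ad] := det3_ip_gt0 la lb ld (lt0r_neq0 dabd).
have [_ cd _] := det3_ip_gt0 lb lc ld (lt0r_neq0 dbcd).
move: bd ad cd; rewrite -!lam_gt0 => bd ad cd.
have s2 : 0 < Num.sqrt (2 : R) by rewrite sqrtr_gt0.
move=> h; have ne : Num.sqrt 2 * lam B D * lam A D * lam C D != 0.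
  by rewrite !mulf_neq0 ?lt0r_neq0.
apply: (mulfI ne); apply/eqP; rewrite -subr_eq0 -oppr_eq0; apply/eqP.
by rewrite -[RHS]h; ring.
Qed.

End LorentzSpace.

(** * Ideal polygons as cyclic sequences of light vectors *)

Section CyclicPolygon.
Variable R : rcfType.
Implicit Types (A B C D E : v3 R).

(** If E and D are on different sides of the chord from A to C, then A, E, C, D
    are in cyclic order: in the basis A, C, D the coordinate of E at D is
    negative, and as the products of E with A and C are nonnegative, the other
    two coordinates are positive. *)
Lemma arc_det A C D E : light A -> light C -> light D -> light E ->
  0 < det3 A E C -> 0 < det3 A C D -> 0 < det3 A E D /\ 0 < det3 E C D.
Proof.
move=> la lc ld le daec dacd.
have [ac cd ad] := det3_ip_gt0 la lc ld (lt0r_neq0 dacd).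
have ne := lt0r_neq0 dacd.
have eE := basis_coord E ne.
set p := det3 E C D / _ in eE; set q := det3 A E D / _ in eE.
set r := det3 A C E / _ in eE.
have r0 : r < 0.
  by rewrite /r ltr_pdivrMr // mul0r det3_swap oppr_lt0.
have ipE Z : ip E Z = p * ip A Z + q * ip C Z + r * ip D Z.
  by rewrite [in LHS]eE !ipDl !ipZl.
have aa : ip A A = 0 by case: la.
have cc : ip C C = 0 by case: lc.
have hA := ip_light_ge0 le la; have hC := ip_light_ge0 le lc.
rewrite ipE aa (ipC C A) (ipC D A) mulr0 add0r in hA.
rewrite ipE cc (ipC D C) mulr0 addr0 in hC.
have rd : r * ip A D < 0 by rewrite nmulr_rlt0.
have rc : r * ip C D < 0 by rewrite nmulr_rlt0.
have q0 : 0 < q by rewrite -(pmulr_lgt0 _ ac); lra.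
have p0 : 0 < p by rewrite -(pmulr_lgt0 _ ac); lra.
move: q0 p0; rewrite /q /p !ltr_pdivlMr // !mul0r => -> ->; by [].
Qed.

Variable k : nat.

(** The vertices of an ideal polygon in anti-clockwise order, indexed by natural
    numbers modulo k; the lengths of the vectors are arbitrary. *)
Definition polyrep (Y : nat -> v3 R) :=
  [/\ forall p, light (Y p), forall p, Y (p + k)%N = Y p
    & forall p q r, (p < q < r)%N -> (r < p + k)%N ->
        0 < det3 (Y p) (Y q) (Y r)].

Hypothesis k3 : (3 <= k)%N.
Variable Y : nat -> v3 R.
Hypothesis hY : polyrep Y.

Let lY p : light (Y p). Proof. by case: hY. Qed.

Lemma polyrep_periodic m p : Y (p + m * k)%N = Y p.
Proof.
case: hY => _ per _; elim: m => [|m IH]; first by rewrite mul0n addn0.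
by rewrite mulSnr addnA per.
Qed.

Lemma polyrep_mod p : Y (p %% k)%N = Y p.
Proof. by rewrite [in RHS](divn_eq p k) addnC polyrep_periodic. Qed.

Lemma polyrep_eqmod p q : p = q %[mod k] -> Y p = Y q.
Proof. by move=> e; rewrite -polyrep_mod e polyrep_mod. Qed.

Lemma window p q : exists2 q', (p <= q' < p + k)%N & q' = q %[mod k].
Proof.
exists (p + (q + p * k - p) %% k)%N.
  by rewrite leq_addr ltn_add2l ltn_mod; lia.
rewrite modnDmr subnKC; last by nia.
by rewrite addnC modnMDl.
Qed.

(** The plane spanned by the side b is the set of zeros of this form, which is
    positive inside the polygon. *)
Definition sideform b C := det3 (Y b) (Y b.+1) C.

Lemma sideformD b C D : sideform b (vadd C D) = sideform b C + sideform b D.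
Proof. exact: det3D. Qed.
Lemma sideformZ b a C : sideform b (vscale a C) = a * sideform b C.
Proof. exact: det3Z. Qed.

Lemma eqmodS p q : p = q %[mod k] -> p.+1 = q.+1 %[mod k].
Proof. by move=> e; rewrite -(addn1 p) -(addn1 q) -modnDml e modnDml. Qed.

Lemma sideform_mod b b' : b = b' %[mod k] -> sideform b =1 sideform b'.
Proof.
by move=> e C; rewrite /sideform (polyrep_eqmod e) (polyrep_eqmod (eqmodS e)).
Qed.

Lemma sideform_vertex_gt0 b q : q != b %[mod k] -> q != b.+1 %[mod k] ->
  0 < sideform b (Y q).
Proof.
have [q' /andP[h1 h2] e] := window b q.
rewrite -(polyrep_eqmod e) -e /sideform => n1 n2.
case: hY => _ _; apply => //; rewrite ltnSn /=.
have : q' != b by apply: contraNneq n1 => ->.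
have : q' != b.+1 by apply: contraNneq n2 => ->.
lia.
Qed.

Lemma sideform_vertex_ge0 b q : 0 <= sideform b (Y q).
Proof.
have [e|n1] := eqVneq (q %% k)%N (b %% k)%N.
  by rewrite (polyrep_eqmod e) /sideform det3_aba.
have [e|n2] := eqVneq (q %% k)%N (b.+1 %% k)%N.
  by rewrite (polyrep_eqmod e) /sideform det3_abb.
exact/ltW/sideform_vertex_gt0.
Qed.

Lemma neqmod_small p q : (p < q < p + k)%N -> p != q %[mod k].
Proof.
move=> /andP[h1 h2]; apply/negP => /eqP e.
have : q - p = 0 %[mod k].
  by apply/eqP; rewrite -(eqn_modDr p) subnK ?add0n ?e // ltnW.
by rewrite mod0n modn_small; lia.
Qed.

Lemma lam_vertex_gt0 p q : p != q %[mod k] -> 0 < lam (Y p) (Y q).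
Proof.
move=> ne; rewrite lam_gt0.
have [q' /andP[h1 h2] e] := window p q.
rewrite -(polyrep_eqmod e); have {h1} h1 : (p < q')%N.
  by rewrite ltn_neqAle h1 andbT; apply: contraNneq ne => ->; rewrite e.
have [h|h] := ltnP q' (p + k).-1.
  have d : 0 < det3 (Y p) (Y q') (Y (p + k).-1) by case: hY => _ _; apply; lia.
  by have [] := det3_ip_gt0 (lY _) (lY _) (lY _) (lt0r_neq0 d).
have d : 0 < det3 (Y p) (Y p.+1) (Y q') by case: hY => _ _; apply; lia.
by have [] := det3_ip_gt0 (lY _) (lY _) (lY _) (lt0r_neq0 d).
Qed.

Lemma lam_side_gt0 p : 0 < lam (Y p) (Y p.+1).
Proof. by apply/lam_vertex_gt0/neqmod_small; lia. Qed.

(** An ideal point beyond the side b lies between b and b + 1 in the cyclic order: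
    apply arc_det to the side b, and then to the chord from b to i. *)
Lemma arc_sideform_gt0 b i E : light E -> sideform b E < 0 ->
  i != b %[mod k] -> 0 < sideform i E.
Proof.
move=> le hE ne.
have [i' /andP[h1 h2] e] := window b i.
rewrite -(sideform_mod e); have {h1} h1 : (b < i')%N.
  by rewrite ltn_neqAle h1 andbT; apply: contraNneq ne => ->; rewrite e.
have dE : 0 < det3 (Y b) E (Y b.+1) by rewrite det3_swap oppr_gt0.
have pos p q r : (p < q < r)%N -> (r < p + k)%N -> 0 < det3 (Y p) (Y q) (Y r).
  by case: hY => _ _; apply.
have [ei|ne1] := eqVneq i' b.+1.
  rewrite {}ei in h1 h2 e *; rewrite /sideform -det3_rot.
  have d : 0 < det3 (Y b) (Y b.+1) (Y b.+2) by apply: pos; lia.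
  by have [] := arc_det (lY _) (lY _) (lY _) le dE d.
have [ei|ne2] := eqVneq i'.+1 (b + k)%N.
  rewrite /sideform ei; case: (hY) => _ -> _.
  rewrite det3_rot.
  have d : 0 < det3 (Y b) (Y b.+1) (Y i') by apply: pos; lia.
  by have [] := arc_det (lY _) (lY _) (lY _) le dE d.
have d : 0 < det3 (Y b) (Y b.+1) (Y i') by apply: pos; lia.
have [d1 _] := arc_det (lY _) (lY _) (lY _) le dE d.
have d2 : 0 < det3 (Y b) (Y i') (Y i'.+1) by apply: pos; lia.
by have [_] := arc_det (lY _) (lY _) (lY _) le d1 d2; rewrite -det3_rot -det3_rot.
Qed.

Lemma arc_lam_gt0 c E : light E -> sideform c E < 0 ->
  0 < lam E (Y c) /\ 0 < lam E (Y c.+1).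
Proof.
move=> le hE; rewrite !lam_gt0 !(ipC E).
by have [] := det3_ip_gt0 (lY _) (lY _) le (ltr0_neq0 hE).
Qed.

(** Ptolemy's theorem for the quadrilateral c, E, c + 1, b; it remains true when
    b is one of the ends of the side c. *)
Lemma ptolemy_arc c b E : light E -> sideform c E < 0 ->
  lam E (Y b) * lam (Y c) (Y c.+1) =
  lam E (Y c) * lam (Y c.+1) (Y b) + lam E (Y c.+1) * lam (Y c) (Y b).
Proof.
move=> le hE.
have [e|n1] := eqVneq (b %% k)%N (c %% k)%N.
  by rewrite (polyrep_eqmod e) lamXX // mulr0 addr0 (lamC (Y c)).
have [e|n2] := eqVneq (b %% k)%N (c.+1 %% k)%N.
  by rewrite (polyrep_eqmod e) lamXX // mulr0 add0r.
have d := sideform_vertex_gt0 n1 n2.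
have dE : 0 < det3 (Y c) E (Y c.+1) by rewrite det3_swap oppr_gt0.
have [d1 d2] := arc_det (lY _) (lY _) (lY _) le dE d.
have := ptolemy (lY c) le (lY c.+1) (lY b) d1 d2 d.
by rewrite (lamC (Y c) E) => <-; ring.
Qed.

Lemma ptolemy_vertices p d : (2 <= d)%N -> (d.+1 < k)%N ->
  lam (Y p) (Y (p + d)%N) * lam (Y p.+1) (Y (p + d).+1) =
  lam (Y p) (Y p.+1) * lam (Y (p + d)%N) (Y (p + d).+1)
  + lam (Y p) (Y (p + d).+1) * lam (Y p.+1) (Y (p + d)%N).
Proof.
move=> d2 dk; case: (hY) => _ _ pos.
rewrite ptolemy //; first by rewrite [X in _ + X]mulrC.
all: by apply: pos; lia.
Qed.

(** The ideal points of the closed polygon are its vertices: E is a combination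
    with nonnegative coefficients of the vertices of some triangle 0, i, i + 1,
    and since E is isotropic, only one coefficient is not zero. *)
Lemma ideal_point_vertex E : light E -> (forall p, 0 <= sideform p E) ->
  exists2 q, (q < k)%N & exists2 r, 0 < r & E = vscale r (Y q).
Proof.
move=> le hE; case: (hY) => _ per pos.
(* the triangle of the fan from the vertex 0 that contains E *)
have [i [i1 i2 h1 h2]] : exists i, [/\ (0 < i)%N, (i.+1 < k)%N,
    0 <= det3 (Y 0) (Y i) E & det3 (Y 0) (Y i.+1) E <= 0].
  have hlast : det3 (Y 0) (Y k.-1) E <= 0.
    have := hE k.-1; rewrite /sideform prednK; last by lia.
    by rewrite -[k]add0n per det3_swap12 oppr_ge0.
  have ex : exists i, (0 < i)%N && (det3 (Y 0) (Y i.+1) E <= 0).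
    by exists k.-2; rewrite prednK ?hlast; lia.
  case/ex_minnP: ex => i /andP[i0 hi] min.
  have ik : (i <= k.-2)%N by apply: min; rewrite prednK ?hlast; lia.
  exists i; split => //; first by lia.
  have [->|i1] := eqVneq i 1%N; first exact: hE 0%N.
  rewrite leNgt; apply/negP => h.
  have : (i <= i.-1)%N by apply: min; rewrite prednK // ltW //; lia.
  lia.
have d : 0 < det3 (Y 0) (Y i) (Y i.+1) by apply: pos; lia.
have [a b c] := det3_ip_gt0 (lY _) (lY _) (lY _) (lt0r_neq0 d).
have eE := basis_coord E (lt0r_neq0 d).
set p := det3 E _ _ / _ in eE; set q := det3 _ E _ / _ in eE.
set r := det3 _ _ E / _ in eE.
have p0 : 0 <= p by rewrite /p divr_ge0 ?(ltW d) // det3_rot; apply: hE.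
have q0 : 0 <= q by rewrite /q divr_ge0 ?(ltW d) // det3_swap oppr_ge0.
have r0 : 0 <= r by rewrite /r divr_ge0 ?(ltW d).
clearbody p q r.
have : 2 * (p * q * ip (Y 0) (Y i) + q * r * ip (Y i) (Y i.+1)
            + p * r * ip (Y 0) (Y i.+1)) = ip E E.
  rewrite [in RHS]eE !ipDl !ipDr !ipZl !ipZr.
  case: (lY 0) (lY i) (lY i.+1) => -> _ [-> _] [-> _].
  rewrite (ipC (Y i) (Y 0)) (ipC (Y i.+1) (Y 0)) (ipC (Y i.+1) (Y i)); ring.
have p1 : 0 <= p * q * ip (Y 0) (Y i) by exact: (mulr_ge0 (mulr_ge0 p0 q0) (ltW a)).
have p2 : 0 <= q * r * ip (Y i) (Y i.+1) by exact: (mulr_ge0 (mulr_ge0 q0 r0) (ltW b)).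
have p3 : 0 <= p * r * ip (Y 0) (Y i.+1) by exact: (mulr_ge0 (mulr_ge0 p0 r0) (ltW c)).
case: (le) => -> E0 s.
have /eqP : p * q * ip (Y 0) (Y i) = 0 by lra.
have /eqP : q * r * ip (Y i) (Y i.+1) = 0 by lra.
have /eqP : p * r * ip (Y 0) (Y i.+1) = 0 by lra.
rewrite !mulf_eq0 !(gt_eqF a, gt_eqF b, gt_eqF c) !orbF.
have single z s' (s0 : 0 <= s') : E = vscale s' (Y z) -> 0 < s'.
  move=> e; rewrite lt0r s0 andbT; apply/negP => /eqP e0.
  by move: E0; rewrite e e0 /= mul0r ltxx.
have [ep|np] := eqVneq p 0; last first.
  move=> /= /eqP er _ /eqP eq0.
  have e : E = vscale p (Y 0).
    by rewrite [LHS]eE er eq0 /vadd /vscale /= !mul0r !addr0.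
  exists 0%N; [by apply: leq_trans k3|exact: (ex_intro2 _ _ p (single _ _ p0 e) e)].
have [eq0|nq] := eqVneq q 0; last first.
  move=> /= _ /eqP er _.
  have e : E = vscale q (Y i).
    by rewrite [LHS]eE er ep /vadd /vscale /= !mul0r !addr0 !add0r.
  exists i; [exact: ltnW|exact: (ex_intro2 _ _ q (single _ _ q0 e) e)].
move=> _ _ _.
have e : E = vscale r (Y i.+1).
  by rewrite [LHS]eE eq0 ep /vadd /vscale /= !mul0r !add0r.
exists i.+1; [exact: i2|exact: (ex_intro2 _ _ r (single _ _ r0 e) e)].
Qed.

Lemma side_span b C : sideform b C = 0 ->
  C = vadd (vscale (ip C (Y b.+1) / ip (Y b) (Y b.+1)) (Y b))
           (vscale (ip C (Y b) / ip (Y b) (Y b.+1)) (Y b.+1)).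
Proof.
move=> h; have d : 0 < det3 (Y b) (Y b.+1) (Y b.+2).
  by case: hY => _ _; apply; lia.
have [m _ _] := det3_ip_gt0 (lY _) (lY _) (lY _) (lt0r_neq0 d).
have := basis_coord C (lt0r_neq0 d); rewrite /sideform in h; rewrite h.
set p := _ / _; set q := _ / _ => eC.
have {}eC : C = vadd (vscale p (Y b)) (vscale q (Y b.+1)).
  by rewrite {1}eC mul0r /vscale /vadd /= !mul0r !addr0.
case: (lY b) (lY b.+1) => yb _ [yb' _].
rewrite {2 3}eC !ipDl !ipZl yb yb' (ipC (Y b.+1) (Y b)) !mulr0 addr0 add0r.
by rewrite !mulfK ?lt0r_neq0.
Qed.

(** Distinct sides of an ideal polygon do not meet: a point of the side b is a
    combination with positive coefficients of its ends, and the form of another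
    side vanishes at most at one of them. *)
Lemma side_sideform_gt0 b i C : hyp C -> sideform b C = 0 ->
  i != b %[mod k] -> 0 < sideform i C.
Proof.
move=> hC hb ne; rewrite (side_span hb) sideformD !sideformZ.
have m : 0 < ip (Y b) (Y b.+1) by rewrite -lam_gt0 lam_side_gt0.
have p : 0 < ip C (Y b.+1) / ip (Y b) (Y b.+1) by exact: divr_gt0 (ip_hyp_light hC (lY _)) m.
have q : 0 < ip C (Y b) / ip (Y b) (Y b.+1) by exact: divr_gt0 (ip_hyp_light hC (lY _)) m.
have [n1|n1] := boolP (b != i.+1 %[mod k]).
  apply: ltr_pwDl; first by rewrite mulr_gt0 // sideform_vertex_gt0 // eq_sym.
  by rewrite mulr_ge0 ?sideform_vertex_ge0 // ltW.
apply: ltr_wpDl; first by rewrite mulr_ge0 ?sideform_vertex_ge0 // ltW.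
rewrite mulr_gt0 //; move: n1; rewrite negbK => /eqP e.
rewrite (polyrep_eqmod (eqmodS e)); case: hY => _ _; apply; lia.
Qed.
End CyclicPolygon.

(** * Geometric means *)

Section GeometricMean.
Variables (R : realType) (k : nat).
Hypothesis k0 : (0 < k)%N.
Implicit Types f g : nat -> R.

Definition gmean f : R := (\prod_(t < k) f t) `^ (k%:R^-1).

Lemma eq_gmean f g : (forall t, f t = g t) -> gmean f = gmean g.
Proof. by move=> e; rewrite /gmean; under eq_bigr do rewrite e. Qed.

Lemma gmean_gt0 f : (forall t, 0 < f t) -> 0 < gmean f.
Proof. by move=> h; rewrite powR_gt0 // prodr_gt0. Qed.

Lemma gmeanM f g : (forall t, 0 <= f t) -> (forall t, 0 <= g t) ->
  gmean (fun t => f t * g t) = gmean f * gmean g.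
Proof.
by move=> hf hg; rewrite /gmean big_split /= powRM // prodr_ge0.
Qed.

Lemma gmean_cst a : 0 <= a -> gmean (fun=> a) = a.
Proof.
move=> a0; rewrite /gmean prodr_const card_ord -powR_mulrn // -powRrM.
by rewrite divff ?powRr1 // pnatr_eq0; lia.
Qed.

Lemma gmeanV f : (forall t, 0 < f t) -> gmean (fun t => (f t)^-1) = (gmean f)^-1.
Proof.
move=> hf; have h : gmean f != 0 by rewrite lt0r_neq0 ?gmean_gt0.
apply: (mulfI h); rewrite divff // -gmeanM => [|t|t].
- rewrite -[RHS](@gmean_cst 1) //; apply: eq_gmean => t.
  by rewrite divff // lt0r_neq0.
- exact: ltW.
- by rewrite invr_ge0 ltW.
Qed.

Lemma gmean_shift f : (forall t, f (t + k)%N = f t) ->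
  gmean (fun t => f t.+1) = gmean f.
Proof.
move=> per; rewrite /gmean; congr (_ `^ _).
case: k k0 per => // k' _ per.
by rewrite big_ord_recr [RHS]big_ord_recl /= -[k'.+1]add0n per mulrC.
Qed.

Lemma gmean_le f : (forall t, 0 <= f t) ->
  gmean f <= (\sum_(t < k) f t) / k%:R ?=
    iff [forall i : 'I_k, forall j : 'I_k, f i == f j].
Proof.
move=> hf; have hs : 0 <= (\sum_(t < k) f t) / k%:R.
  by rewrite divr_ge0 // sumr_ge0.
have hp : 0 <= \prod_(t < k) f t by rewrite prodr_ge0.
have k1 : k%:R != 0 :> R by rewrite pnatr_eq0; lia.
have ki : 0 < k%:R^-1 :> R by rewrite invr_gt0 ltr0n.
have root : (\sum_(t < k) f t) / k%:R =
    (((\sum_(t < k) f t) / k%:R) ^+ k) `^ (k%:R^-1).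
  by rewrite -powR_mulrn // -powRrM divff // powRr1.
have [h1 h2] : \prod_(t < k) f t <= ((\sum_(t < k) f t) / k%:R) ^+ k
    ?= iff [forall i : 'I_k, forall j : 'I_k, f i == f j].
  have := @leif_AGM R _ predT (fun i : 'I_k => f i) (fun i _ => hf i).
  by rewrite cardE enumT -enumT -cardE card_ord.
split; first by rewrite root /gmean ge0_ler_powR ?nnegrE ?exprn_ge0 // ltW.
rewrite -h2 [in LHS]root /gmean; apply/eqP/eqP => [|-> //].
by apply: (powR_injective ki); rewrite ?nnegrE ?exprn_ge0.
Qed.

(** Superadditivity of the geometric mean, from the inequality of means for
    f / (f + g) and g / (f + g). *)
Lemma gmeanD_aux f g : (forall t, 0 <= f t) -> (forall t, 0 <= g t) ->
  (forall t, 0 < f t + g t) ->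
  gmean f <= gmean (fun t => f t + g t)
              * ((\sum_(t < k) f t / (f t + g t)) / k%:R)
     ?= iff [forall i : 'I_k, forall j : 'I_k,
              f i / (f i + g i) == f j / (f j + g j)].
Proof.
move=> hf hg hfg.
have h t : 0 <= f t / (f t + g t) by rewrite divr_ge0 // ltW.
have p : 0 < gmean (fun t => f t + g t) by rewrite gmean_gt0.
have e : gmean f =
    gmean (fun t => f t + g t) * gmean (fun t => f t / (f t + g t)).
  rewrite -gmeanM // => [|t]; last exact: ltW.
  by apply: eq_gmean => t; rewrite mulrC divfK // lt0r_neq0.
have [h1 h2] := gmean_le h.
split; first by rewrite e ler_pM2l.
by rewrite e -h2; apply/eqP/eqP => [/(mulfI (lt0r_neq0 p))|->].
Qed.

Lemma gmeanD_sum f g : (forall t, 0 < f t + g t) ->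
  (\sum_(t < k) f t / (f t + g t)) / k%:R
  + (\sum_(t < k) g t / (f t + g t)) / k%:R = 1.
Proof.
move=> h; rewrite -mulrDl -big_split /=.
under eq_bigr do rewrite -mulrDl divff ?lt0r_neq0 //.
by rewrite sumr_const card_ord divff // pnatr_eq0; lia.
Qed.

(** Divide by the right-hand side: the two arithmetic means of gmeanD_aux add up
    to 1. *)
Lemma gmeanD f g : (forall t, 0 <= f t) -> (forall t, 0 <= g t) ->
  (forall t, 0 < f t + g t) ->
  gmean f + gmean g <= gmean (fun t => f t + g t).
Proof.
move=> hf hg hfg; rewrite -[leRHS]mulr1 -(gmeanD_sum hfg) mulrDr.
have [h1 _] := gmeanD_aux hf hg hfg; apply: lerD h1 _.
have hgf t : 0 < g t + f t by rewrite addrC.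
have [h1 _] := gmeanD_aux hg hf hgf; move: h1.
rewrite (@eq_gmean (fun t => g t + f t) _ (fun t => addrC (g t) (f t))).
by under eq_bigr do rewrite (addrC (g _)).
Qed.

Lemma gmeanD_eq f g : (forall t, 0 < f t) -> (forall t, 0 < g t) ->
  gmean f + gmean g = gmean (fun t => f t + g t) ->
  forall t, (t < k)%N -> f t / (f t + g t) = gmean f / gmean (fun t => f t + g t).
Proof.
move=> hf hg e.
have hfg t : 0 < f t + g t by rewrite addr_gt0.
have hf' t := ltW (hf t); have hg' t := ltW (hg t).
have p : 0 < gmean (fun t => f t + g t) by rewrite gmean_gt0.
have [h1 h2] := gmeanD_aux hf' hg' hfg.
have h3 : gmean g <= gmean (fun t => f t + g t)
              * ((\sum_(t < k) g t / (f t + g t)) / k%:R).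
  have hgf t : 0 < g t + f t by rewrite addrC.
  have [h3 _] := gmeanD_aux hg' hf' hgf; move: h3.
  rewrite (@eq_gmean (fun t => g t + f t) _ (fun t => addrC (g t) (f t))).
  by under eq_bigr do rewrite (addrC (g _)).
have := gmeanD_sum hfg; set A := _ / _ in h1 h2 *; set B := _ / _ in h3 *.
move=> AB; have eA : gmean f = gmean (fun t => f t + g t) * A.
  apply/eqP; rewrite eq_le h1 /=.
  have : gmean (fun t => f t + g t) = gmean (fun t => f t + g t) * A
       + gmean (fun t => f t + g t) * B by rewrite -mulrDr AB mulr1.
  lra.
move: h2; rewrite eA eqxx => /esym/forallP h t tk.
rewrite mulrAC divff ?lt0r_neq0 // mul1r /A.
have k1 : k%:R != 0 :> R by rewrite pnatr_eq0; lia.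
apply: (mulIf k1); rewrite divfK //.
rewrite (eq_bigr (fun=> f t / (f t + g t))) => [|i _].
  by rewrite sumr_const card_ord mulr_natr.
by have /forallP/(_ (Ordinal tk))/eqP := h i.
Qed.

End GeometricMean.

(** * Weights between vertices and a discrete minimum principle *)

Section Weights.
Variables (R : realType) (k : nat).
Hypothesis k3 : (3 <= k)%N.
Implicit Types (w s D : nat -> nat -> R) (b : nat -> nat).

(** The properties of the lambda lengths between the vertices of a polygon that
    the averaging argument needs; indices are read modulo k. *)
Record weights w : Prop := Weights {
  weights_sym : forall p q, w p q = w q p;
  weights_mod : forall p p' q, p = p' %[mod k] -> w p q = w p' q;
  weights_diag : forall p, w p p = 0;
  weights_gt0 : forall p q, p != q %[mod k] -> 0 < w p q }.

(** The weights of a polygon with a rotational symmetry. *)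
Definition circulant w := forall p q, w p.+1 q.+1 = w p q.

Lemma weights_modr w p q q' : weights w -> q = q' %[mod k] -> w p q = w p q'.
Proof. by move=> hw e; rewrite !(weights_sym hw p) (weights_mod hw p e). Qed.

Lemma weights_ge0 w p q : weights w -> 0 <= w p q.
Proof.
move=> hw; have [e|ne] := eqVneq (p %% k)%N (q %% k)%N.
  by rewrite (weights_mod hw _ e) (weights_diag hw).
exact: ltW (weights_gt0 hw ne).
Qed.

Lemma neqmodS p : p != p.+1 %[mod k].
Proof.
apply/negP => /eqP e; have : 0 = 1 %[mod k].
  by apply/eqP; rewrite -(eqn_modDl p) addn0 addn1 e.
by rewrite mod0n modn_small; lia.
Qed.

Lemma circulant_side w p : circulant w -> w p p.+1 = w 0 1.
Proof. by move=> c; elim: p => // p IH; rewrite c. Qed.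

Lemma circulantE w p q : weights w -> circulant w ->
  w p q = w 0%N ((q + p * k - p) %% k)%N.
Proof.
move=> hw hc; have sh m d : w m (m + d)%N = w 0%N d.
  by elim: m => // m IH; rewrite addSn hc.
rewrite (weights_modr _ hw (modn_mod _ _)) -(sh p) subnKC; last by nia.
by apply: weights_modr => //; rewrite addnC modnMDl.
Qed.

(** Ptolemy's theorem for the quadrilaterals with vertices p, p + 1, p + d and
    p + d + 1. *)
Definition ptolemaic w := forall p d, (2 <= d)%N -> (d.+1 < k)%N ->
  w p (p + d)%N * w p.+1 (p + d).+1 =
  w p p.+1 * w (p + d)%N (p + d).+1 + w p (p + d).+1 * w p.+1 (p + d)%N.

(** Averaging over the rotations makes the weights circulant, at the price of
    replacing Ptolemy's relations by the inequalities of wmean_step. *)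
Definition wmean w p q := gmean k (fun t => w (p + t)%N (q + t)%N).

Lemma wmean_weights w : weights w -> weights (wmean w).
Proof.
move=> hw; split=> [p q|p p' q e|p|p q ne].
- by apply: eq_gmean => t; rewrite (weights_sym hw).
- apply: eq_gmean => t; apply: (weights_mod hw).
  by rewrite -modnDml e modnDml.
- rewrite /wmean -[RHS](@gmean_cst R k _ 0) //; last by lia.
  by apply: eq_gmean => t; rewrite (weights_diag hw).
- apply: gmean_gt0 => t; apply: (weights_gt0 hw).
  by rewrite eqn_modDr.
Qed.

Lemma wmean_circulant w : weights w -> circulant (wmean w).
Proof.
move=> hw p q; rewrite [RHS]/wmean -[RHS]gmean_shift; last 2 first.
- by lia.
- move=> t; rewrite !addnA; rewrite (weights_mod (p' := (p + t)%N) hw).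
    by apply: weights_modr => //; rewrite modnDr.
  by rewrite modnDr.
by apply: eq_gmean => t; rewrite !addSnnS.
Qed.

(** The geometric mean of Ptolemy's relations, by superadditivity. *)
Lemma wmean_step w (d : nat) : weights w -> ptolemaic w ->
  (2 <= d)%N -> (d.+1 < k)%N ->
  wmean w 0 1 ^+ 2 + wmean w 0 d.+1 * wmean w 0 d.-1 <= wmean w 0 d ^+ 2.
Proof.
move=> hw hp d2 dk.
have k0 : (0 < k)%N by lia.
have wge p q := weights_ge0 p q hw.
have hD := wmean_weights hw; have cD := wmean_circulant hw.
have e1 : wmean w 0 d ^+ 2 = gmean k (fun t => w (0 + t)%N (d + t)%N * w (1 + t)%N (d.+1 + t)%N).
  by rewrite gmeanM // expr2 -[X in _ * X]cD.
have e2 : wmean w 0 1 ^+ 2 = gmean k (fun t => w (0 + t)%N (1 + t)%N * w (d + t)%N (d.+1 + t)%N).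
  by rewrite gmeanM // expr2 -[in X in _ * X](circulant_side d cD).
have e3 : wmean w 0 d.+1 * wmean w 0 d.-1 =
   gmean k (fun t => w (0 + t)%N (d.+1 + t)%N * w (1 + t)%N (d + t)%N).
  rewrite gmeanM // -[wmean w 0 d.-1]cD prednK //; lia.
have e t : w (0 + t)%N (1 + t)%N * w (d + t)%N (d.+1 + t)%N
         + w (0 + t)%N (d.+1 + t)%N * w (1 + t)%N (d + t)%N =
         w (0 + t)%N (d + t)%N * w (1 + t)%N (d.+1 + t)%N.
  by have := hp t d d2 dk; rewrite (addnC t) !add0n !addSn => ->.
rewrite e1 e2 e3 -(eq_gmean _ e) gmeanD // => t; rewrite ?mulr_ge0 // e.
rewrite mulr_gt0 // (weights_gt0 hw) // eqn_modDr.
  by rewrite mod0n modn_small; lia.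
by rewrite !modn_small; lia.
Qed.

(** Where the ratio r of D = wmean w to s is minimal, the neighbouring diagonals
    of D are at least r times those of s.  Subtracting the equation for s from
    the inequality for D leaves D(1)^2 <= (r s(1))^2: the minimum is at least the
    value on the boundary d = 1. *)
Lemma min_principle w s d : weights w -> ptolemaic w ->
  weights s -> circulant s -> ptolemaic s -> (0 < d < k)%N ->
  s 0%N d * wmean w 0 1 <= wmean w 0 d * s 0%N 1.
Proof.
move=> hw hpw hs cs hps /andP[d0 dk].
set D := wmean w; have hD : weights D by exact: wmean_weights.
have cD : circulant D by exact: wmean_circulant.
have spos e : (0 < e < k)%N -> 0 < s 0%N e.
  by move=> he; apply: (weights_gt0 hs); rewrite mod0n modn_small; lia.
have s1 : 0 < s 0%N 1%N by apply: spos; lia.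
have [d' hd' /= min] : exists2 d', (0 < d' < k)%N & forall e, (0 < e < k)%N ->
    D 0%N d' / s 0%N d' <= D 0%N e / s 0%N e.
  have i0 : 'I_k.-1 by exists 0%N; lia.
  case: (@Order.TotalTheory.arg_minP _ _ _ i0 predT
    (fun i : 'I_k.-1 => D 0%N i.+1 / s 0%N i.+1) isT) => i _ hi.
  exists i.+1; first by case: i {hi} => i /=; lia.
  move=> e he; have he' : (e.-1 < k.-1)%N by lia.
  by have := hi (Ordinal he') isT; rewrite /= (@prednK e) //; lia.
have dpos : 0 < s 0%N d by apply: spos; lia.
have d'pos : 0 < s 0%N d' by exact: spos.
suff h : D 0%N 1%N / s 0%N 1%N <= D 0%N d' / s 0%N d'.
  have : D 0%N 1%N / s 0%N 1%N <= D 0%N d / s 0%N d.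
    by apply: le_trans h (min _ _); lia.
  by rewrite ler_pdivrMr // mulrAC ler_pdivlMr // mulrC.
have lastE W : weights W -> circulant W -> W 0%N k.-1 = W 0%N 1%N.
  move=> hW cW; rewrite -(circulant_side k.-1 cW) (weights_sym hW).
  by apply: weights_modr => //; rewrite prednK ?modnn ?mod0n //; lia.
have [->//|n1] := eqVneq d' 1%N.
have [->|n2] := eqVneq d' k.-1; first by rewrite !lastE.
have h2 : (2 <= d')%N by lia.
have hk : (d'.+1 < k)%N by lia.
have up : 0 < s 0%N d'.+1 by apply: spos; lia.
have lo : 0 < s 0%N d'.-1 by apply: spos; lia.
set r := D 0%N d' / _ in min *.
have r0 : 0 <= r by rewrite divr_ge0 ?(weights_ge0 _ _ hD) // ltW.
have mu : r * s 0%N d'.+1 <= D 0%N d'.+1.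
  by rewrite -ler_pdivlMr //; apply: min; lia.
have ml : r * s 0%N d'.-1 <= D 0%N d'.-1.
  by rewrite -ler_pdivlMr //; apply: min; lia.
have step := wmean_step hw hpw h2 hk; rewrite -/D in step.
have eD : D 0%N d' = r * s 0%N d' by rewrite /r divfK // lt0r_neq0.
have sstep : s 0%N d' ^+ 2 = s 0%N 1%N ^+ 2 + s 0%N d'.+1 * s 0%N d'.-1.
  have := hps 0%N d' h2 hk; rewrite add0n cs (circulant_side d' cs) => e.
  by rewrite !expr2 e -[in s 1%N _](@prednK d') ?cs //; lia.
have prod : r * s 0%N d'.+1 * (r * s 0%N d'.-1) <= D 0%N d'.+1 * D 0%N d'.-1.
  by apply: ler_pM => //; apply: mulr_ge0 => //; apply: ltW.
have : D 0%N 1%N ^+ 2 <= (r * s 0%N 1%N) ^+ 2.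
  have : (r * s 0%N d') ^+ 2 = (r * s 0%N 1%N) ^+ 2 + r * s 0%N d'.+1 * (r * s 0%N d'.-1).
    by rewrite exprMn sstep; ring.
  by move: step; rewrite eD; lra.
have rs : 0 <= r * s 0%N 1%N by exact: mulr_ge0 r0 (ltW s1).
have D1 : 0 <= D 0%N 1%N by exact: weights_ge0.
by rewrite ler_pXn2r // ler_pdivrMr.
Qed.

(** Equality at an interior diagonal d propagates to d - 1, hence down to d = 2.
    There superadditivity of the geometric mean is an equality, so that the terms
    of Ptolemy's relation for four consecutive vertices have constant ratios. *)
Lemma min_principle_eq w s d : weights w -> ptolemaic w ->
  weights s -> circulant s -> ptolemaic s -> (2 <= d)%N -> (d.+1 < k)%N ->
  s 0%N d * wmean w 0 1 = wmean w 0 d * s 0%N 1 ->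
  forall t, (t < k)%N ->
    w t t.+1 * w t.+2 t.+3 * s 0%N 2%N ^+ 2 =
    s 0%N 1%N ^+ 2 * (w t t.+2 * w t.+1 t.+3).
Proof.
move=> hw hpw hs cs hps d2 dk eqd.
have k0 : (0 < k)%N by lia.
have ge e (he : (0 < e < k)%N) := min_principle hw hpw hs cs hps he.
set D := wmean w in eqd ge *; have hD : weights D by exact: wmean_weights.
have cD : circulant D by exact: wmean_circulant.
have spos e : (0 < e < k)%N -> 0 < s 0%N e.
  by move=> he; apply: (weights_gt0 hs); rewrite mod0n modn_small; lia.
have s1 : 0 < s 0%N 1%N by apply: spos; lia.
have D1 : 0 < D 0%N 1%N.
  by apply: (weights_gt0 hD); rewrite mod0n modn_small; lia.
set c := D 0%N 1%N / s 0%N 1%N.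
have c0 : 0 < c by rewrite divr_gt0.
have Dge e : (0 < e < k)%N -> c * s 0%N e <= D 0%N e.
  by move=> he; rewrite /c mulrAC ler_pdivrMr // mulrC ge.
have cD1 : D 0%N 1%N = c * s 0%N 1%N by rewrite divfK // lt0r_neq0.
have {}eqd : D 0%N d = c * s 0%N d.
  apply: (mulIf (lt0r_neq0 s1)); rewrite -eqd cD1; ring.
have sstep e : (2 <= e)%N -> (e.+1 < k)%N ->
    s 0%N e ^+ 2 = s 0%N 1%N ^+ 2 + s 0%N e.+1 * s 0%N e.-1.
  move=> e2 ek; have := hps 0%N e e2 ek.
  rewrite add0n cs (circulant_side e cs) => h.
  by rewrite !expr2 h -[in s 1%N _](@prednK e) ?cs //; lia.
have Dstep e : (2 <= e)%N -> (e.+1 < k)%N ->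
    D 0%N 1%N ^+ 2 + D 0%N e.+1 * D 0%N e.-1 <= D 0%N e ^+ 2.
  exact: wmean_step.
(* at d.+1, the two recursions and c * s 0 d.+2 <= D 0 d.+2 bound D 0 d above *)
have eq2 : D 0%N 2%N = c * s 0%N 2%N.
  elim: d d2 dk eqd => // d IH; rewrite leq_eqVlt => /orP[/eqP <- //|d2] dk eqd.
  apply: IH => //; [by lia|]; apply/eqP; rewrite eq_le Dge ?andbT; last by lia.
  have up : 0 < s 0%N d.+2 by apply: spos; lia.
  have d2' : (2 <= d.+1)%N := ltnW d2.
  have := Dstep _ d2' dk; rewrite eqd exprMn (sstep _ d2' dk) cD1 exprMn /= => h.
  have h1 : c * s 0%N d.+2 * D 0%N d <= D 0%N d.+2 * D 0%N d.
    by rewrite ler_wpM2r ?(weights_ge0 _ _ hD) // Dge //; lia.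
  have h2 : c * s 0%N d.+2 * D 0%N d <= c * s 0%N d.+2 * (c * s 0%N d).
    apply: le_trans h1 _; move: h; rewrite mulrDr lerD2l => h.
    by apply: le_trans h _; rewrite le_eqVlt; apply/orP/or_introl/eqP; ring.
  by move: h2; rewrite ler_pM2l // mulr_gt0.
have k4 : (3 < k)%N by lia.
have w3 t : 0 < w t t.+3.
  by apply: (weights_gt0 hw); rewrite -{1}[t]addn0 -addn3 eqn_modDl mod0n modn_small.
have wS t : 0 < w t t.+1 by apply: (weights_gt0 hw); apply: neqmodS.
have w2 t : 0 < w t t.+2.
  by apply: (weights_gt0 hw); rewrite -{1}[t]addn0 -addn2 eqn_modDl mod0n modn_small //; lia.
pose f t := w t t.+1 * w t.+2 t.+3; pose g t := w t t.+3 * w t.+1 t.+2.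
have f0 t : 0 < f t by rewrite mulr_gt0.
have g0 t : 0 < g t by rewrite mulr_gt0.
have fg t : f t + g t = w t t.+2 * w t.+1 t.+3.
  by have := @hpw t 2%N isT k4; rewrite !addn2 => ->.
have ef : gmean k f = D 0%N 1%N ^+ 2.
  rewrite expr2 -{2}(circulant_side 2 cD).
  by apply: gmeanM => t; apply: weights_ge0.
have eg : gmean k g = D 0%N 3%N * D 0%N 1%N.
  rewrite -(circulant_side 1 cD).
  by apply: gmeanM => t; apply: weights_ge0.
have efg : gmean k (fun t => f t + g t) = D 0%N 2%N ^+ 2.
  rewrite (eq_gmean _ fg) expr2 -{2}(cD 0%N 2%N).
  by apply: gmeanM => t; apply: weights_ge0.
have tot : gmean k f + gmean k g = gmean k (fun t => f t + g t).
  apply/eqP; rewrite eq_le gmeanD //=; last first.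
  - by move=> t; rewrite addr_gt0.
  - by move=> t; apply: ltW.
  - by move=> t; apply: ltW.
  rewrite efg ef eg eq2 cD1 exprMn (sstep 2%N) //= mulrDr -exprMn -cD1 lerD2l.
  have h : c * s 0%N 3%N <= D 0%N 3%N by apply: Dge; lia.
  have := ler_wpM2r (ltW D1) h; rewrite {1}cD1.
  by apply: le_trans; rewrite le_eqVlt; apply/orP/or_introl/eqP; ring.
move=> t tk; have := gmeanD_eq k0 f0 g0 tot tk.
rewrite ef efg eq2 cD1 fg /f => h.
have w20 := lt0r_neq0 (w2 t); have w21 := lt0r_neq0 (w2 t.+1).
have s20 : s 0%N 2%N != 0 by rewrite lt0r_neq0 // spos //; lia.
have cn := lt0r_neq0 c0.
move/(congr1 (fun x => x * (w t t.+2 * w t.+1 t.+3) * s 0%N 2%N ^+ 2)): h.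
rewrite divfK ?mulf_neq0 // => ->; field.
by rewrite s20.
Qed.

End Weights.

(** * The recursion along a billiard trajectory *)

Section Families.
Variables (R : realType) (k n : nat).
Hypotheses (k3 : (3 <= k)%N) (n0 : (0 < n)%N).
Implicit Types (w s D : nat -> nat -> R) (b : nat -> nat) (u v : nat -> R).

(** The geodesic that hits the side b j has an ideal end beyond this side; u j
    and v j are the lambda lengths from this end to the ends b j and b j + 1 of
    the side.  The next geodesic is the mirror image in the side b j, and its end
    lies beyond the side b j.+1: the equations are Ptolemy's theorem for this end,
    the side b j.+1 and one end of the side b j.  Over one period of n reflections,
    the ends are the same, with light vectors scaled by mu ^- 2. *)
Record family w b (mu : R) u v : Prop := Family {
  family_gt0 : forall j, 0 < u j /\ 0 < v j;
  family_per : forall j, u (j + n)%N = mu^-1 * u j /\ v (j + n)%N = mu^-1 * v j;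
  family_u : forall j, u j * w (b j.+1) (b j.+1).+1 =
    u j.+1 * w (b j.+1).+1 (b j) + v j.+1 * w (b j.+1) (b j);
  family_v : forall j, v j * w (b j.+1) (b j.+1).+1 =
    u j.+1 * w (b j.+1).+1 (b j).+1 + v j.+1 * w (b j.+1) (b j).+1 }.

(** The labels go back and forth between two adjacent sides, so that the polygon
    is only seen to turn around their common vertex. *)
Definition alternating b (e : bool) := forall j,
  if odd j (+) e then b j.+1 = (b j).+1 %[mod k] else (b j.+1).+1 = b j %[mod k].

(** Turning around a vertex keeps its lambda length, which appears alternately as
    u j and v j; hence a solution with such labels is not scaled. *)
Lemma family_not_alternating w b mu u v e : weights k w -> 1 < mu ->
  family w b mu u v -> ~ alternating b e.
Proof.
move=> hw mu1 [pos per hu hv] alt.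
pose x j := if odd j (+) e then v j else u j.
have wS p : 0 < w p p.+1 by apply: (weights_gt0 hw); apply: neqmodS.
have xS j : x j.+1 = x j.
  rewrite /x /= addNb; have := alt j; case: (odd j (+) e) => /= h.
    have := hv j; rewrite (weights_modr (q := (b j).+1) (q' := b j.+1) _ hw) //.
    rewrite (weights_modr (q := (b j).+1) (q' := b j.+1) _ hw) //.
    rewrite (weights_diag hw) mulr0 addr0 (weights_sym hw (b j.+1).+1).
    by move/(mulIf (lt0r_neq0 (wS _))) => ->.
  have := hu j; rewrite (weights_modr (q := b j) (q' := (b j.+1).+1) _ hw) //.
  rewrite (weights_modr (q := b j) (q' := (b j.+1).+1) _ hw) //.
  by rewrite (weights_diag hw) mulr0 add0r => /(mulIf (lt0r_neq0 (wS _))) ->.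
have xm m j : x (m + j)%N = x j by elim: m => // m IH; rewrite addSn xS.
have mu0 : 0 < mu by apply: lt_trans mu1.
have : x (n + n)%N = mu^-1 * mu^-1 * x 0%N.
  rewrite /x oddD addbb addFb /=; have [u1 v1] := per n; have [u2 v2] := per 0%N.
  by move: u2 v2; rewrite add0n u1 v1 => -> ->; case: e {alt x xS xm}; rewrite mulrA.
rewrite -[in LHS](addn0 (n + n)%N) xm.
have x0 : x 0%N != 0 by rewrite /x; have [] := pos 0%N; case: ifP; lra.
rewrite -[LHS]mul1r => /(mulIf x0) h.
have : mu^-1 < 1 by rewrite invf_lt1.
have : 0 < mu^-1 by rewrite invr_gt0.
nra.
Qed.

(** Comparison of a solution u, v of the recursion for s with a supersolution u',
    v'.  The minimum m j of the two ratios does not increase with j, since the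
    coefficients are not negative; over one period it is multiplied by mu / mu'. *)
Section Compare.
Variables (s r : nat -> nat -> R) (b : nat -> nat) (mu mu' : R).
Variables (u v u' v' : nat -> R).
Hypotheses (hs : weights k s) (hb : forall j, b j != b j.+1 %[mod k]).
Hypotheses (mu0 : 0 < mu) (mu'0 : 0 < mu') (fam : family s b mu u v).
Hypothesis sr : forall p q, s p q <= r p q.
Hypothesis pos' : forall j, 0 < u' j /\ 0 < v' j.
Hypothesis per' : forall j, u' (j + n)%N = mu'^-1 * u' j /\ v' (j + n)%N = mu'^-1 * v' j.
Hypothesis hu' : forall j, u' j.+1 * r (b j.+1).+1 (b j) + v' j.+1 * r (b j.+1) (b j)
   <= u' j * s (b j.+1) (b j.+1).+1.
Hypothesis hv' : forall j,
  u' j.+1 * r (b j.+1).+1 (b j).+1 + v' j.+1 * r (b j.+1) (b j).+1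
   <= v' j * s (b j.+1) (b j.+1).+1.

Let m j := Num.min (u' j / u j) (v' j / v j).

Let m_gt0 j : 0 < m j.
Proof.
by rewrite lt_min !divr_gt0 //; have [] := family_gt0 fam j; have [] := pos' j.
Qed.

Let m_le j : m j * u j <= u' j /\ m j * v j <= v' j.
Proof.
have [a c] := family_gt0 fam j.
by split; rewrite -ler_pdivlMr // /m ge_min lexx ?orbT.
Qed.

Let sge0 p q : 0 <= s p q. Proof. exact: (weights_ge0 p q hs). Qed.
Let sS p : 0 < s p p.+1. Proof. by apply: (weights_gt0 hs); apply: neqmodS. Qed.

Let term x p q j (hx : 0 < x) (x' : R) : m j * x <= x' ->
  m j * (x * s p q) <= x' * r p q.
Proof.
move=> h; rewrite mulrA; apply: ler_pM => //.
by rewrite mulr_ge0 // ltW.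
Qed.

Let m_mono j : m j.+1 <= m j.
Proof.
have [a c] := family_gt0 fam j; have [a1 c1] := family_gt0 fam j.+1.
have [h1 h2] := m_le j.+1.
rewrite le_min !ler_pdivlMr //; apply/andP; split.
  rewrite -(ler_pM2r (sS (b j.+1))) -mulrA (family_u fam) mulrDr.
  apply: le_trans (hu' j); apply: lerD; exact: term.
rewrite -(ler_pM2r (sS (b j.+1))) -mulrA (family_v fam) mulrDr.
apply: le_trans (hv' j); apply: lerD; exact: term.
Qed.

Let m_per j : m (j + n)%N = mu'^-1 / mu^-1 * m j.
Proof.
have [e1 e2] := family_per fam j; have [e1' e2'] := per' j.
rewrite /m e1 e2 e1' e2' !invfM !invrK minr_pMr; last first.
  by rewrite mulr_ge0 ?invr_ge0 // ltW.
by congr (Num.min _ _); rewrite mulrACA.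
Qed.

Let m_antitone i j : m (j + i)%N <= m j.
Proof.
elim: i => [|i IH]; first by rewrite addn0.
by rewrite addnS; apply: le_trans (m_mono _) IH.
Qed.

Lemma family_le : mu <= mu'.
Proof.
have := m_antitone n 0; rewrite m_per -[leRHS]mul1r ler_pM2r // invrK.
by rewrite mulrC ler_pdivrMr // mul1r.
Qed.

(* In the case of equality the minimal ratio is constant, and every
   inequality used at a component realising it is an equality. *)
Hypothesis mu_eq : mu' = mu.

Let m_cst j : m j = m 0%N.
Proof.
have mul i : m (i * n)%N = m 0%N.
  elim: i => // i IH; rewrite mulSnr m_per mu_eq divff ?mul1r //.
  by rewrite invr_eq0 lt0r_neq0.
apply/eqP; rewrite eq_le; apply/andP; split; first exact: (m_antitone j 0).
have -> : m 0%N = m (j + (j * n - j))%N.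
  by rewrite subnKC ?mul // leq_pmulr.
exact: m_antitone.
Qed.

Let tight p q j x (x' y y' z z' : R) p' q' : 0 < x -> 0 < y -> 0 < z ->
  m j * x <= x' -> m j * y <= y' ->
  z * s (b j) (b j).+1 = x * s p q + y * s p' q' ->
  x' * r p q + y' * r p' q' <= z' * s (b j) (b j).+1 -> z' = m j * z ->
  [/\ m j * (x * s p q) = x' * r p q & m j * (y * s p' q') = y' * r p' q'].
Proof.
move=> x0 y0 z0 hx hy e h hz.
have t1 := term p q x0 hx; have t2 := term p' q' y0 hy.
have : m j * (x * s p q) + m j * (y * s p' q') = z' * s (b j) (b j).+1.
  by rewrite -mulrDr -e hz mulrA.
by move: h t1 t2 => h t1 t2 e'; split; lra.
Qed.

Let tight_eq p q j x x' : 0 < x -> m j * x <= x' ->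
  m j * (x * s p q) = x' * r p q -> r p q = s p q /\ (0 < s p q -> x' = m j * x).
Proof.
move=> x0 hx e; have mx : 0 < m j * x by rewrite mulr_gt0.
have x'0 : 0 < x' by apply: lt_le_trans mx hx.
have re : r p q = s p q.
  apply/eqP; rewrite eq_le sr andbT -(ler_pM2l x'0) -e mulrA.
  by rewrite ler_wpM2r.
split=> // sp; move: e; rewrite re mulrA => /(mulIf (lt0r_neq0 sp)) ->.
by [].
Qed.

(** If the ratio m is constant, start with a component that realises it.  All
    inequalities in its equation are equalities: the next pair has a component
    realising m again, and the two coefficients agree in r and s.  By hypothesis
    both belong to equal or adjacent indices, which for four or more sides only
    leaves the labels that turn around a vertex. *)
Lemma family_eq_alternating (k4 : (4 <= k)%N) :
  (forall p q, r p q = s p q ->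
     [\/ p = q %[mod k], p.+1 = q %[mod k] | p = q.+1 %[mod k]]) ->
  exists e, alternating b e.
Proof.
move=> hr.
have not3 p : p.+3 != p %[mod k].
  rewrite eq_sym; apply/negP => /eqP e; have : 0 = 3 %[mod k].
    by apply/eqP; rewrite -(eqn_modDl p) addn0 addn3 e.
  by rewrite mod0n modn_small; lia.
have eS p q : p = q %[mod k] -> p.+1 = q.+1 %[mod k].
  by move=> e; rewrite -(addn1 p) -(addn1 q) -modnDml e modnDml.
have Se p q : p.+1 = q.+1 %[mod k] -> p = q %[mod k].
  by move=> /eqP e; apply/eqP; rewrite -(eqn_modDr 1) !addn1.
have stepu j : u' j = m j * u j ->
    (b j.+1).+1 = b j %[mod k] /\ v' j.+1 = m j.+1 * v j.+1.
  move=> hj; have [a c] := family_gt0 fam j; have [a1 c1] := family_gt0 fam j.+1.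
  have [h1 h2] := m_le j.+1.
  have hj' : u' j = m j.+1 * u j by rewrite hj !m_cst.
  have [t1 t2] := tight a1 c1 a h1 h2 (family_u fam j) (hu' j) hj'.
  have [r1 _] := tight_eq a1 h1 t1; have [r2 s2] := tight_eq c1 h2 t2.
  have hbj : (b j.+1).+1 = b j %[mod k].
    case: (hr _ _ r2) => // e2; first by have := hb j; rewrite e2 eqxx.
    case: (hr _ _ r1) => // e1.
      have := not3 (b j); rewrite -e1; move/eS: (eS _ _ e2) => ->.
      by rewrite eqxx.
    by have := hb j; rewrite (Se _ _ e1) eqxx.
  split=> //; apply: s2; apply: (weights_gt0 hs); rewrite eq_sym; exact: hb.
have stepv j : v' j = m j * v j ->
    b j.+1 = (b j).+1 %[mod k] /\ u' j.+1 = m j.+1 * u j.+1.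
  move=> hj; have [a c] := family_gt0 fam j; have [a1 c1] := family_gt0 fam j.+1.
  have [h1 h2] := m_le j.+1.
  have hj' : v' j = m j.+1 * v j by rewrite hj !m_cst.
  have [t1 t2] := tight a1 c1 c h1 h2 (family_v fam j) (hv' j) hj'.
  have [r1 s1] := tight_eq a1 h1 t1; have [r2 _] := tight_eq c1 h2 t2.
  have hbj : b j.+1 = (b j).+1 %[mod k].
    case: (hr _ _ r2) => // e2; first by have := hb j; rewrite (Se _ _ e2) eqxx.
    case: (hr _ _ r1) => // e1; first by have := hb j; rewrite (Se _ _ e1) eqxx.
      by have := not3 (b j); rewrite -(eS _ _ e2) (Se _ _ e1) eqxx.
    exact: Se.
  split=> //; apply: s1; apply: (weights_gt0 hs).
  rewrite -(addn1 (b j.+1)) -(addn1 (b j)) eqn_modDr eq_sym; exact: hb.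
have init : exists e, if e then v' 0%N = m 0%N * v 0%N else u' 0%N = m 0%N * u 0%N.
  have [a c] := family_gt0 fam 0%N.
  rewrite /m /Num.min; case: ifP => _.
    by exists false; rewrite divfK // lt0r_neq0.
  by exists true; rewrite divfK // lt0r_neq0.
case: init => e he; exists e.
have all j : if odd j (+) e then v' j = m j * v j else u' j = m j * u j.
  elim: j => // j; rewrite /= addNb; case: (odd j (+) e) => /= h.
    by case: (stepv j h).
  by case: (stepu j h).
by move=> j; have := all j; case: ifP => _ h; [case: (stepv j h)|case: (stepu j h)].
Qed.

End Compare.

(** The geometric means of the solutions for all shifts of the labels are a
    supersolution for the circulant weights s: superadditivity of the mean gives
    the recursion with coefficients D, and the weights r, which are D scaled to
    agree with s on the sides, dominate s by the minimum principle. *)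
Section Mean.
Variables (w s : nat -> nat -> R) (b : nat -> nat) (mu : nat -> R) (mu0 : R).
Variables (U V : nat -> nat -> R) (u v : nat -> R).
Hypotheses (hw : weights k w) (hpw : ptolemaic k w).
Hypotheses (hs : weights k s) (cs : circulant s) (hps : ptolemaic k s).
Hypothesis hb : forall j, b j != b j.+1 %[mod k].
Hypotheses (mu0_gt0 : 0 < mu0) (mu_gt0 : forall t, 0 < mu t).
Hypothesis fam : family s b mu0 u v.
Hypothesis fams : forall t, family w (fun j => b j + t)%N (mu t) (U t) (V t).

Let k0 : (0 < k)%N. Proof. by lia. Qed.
Let D := wmean k w.
Let r p q := D p q * (s 0%N 1%N / D 0%N 1%N).
Let u' j := gmean k (fun t => U t j).
Let v' j := gmean k (fun t => V t j).

Let hD : weights k D. Proof. exact: wmean_weights. Qed.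
Let cD : circulant D. Proof. exact: wmean_circulant. Qed.
Let D1 : 0 < D 0%N 1%N.
Proof. by apply: (weights_gt0 hD); apply: neqmodS. Qed.
Let s1 : 0 < s 0%N 1%N.
Proof. by apply: (weights_gt0 hs); apply: neqmodS. Qed.

Let Ugt0 t j : 0 < U t j. Proof. by case: (family_gt0 (fams t) j). Qed.
Let Vgt0 t j : 0 < V t j. Proof. by case: (family_gt0 (fams t) j). Qed.

Let sr p q : s p q <= r p q.
Proof.
rewrite /r mulrA ler_pdivlMr // (circulantE k3 p q hD cD) (circulantE k3 p q hs cs).
set d := (_ %% _)%N; have dk : (d < k)%N by rewrite ltn_mod.
have [->|d0] := eqVneq d 0%N; first by rewrite (weights_diag hD) (weights_diag hs) !mul0r.
apply: min_principle => //; lia.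
Qed.

(* p and q are reduced to a pair 0, d; the last case is an interior diagonal *)
Let req p q : r p q = s p q ->
  [\/ p = q %[mod k], p.+1 = q %[mod k], p = q.+1 %[mod k]
    | exists d, [/\ (2 <= d)%N, (d.+1 < k)%N &
        s 0%N d * wmean k w 0 1 = wmean k w 0 d * s 0%N 1]].
Proof.
rewrite /r (circulantE k3 p q hD cD) (circulantE k3 p q hs cs).
set d := (_ %% _)%N; have dk : (d < k)%N by rewrite ltn_mod.
have qd : q = p + d %[mod k].
  by rewrite modnDmr subnKC; [rewrite addnC modnMDl|nia].
move=> e; have [d0|n0'] := eqVneq d 0%N; first by constructor 1; rewrite qd d0 addn0.
have [d1|n1] := eqVneq d 1%N; first by constructor 2; rewrite qd d1 addn1.
have [d2|n2] := eqVneq d k.-1.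
  constructor 3; rewrite -addn1 -modnDml qd modnDml d2 -addnA addn1 prednK //.
  by rewrite modnDr.
constructor 4; exists d; split; [lia|lia|].
by rewrite -e -/D mulrA divfK // lt0r_neq0.
Qed.

Let pos' j : 0 < u' j /\ 0 < v' j.
Proof. by split; apply: gmean_gt0. Qed.

Let per' j : u' (j + n)%N = (gmean k mu)^-1 * u' j /\
  v' (j + n)%N = (gmean k mu)^-1 * v' j.
Proof.
rewrite -gmeanV // /u' /v' -!gmeanM; try by move=> t; rewrite ?invr_ge0; apply: ltW.
by split; apply: eq_gmean => t; case: (family_per (fams t) j).
Qed.

Let mean_step (f g h : nat -> R) p q p' q' p'' : 
  (forall t, 0 < f t) -> (forall t, 0 < g t) ->
  (forall t, 0 < h t) ->
  (forall t, h t * w (p'' + t)%N (p'' + t).+1 =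
     f t * w (p + t)%N (q + t)%N + g t * w (p' + t)%N (q' + t)%N) ->
  gmean k f * r p q + gmean k g * r p' q' <= gmean k h * s p'' p''.+1.
Proof.
move=> f0 g0 h0 e; rewrite (circulant_side p'' cs).
have wge p1 q1 : 0 <= w p1 q1 by exact: (weights_ge0 p1 q1 hw).
have main : gmean k f * D p q + gmean k g * D p' q' <= gmean k h * D 0%N 1%N.
  rewrite -(circulant_side p'' cD) -!gmeanM //; try by move=> t; apply: ltW.
  rewrite -(eq_gmean _ (fun t => esym (e t))); apply: gmeanD => //.
  - by move=> t; rewrite mulr_ge0 // ltW.
  - by move=> t; rewrite mulr_ge0 // ltW.
  - by move=> t; rewrite -e mulr_gt0 // (weights_gt0 hw) // neqmodS.
have c0 : 0 <= s 0%N 1%N / D 0%N 1%N by rewrite divr_ge0 // ltW.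
have := ler_wpM2r c0 main; rewrite mulrDl /r !mulrA => /le_trans; apply.
rewrite le_eqVlt; apply/orP/or_introl/eqP; field.
exact: lt0r_neq0.
Qed.

Lemma mean_family_le : mu0 <= gmean k mu.
Proof.
apply: (family_le hs _ _ fam sr pos' per') => //.
- exact: gmean_gt0.
- by move=> j; apply: mean_step => // t; rewrite (family_u (fams t)).
- by move=> j; apply: mean_step => // t; rewrite (family_v (fams t)).
Qed.

(** If no interior diagonal of r agrees with s, then r and s only agree at equal
    or adjacent indices, and the labels alternate; otherwise min_principle_eq
    applies. *)
Lemma mean_family_eq : (4 <= k)%N -> gmean k mu = mu0 ->
  (forall e, ~ alternating b e) -> forall t, (t < k)%N ->
    w t t.+1 * w t.+2 t.+3 * s 0%N 2%N ^+ 2 =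
    s 0%N 1%N ^+ 2 * (w t t.+2 * w t.+1 t.+3).
Proof.
move=> k4 emu na.
case: (pselect (exists d, [/\ (2 <= d)%N, (d.+1 < k)%N &
        s 0%N d * wmean k w 0 1 = wmean k w 0 d * s 0%N 1])) => [[d [d2 dk ed]]|nd].
  exact: (min_principle_eq k3 hw hpw hs cs hps d2 dk ed).
have [e he] : exists e, alternating b e; last by case: (na e).
apply: (family_eq_alternating hs hb _ _ fam sr pos' per') => //.
- exact: gmean_gt0.
- by move=> j; apply: mean_step => // t; rewrite (family_u (fams t)).
- by move=> j; apply: mean_step => // t; rewrite (family_v (fams t)).
- move=> p q /req [||| ex]; [by constructor 1|by constructor 2|by constructor 3|].
  by case: nd.
Qed.

End Mean.
End Families.

(** * The hyperboloid model *)

Section Hyperboloid.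
Variable R : realType.
Implicit Types (p q : hplane R) (C D E F X Y : v3 R) (s t : R).

Definition cosh t : R := (expR t + expR (- t)) / 2.

Lemma coshN t : cosh (- t) = cosh t.
Proof. by rewrite /cosh opprK addrC. Qed.

Lemma cosh_norm t : cosh `|t| = cosh t.
Proof. by case: (ger0P t) => _; rewrite ?coshN. Qed.

Lemma expRVr t : expR (- t) * expR t = 1.
Proof. by rewrite mulrC expRxMexpNx_1. Qed.

Lemma arcosh_cosh t : arcosh (cosh t) = `|t|.
Proof.
rewrite -cosh_norm; move: (normr_ge0 t); move: `|t| => {}t t0.
rewrite /arcosh.
have -> : cosh t ^+ 2 - 1 = ((expR t - expR (- t)) / 2) ^+ 2.
  by rewrite /cosh expRN; field; rewrite lt0r_neq0 ?expR_gt0.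
rewrite sqrtr_sqr ger0_norm; last first.
  by rewrite divr_ge0 // subr_ge0 ler_expR; lra.
have -> : cosh t + (expR t - expR (- t)) / 2 = expR t by rewrite /cosh; field.
by rewrite expRK.
Qed.

Lemma cosh_arcosh t : 1 <= t -> cosh (arcosh t) = t /\ 0 <= arcosh t.
Proof.
move=> t1; have h : 0 <= t ^+ 2 - 1 by rewrite subr_ge0 exprn_ege1.
have s0 := sqrtr_ge0 (t ^+ 2 - 1); have s2 := sqr_sqrtr h.
have p : 0 < t + Num.sqrt (t ^+ 2 - 1) by lra.
rewrite /arcosh; split; last by apply: ln_ge0; lra.
rewrite /cosh expRN lnK ?posrE //.
set r := Num.sqrt _ in s0 s2 p *.
have e : (t + r) * (t - r) = 1 by rewrite mulrC -subr_sqr s2; ring.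
have -> : (t + r)^-1 = t - r.
  by apply: (mulfI (lt0r_neq0 p)); rewrite e divff // lt0r_neq0.
by field.
Qed.

(** The disc is projected to the hyperboloid from the point (-1, 0, 0); proj is
    the inverse projection. *)
Definition lift p : v3 R :=
  let d := 1 - normsq (sval p) in
  V3 ((1 + normsq (sval p)) / d) (2 * (sval p).1 / d) (2 * (sval p).2 / d).

Lemma normsq_lt1 p : 0 < 1 - normsq (sval p).
Proof. by rewrite subr_gt0; case: p. Qed.

Lemma normsq_ge0 (u : R * R) : 0 <= normsq u.
Proof. by rewrite /normsq /dot addr_ge0 // -expr2 sqr_ge0. Qed.

Lemma lift_hyp p : hyp (lift p).
Proof.
have h := normsq_lt1 p; have ne := lt0r_neq0 h; split; last first.
  by rewrite /= divr_gt0 // ltr_pwDl // normsq_ge0.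
move: ne; rewrite /ip /lift /= /normsq /dot => ne; by field; rewrite ?ne.
Qed.

Lemma ip_lift p q : ip (lift p) (lift q) =
  1 + 2 * normsq ((sval p).1 - (sval q).1, (sval p).2 - (sval q).2)
              / ((1 - normsq (sval p)) * (1 - normsq (sval q))).
Proof.
have np := lt0r_neq0 (normsq_lt1 p); have nq := lt0r_neq0 (normsq_lt1 q).
move: np nq; rewrite /ip /lift /= /normsq /dot /= => np nq; field.
by rewrite np nq.
Qed.

Lemma ip_lift_ge1 p q : 1 <= ip (lift p) (lift q).
Proof.
rewrite ip_lift lerDl divr_ge0 ?mulr_ge0 ?normsq_ge0 //; apply: ltW; exact: normsq_lt1.
Qed.

Lemma hdistE p q : hdist p q = arcosh (ip (lift p) (lift q)).
Proof. by rewrite ip_lift. Qed.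

Lemma cosh_hdist p q : cosh (hdist p q) = ip (lift p) (lift q).
Proof. by rewrite hdistE; case: (cosh_arcosh (ip_lift_ge1 p q)). Qed.

Lemma hdist_cosh p q t : ip (lift p) (lift q) = cosh t -> hdist p q = `|t|.
Proof. by rewrite hdistE => ->; exact: arcosh_cosh. Qed.

Lemma normsq0 : normsq (0, 0) < 1 :> R.
Proof. by rewrite /normsq /dot /= mulr0 addr0. Qed.

Definition proj C : hplane R :=
  insubd (exist (fun u => normsq u < 1) (0, 0) normsq0)
         (v1 C / (1 + v0 C), v2 C / (1 + v0 C)).

Lemma sval_proj C : hyp C ->
  sval (proj C) = (v1 C / (1 + v0 C), v2 C / (1 + v0 C)).
Proof.
move=> [c c0]; rewrite /proj; apply: (@insubdK _ _ (hplane R)).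
have n : 0 < (1 + v0 C) by lra.
rewrite -topredE /= /normsq /dot /=.
have -> : v1 C / (1 + v0 C) * (v1 C / (1 + v0 C)) + v2 C / (1 + v0 C) * (v2 C / (1 + v0 C))
    = (v1 C * v1 C + v2 C * v2 C) / (1 + v0 C) ^+ 2 by field; rewrite lt0r_neq0.
rewrite ltr_pdivrMr ?exprn_gt0 // mul1r.
by move: c; rewrite /ip; nra.
Qed.

Lemma lift_proj C : hyp C -> lift (proj C) = C.
Proof.
move=> hC; rewrite /lift sval_proj //; case: C hC => c0 c1 c2 [] /=; rewrite /ip /= => c p.
have n : 1 + c0 != 0 by lra.
have e : 1 - normsq (c1 / (1 + c0), c2 / (1 + c0)) = 2 / (1 + c0).
  rewrite /normsq /dot /=.
  have -> : c1 / (1 + c0) * (c1 / (1 + c0)) + c2 / (1 + c0) * (c2 / (1 + c0))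
    = (c1 * c1 + c2 * c2) / (1 + c0) ^+ 2 by field.
  have -> : c1 * c1 + c2 * c2 = c0 * c0 - 1 by lra.
  by field.
have e' : 1 + normsq (c1 / (1 + c0), c2 / (1 + c0)) = 2 * c0 / (1 + c0).
  have : normsq (c1 / (1 + c0), c2 / (1 + c0)) = 1 - 2 / (1 + c0) by rewrite -e; ring.
  by move=> ->; field.
by rewrite e e'; congr V3; field.
Qed.

Lemma proj_lift p : proj (lift p) = p.
Proof.
apply/val_inj; rewrite /= sval_proj; last exact: lift_hyp.
have ne := lt0r_neq0 (normsq_lt1 p); rewrite /lift /=.
have -> : 1 + (1 + normsq (sval p)) / (1 - normsq (sval p)) = 2 / (1 - normsq (sval p)).
  by field.
by rewrite [RHS]surjective_pairing; congr pair; field.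
Qed.

Lemma lift_inj : injective lift.
Proof. by apply: can_inj; exact: proj_lift. Qed.

(** A frame consists of the ends of a geodesic, normalised in such a way that
    seg E F is its parametrisation by arc length from F to E. *)
Definition frame E F := [/\ light E, light F & ip E F = 2^-1].
Definition pt E F s := vadd (vscale (expR s) E) (vscale (expR (- s)) F).
Definition seg E F s := proj (pt E F s).

Lemma ip_pt E F s t : frame E F -> ip (pt E F s) (pt E F t) = cosh (s - t).
Proof.
move=> [[e _] [f _] ef]; rewrite !ipDl !ipDr !ipZl !ipZr e f (ipC F E) ef /cosh.
by rewrite opprB !expRD; field.
Qed.

Lemma pt_hyp E F s : frame E F -> hyp (pt E F s).
Proof.
move=> fr; split; first by rewrite ip_pt // subrr /cosh oppr0 expR0; field.
case: fr => -[_ e] [_ f] _; by rewrite /= addr_gt0 // mulr_gt0 // expR_gt0.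
Qed.

Lemma lift_seg E F s : frame E F -> lift (seg E F s) = pt E F s.
Proof. by move=> fr; rewrite lift_proj //; exact: pt_hyp. Qed.

Lemma hdist_seg E F s t : frame E F -> hdist (seg E F s) (seg E F t) = `|s - t|.
Proof. by move=> fr; apply: hdist_cosh; rewrite !lift_seg // ip_pt. Qed.

Lemma null_forward X E : hyp X -> ip E E = 0 -> 0 < ip E X -> light E.
Proof.
move=> hX e ex; split => //; rewrite ltNge; apply/negP => h.
have [z|ne] := eqVneq (v0 E) 0.
  move: e; rewrite /ip z mul0r => e.
  have /eqP : v1 E ^+ 2 + v2 E ^+ 2 = 0 by rewrite -oppr0 -e; ring.
  rewrite paddr_eq0 ?sqr_ge0 // !sqrf_eq0 => /andP[/eqP e1 /eqP e2].
  by move: ex; rewrite /ip z e1 e2 !mul0r !subr0 ltxx.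
have lE : light (vscale (-1) E).
  split; first by rewrite ipZl ipZr e !mulr0.
  by rewrite /= mulN1r oppr_gt0 lt_neqAle ne.
by have := ip_hyp_light hX lE; rewrite ipZr (ipC X); lra.
Qed.

(** Two points determine the frame of a parametrised geodesic.  A point X with
    the right distances to both of them lies on it: the difference of X and
    the point of the geodesic is isotropic and orthogonal to C, hence zero. *)
Lemma frame_through C D a b : hyp C -> hyp D -> a != b -> ip C D = cosh (a - b) ->
  exists E F, [/\ frame E F, pt E F a = C, pt E F b = D
    & forall X s, hyp X -> ip X C = cosh (s - a) -> ip X D = cosh (s - b) ->
        X = pt E F s].
Proof.
move=> hC hD ab CD.
pose x := expR a; pose y := expR b.
have x0 : 0 < x := expR_gt0 a; have y0 : 0 < y := expR_gt0 b.
have xn := lt0r_neq0 x0; have yn := lt0r_neq0 y0.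
have xy : x != y by apply: contra_neq ab; exact: expR_inj.
have nd : y * y + - x * x != 0.
  have -> : y * y + - x * x = (y - x) * (y + x) by ring.
  rewrite mulf_neq0 //; first by rewrite subr_eq0 eq_sym.
  by rewrite lt0r_neq0 // addr_gt0.
pose d := y / x - x / y.
have dn : d != 0.
  have -> : d = (y * y + - x * x) / (x * y) by rewrite /d; field; rewrite xn yn.
  by rewrite mulf_neq0 // invr_eq0 mulf_neq0.
pose E := vscale d^-1 (vadd (vscale x^-1 D) (vscale (- y^-1) C)).
pose F := vscale d^-1 (vadd (vscale y C) (vscale (- x) D)).
case: (hC) (hD) => cc _ [dd _].
have CD' : ip C D = (x / y + y / x) / 2.
  by rewrite CD /cosh opprB !expRD !expRN.
have EE : ip E E = 0.
  rewrite !ipZl !ipZr !ipDl !ipDr !ipZl !ipZr cc dd (ipC D C) CD' /d.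
  by field; rewrite xn yn nd.
have FF : ip F F = 0.
  rewrite !ipZl !ipZr !ipDl !ipDr !ipZl !ipZr cc dd (ipC D C) CD' /d.
  by field; rewrite xn yn nd.
have EF : ip E F = 2^-1.
  rewrite !ipZl !ipZr !ipDl !ipDr !ipZl !ipZr cc dd (ipC D C) CD' /d.
  by field; rewrite xn yn nd.
have pa : pt E F a = C.
  rewrite /pt expRN -/x /E /F /vadd /vscale /= /d; case: (C) => c0 c1 c2 /=.
  by congr V3; field; rewrite xn yn nd.
have pb : pt E F b = D.
  rewrite /pt expRN -/y /E /F /vadd /vscale /= /d; case: (D) => c0 c1 c2 /=.
  by congr V3; field; rewrite xn yn nd.
have lE : light E.
  apply: (null_forward hC EE); rewrite -pa /pt ipDr (ipZr _ E E) (ipZr _ E F) EE EF mulr0 add0r.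
  by rewrite mulr_gt0 ?expR_gt0 // invr_gt0.
have lF : light F.
  apply: (null_forward hC FF); rewrite -pa /pt ipDr (ipZr _ F E) (ipZr _ F F) FF (ipC F) EF mulr0 addr0.
  by rewrite mulr_gt0 ?expR_gt0 // invr_gt0.
have fr : frame E F by [].
exists E, F; split=> // X s hX XC XD.
have [xx _] := hX.
have hC' : ip (pt E F s) C = cosh (s - a) by rewrite -pa ip_pt.
have hD' : ip (pt E F s) D = cosh (s - b) by rewrite -pb ip_pt.
have span Z W : ip Z C = ip W C -> ip Z D = ip W D ->
    ip Z (pt E F s) = ip W (pt E F s).
  by move=> zc zd; rewrite /pt /E /F !(ipDr, ipZr) zc zd.
have hp : ip (pt E F s) (pt E F s) = 1 by have [] := pt_hyp s fr.
have Xp : ip X (pt E F s) = 1 by rewrite (span X (pt E F s)) ?hp ?XC ?XD ?hC' ?hD'.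
pose Z := vadd X (vscale (-1) (pt E F s)).
have Z0 : Z = V3 0 0 0.
  apply: (hyp_orth hC).
    by rewrite /Z ipDl ipZl XC hC'; ring.
  by rewrite /Z !ipDl !ipDr !ipZl !ipZr hp xx Xp (ipC _ X) Xp; ring.
move: Z0; rewrite /Z /vadd /vscale; case: (pt E F s) X {hX XC XD xx Xp Z} => ? ? ? [? ? ?] /=.
by case=> *; congr V3; lra.
Qed.

Lemma geodesic_frame (c : R -> hplane R) : geodesic_line c ->
  exists E F, frame E F /\ forall s, lift (c s) = pt E F s.
Proof.
move=> hc; have ipc s t : ip (lift (c s)) (lift (c t)) = cosh (s - t).
  by rewrite -cosh_hdist hc cosh_norm.
have [|E [F [fr _ _ h]]] := frame_through (lift_hyp (c 0)) (lift_hyp (c 1)) _ (ipc 0 1).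
  by rewrite eq_sym oner_neq0.
by exists E, F; split=> // s; apply: h => //; exact: lift_hyp.
Qed.

End Hyperboloid.

(** * Ends and velocities of geodesics *)

Section Limits.
Variable R : realType.
Implicit Types (C D E F X Y : v3 R) (s t : R).

Lemma cvg_near_eq (G : set_system R) {FG : Filter G} (f g : R -> R) (l : R) :
  (\forall s \near G, f s = g s) -> f s @[s --> G] --> l -> g s @[s --> G] --> l.
Proof.
by move=> e; apply: cvg_trans; apply: near_eq_cvg; apply: filterS e => s ->.
Qed.

Lemma cvg_quotient (G : set_system R) {FG : Filter G} (f g : R -> R) (a b : R) :
  b != 0 -> f s @[s --> G] --> a -> g s @[s --> G] --> b ->
  (f s / g s) @[s --> G] --> a / b.
Proof. by move=> b0 ha hb; apply: cvgM => //; exact: cvgV. Qed.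

Lemma expR_quot t : h^-1 * (expR (t + h) - expR t) @[h --> 0^'] --> expR t.
Proof.
have e := congr1 (fun f => f t) (@derive_expR R).
have d : h^-1 *: ((expR \o shift t) (h *: (1:R)) - expR t) @[h --> (0:R)^'] --> expR t.
  rewrite -[X in _ --> X]e; exact: derivable_expR.
move: d; apply: cvg_trans; apply: near_eq_cvg; apply: nearW => h /=.
by rewrite /GRing.scale /= mulr1 (addrC h t).
Qed.

Lemma expRN_quot t :
  h^-1 * (expR (- (t + h)) - expR (- t)) @[h --> 0^'] --> - expR (- t).
Proof.
have h1 := @expR_quot (- t).
have h2 : (- x : R) @[x --> (0 : R)^'] --> (0 : R)^'.
  move=> A; rewrite !nbhs_nearE !near_withinE => -[e /= e0 hA].
  exists e => // x /= xe x0; apply: hA => /=; last by rewrite oppr_eq0.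
  by move: xe; rewrite !sub0r opprK normrN.
have h3 : - ((- x)^-1 * (expR (- t + - x) - expR (- t))) @[x --> (0 : R)^']
    --> - expR (- t).
  by apply: cvgN; exact: (cvg_comp _ _ h2 h1).
move: h3; apply: cvg_trans; apply: near_eq_cvg.
by apply: nearW => h /=; rewrite opprD invrN mulNr opprK.
Qed.

Lemma cvg_coord (G : set_system R) (c : R -> R * R) (y : R * R) : Filter G ->
  c s @[s --> G] --> y -> (c s).1 @[s --> G] --> y.1 /\ (c s).2 @[s --> G] --> y.2.
Proof.
move=> FF h; case: y h => y1 y2 h; split.
  exact: (cvg_comp _ _ h (@cvg_fst _ _ _ _ _)).
exact: (cvg_comp _ _ h (@cvg_snd _ _ _ _ _)).
Qed.

Lemma coord_cvg (G : set_system R) (c : R -> R * R) (y : R * R) : Filter G ->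
  (c s).1 @[s --> G] --> y.1 -> (c s).2 @[s --> G] --> y.2 -> c s @[s --> G] --> y.
Proof.
move=> FF h1 h2; case: y h1 h2 => y1 y2 h1 h2.
have h : ((c s).1, (c s).2) @[s --> G] --> (y1, y2) by exact: cvg_pair h1 h2.
move: h; apply: cvg_trans; apply: near_eq_cvg; apply: nearW => s.
by case: (c s).
Qed.

Lemma real_cvg_unique (G : set_system R) (f : R -> R) (a b : R) : ProperFilter G ->
  f s @[s --> G] --> a -> f s @[s --> G] --> b -> a = b.
Proof. by move=> FG; apply: cvg_unique; exact: Rhausdorff. Qed.

(** The ideal point of a light vector. *)
Definition idp E : R * R := (v1 E / v0 E, v2 E / v0 E).

Let ratio_cvg (e0 e1 f0 f1 : R) : 0 < e0 -> 
  (expR s * e1 + expR (- s) * f1) / (1 + (expR s * e0 + expR (- s) * f0)) 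
    @[s --> +oo] --> e1 / e0.
Proof.
move=> p; have x0 := @cvgr_expR R.
have xx : (expR (- s) * expR (- s)) @[s --> +oo] --> (0 * 0 : R) by exact: cvgM.
have num : (e1 + expR (- s) * expR (- s) * f1) @[s --> +oo] --> e1 + 0 * 0 * f1.
  by apply: cvgD; [exact: cvg_cst|apply: cvgM => //; exact: cvg_cst].
have den : (expR (- s) + e0 + expR (- s) * expR (- s) * f0) @[s --> +oo]
    --> 0 + e0 + 0 * 0 * f0.
  apply: cvgD; first by apply: cvgD => //; exact: cvg_cst.
  by apply: cvgM => //; exact: cvg_cst.
have dn : 0 + e0 + 0 * 0 * f0 != 0 by rewrite !mul0r add0r addr0 lt0r_neq0.
have H : ((e1 + expR (- s) * expR (- s) * f1) /
      (expR (- s) + e0 + expR (- s) * expR (- s) * f0)) @[s --> +oo] -->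
    (e1 + 0 * 0 * f1) / (0 + e0 + 0 * 0 * f0) by exact: cvg_quotient.
rewrite !mul0r !addr0 add0r in H; apply: (cvg_near_eq _ H).
apply: nearW => s /=; have sp := expR_gt0 s.
have -> : expR s * e1 + expR (- s) * f1 =
    expR s * (e1 + expR (- s) * expR (- s) * f1).
  rewrite mulrDr; congr (_ + _); rewrite !mulrA expRxMexpNx_1; ring.
have -> : 1 + (expR s * e0 + expR (- s) * f0) =
    expR s * (expR (- s) + e0 + expR (- s) * expR (- s) * f0).
  rewrite !mulrDr !mulrA expRxMexpNx_1; ring.
by rewrite -[RHS]mulf_div divff ?mul1r // lt0r_neq0.
Qed.

Lemma seg_cvgy E F : frame E F -> sval (seg E F s) @[s --> +oo] --> idp E.
Proof.
move=> fr; have [[_ e0] _ _] := fr.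
have e s : sval (seg E F s) = (v1 (pt E F s) / (1 + v0 (pt E F s)),
                               v2 (pt E F s) / (1 + v0 (pt E F s))).
  by rewrite sval_proj //; exact: pt_hyp.
apply: coord_cvg; under eq_cvg do rewrite e /=; exact: ratio_cvg.
Qed.

Lemma segN E F s : seg E F (- s) = seg F E s.
Proof.
rewrite /seg /pt opprK; congr proj; rewrite /vadd /=; congr V3; exact: addrC.
Qed.

Lemma frame_sym E F : frame E F -> frame F E.
Proof. by move=> [e f ef]; split; rewrite // ipC. Qed.

Lemma seg_cvgNy E F : frame E F -> sval (seg E F s) @[s --> -oo] --> idp F.
Proof.
move=> fr; apply/cvgNy_compNP; under eq_cvg do rewrite /= segN.
exact/seg_cvgy/frame_sym.
Qed.

Lemma seg_geodesic E F : frame E F -> geodesic_line (seg E F).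
Proof. by move=> fr s t; exact: hdist_seg. Qed.

(** Together with joins_frame, this identifies the geodesics from x to y with the
    frames with ends over x and y. *)
Lemma joins_seg E F : frame E F -> joins (seg E F) (idp F) (idp E).
Proof.
move=> fr; split; first exact: seg_geodesic.
by split; [exact: seg_cvgNy | exact: seg_cvgy].
Qed.

Lemma joins_frame (c : R -> hplane R) x y : joins c x y ->
  exists E F, [/\ frame E F, forall s, lift (c s) = pt E F s, idp F = x & idp E = y].
Proof.
move=> [/geodesic_frame [E [F [fr hc]]] [hx hy]]; exists E, F.
have ec s : c s = seg E F s by rewrite /seg -hc proj_lift.
have h1 := seg_cvgNy fr; have h2 := seg_cvgy fr.
move: hx hy; under eq_cvg do rewrite ec; under [X in _ -> X -> _]eq_cvg do rewrite ec.
move=> hx hy; split => //.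
  have [a1 a2] := cvg_coord _ h1; have [b1 b2] := cvg_coord _ hx.
  by case: x {hx} b1 b2 => ? ? b1 b2; congr pair; [apply: real_cvg_unique a1 b1|apply: real_cvg_unique a2 b2].
have [a1 a2] := cvg_coord _ h2; have [b1 b2] := cvg_coord _ hy.
by case: y {hy} b1 b2 => ? ? b1 b2; congr pair; [apply: real_cvg_unique a1 b1|apply: real_cvg_unique a2 b2].
Qed.

(** tangent E F s is the derivative of pt E F s, and dproj C is the differential
    of the projection to the disc at C, by the quotient rule. *)
Definition tangent E F s := vadd (vscale (expR s) E) (vscale (- expR (- s)) F).
Definition dproj C V : R * R :=
  let d := 1 + v0 C in
  ((v1 V * d - v1 C * v0 V) / d ^+ 2, (v2 V * d - v2 C * v0 V) / d ^+ 2).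

Let quot_cvg (e0 e1 f0 f1 : R) t :
  let N s := expR s * e1 + expR (- s) * f1 in
  let M s := 1 + (expR s * e0 + expR (- s) * f0) in
  (forall s, 0 < M s) ->
  h^-1 * (N (t + h) / M (t + h) - N t / M t) @[h --> 0^'] -->
  ((expR t * e1 + - expR (- t) * f1) * M t
     - N t * (expR t * e0 + - expR (- t) * f0)) / M t ^+ 2.
Proof.
move=> N M M0.
pose q h := h^-1 * (expR (t + h) - expR t).
pose q' h := h^-1 * (expR (- (t + h)) - expR (- t)).
have cq : q h @[h --> 0^'] --> expR t by exact: expR_quot.
have cq' : q' h @[h --> 0^'] --> - expR (- t) by exact: expRN_quot.
have lin (a b : R) : (q h * a + q' h * b) @[h --> 0^'] --> expR t * a + - expR (- t) * b.
  by apply: cvgD; apply: cvgM => //; exact: cvg_cst.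
have c0 : (h : R) @[h --> (0 : R)^'] --> (0 : R).
  by apply: cvg_within.
have num : ((q h * e1 + q' h * f1) * M t - N t * (q h * e0 + q' h * f0)) @[h --> 0^'] -->
    (expR t * e1 + - expR (- t) * f1) * M t - N t * (expR t * e0 + - expR (- t) * f0).
  by apply: cvgB; apply: cvgM => //; try exact: cvg_cst; exact: lin.
have den : ((M t + h * (q h * e0 + q' h * f0)) * M t) @[h --> 0^'] -->
    (M t + 0 * (expR t * e0 + - expR (- t) * f0)) * M t.
  apply: cvgM; last exact: cvg_cst.
  apply: cvgD; first exact: cvg_cst.
  apply: cvgM => //; exact: lin.
have Mn := lt0r_neq0 (M0 t).
have dn : (M t + 0 * (expR t * e0 + - expR (- t) * f0)) * M t != 0.
  by rewrite mul0r addr0 mulf_neq0.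
have H : (((q h * e1 + q' h * f1) * M t - N t * (q h * e0 + q' h * f0)) /
     ((M t + h * (q h * e0 + q' h * f0)) * M t)) @[h --> (0 : R)^'] -->
    ((expR t * e1 + - expR (- t) * f1) * M t
       - N t * (expR t * e0 + - expR (- t) * f0)) /
    ((M t + 0 * (expR t * e0 + - expR (- t) * f0)) * M t) by exact: cvg_quotient.
rewrite mul0r addr0 -expr2 in H.
apply: (cvg_near_eq _ H); near=> h => /=.
have hn : h != 0 by near: h; exact: nbhs_dnbhs_neq.
have qe (a b : R) : q h * a + q' h * b =
    h^-1 * ((expR (t + h) * a + expR (- (t + h)) * b) - (expR t * a + expR (- t) * b)).
  by rewrite /q /q'; ring.
have eM : M t + h * (q h * e0 + q' h * f0) = M (t + h).
  by rewrite qe mulrA divff // mul1r /M; ring.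
have Mn' := lt0r_neq0 (M0 (t + h)).
rewrite eM (qe e1 f1) -/(N t) -/(N (t + h)).
have -> : q h * e0 + q' h * f0 = h^-1 * (M (t + h) - M t).
  by rewrite qe /M; ring.
by field; rewrite hn Mn Mn'.
Unshelve. all: by end_near.
Qed.

Lemma velocity_seg (G : set_system R) (c : R -> hplane R) E F t : ProperFilter G ->
  G `=>` (0 : R)^' -> frame E F -> c t = seg E F t ->
  (\forall h \near G, c (t + h) = seg E F (t + h)) ->
  velocity G c t (dproj (pt E F t) (tangent E F t)).
Proof.
move=> FG hG fr ct hc.
have e s : sval (seg E F s) = (v1 (pt E F s) / (1 + v0 (pt E F s)),
                               v2 (pt E F s) / (1 + v0 (pt E F s))).
  by rewrite sval_proj //; exact: pt_hyp.
have M0 s : 0 < 1 + (expR s * v0 E + expR (- s) * v0 F).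
  by have [_] := pt_hyp s fr; rewrite /= => h; lra.
split.
  have H := cvg_trans (cvg_app _ hG) (@quot_cvg _ (v1 E) _ (v1 F) t M0).
  by apply: (cvg_near_eq _ H); apply: filterS hc => h eh; rewrite ct eh !e.
have H := cvg_trans (cvg_app _ hG) (@quot_cvg _ (v2 E) _ (v2 F) t M0).
by apply: (cvg_near_eq _ H); apply: filterS hc => h eh; rewrite ct eh !e.
Qed.

Lemma velocity_unique (G : set_system R) (c : R -> hplane R) t v w :
  ProperFilter G -> velocity G c t v -> velocity G c t w -> v = w.
Proof.
move=> FG; case: v w => [a b] [a' b'] [/= h1 h2] [/= h3 h4].
by congr pair; [apply: real_cvg_unique h1 h3|apply: real_cvg_unique h2 h4].
Qed.
End Limits.

(** * Reflections *)

Section Reflection.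
Variable R : rcfType.
Implicit Types (A B C D E F X Y Z U V W : v3 R) (a b s t : R).

(** The reflection of Lorentz space in the plane spanned by A and B. *)
Definition refl A B Z := vadd (vadd (vscale (2 * ip Z B / ip A B) A)
  (vscale (2 * ip Z A / ip A B) B)) (vscale (-1) Z).

Lemma reflD A B Z W : refl A B (vadd Z W) = vadd (refl A B Z) (refl A B W).
Proof. rewrite /refl !ipDl /vadd /vscale /=; congr V3; ring. Qed.

Lemma reflZ A B a Z : refl A B (vscale a Z) = vscale a (refl A B Z).
Proof. rewrite /refl !ipZl /vadd /vscale /=; congr V3; ring. Qed.

Lemma refl_scale A B a b Z : a != 0 -> b != 0 -> ip A B != 0 ->
  refl (vscale a A) (vscale b B) Z = refl A B Z.
Proof.
move=> a0 b0 m; rewrite /refl !ipZl !ipZr /vadd /vscale /=.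
by congr V3; field; rewrite a0 b0 m.
Qed.

Section Fixed.
Variables A B : v3 R.
Hypotheses (aa : ip A A = 0) (bb : ip B B = 0) (ab : ip A B != 0).

Lemma refl_l : refl A B A = A.
Proof.
rewrite /refl aa; move: ab; move: (ip A B) => m m0; rewrite /vadd /vscale.
by case: (A) (B) => ? ? ? [? ? ?] /=; congr V3; field.
Qed.

Lemma refl_r : refl A B B = B.
Proof.
rewrite /refl bb (ipC B A); move: ab; move: (ip A B) => m m0; rewrite /vadd /vscale.
by case: (A) (B) => ? ? ? [? ? ?] /=; congr V3; field.
Qed.

Lemma ip_refl Z W : ip (refl A B Z) (refl A B W) = ip Z W.
Proof.
rewrite /refl !(ipDl, ipDr, ipZl, ipZr) aa bb (ipC B A) (ipC A W) (ipC B W).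
by field.
Qed.

Lemma ip_refl_l Z : ip (refl A B Z) A = ip Z A.
Proof. by rewrite -{2}refl_l ip_refl. Qed.
Lemma ip_refl_r Z : ip (refl A B Z) B = ip Z B.
Proof. by rewrite -{2}refl_r ip_refl. Qed.

Lemma reflK Z : refl A B (refl A B Z) = Z.
Proof.
rewrite {1}/refl ip_refl_l ip_refl_r /refl /vadd /vscale /=.
by case: (Z) => *; congr V3 => /=; ring.
Qed.
End Fixed.

Lemma det3_refl A B Z : det3 A B (refl A B Z) = - det3 A B Z.
Proof. by rewrite /refl !det3D !det3Z det3_aba det3_abb; ring. Qed.

Lemma refl_light A B E : light A -> light B -> light E -> ip A B != 0 ->
  0 < ip E A -> light (refl A B E).
Proof.
move=> lA lB lE m h; have [a _] := lA; have [b _] := lB; have [e _] := lE.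
by apply: (light_forward lA); rewrite ?ip_refl // ip_refl_l.
Qed.

(** The tangent plane at X projects to the plane of the last two coordinates with
    Jacobian v0 X. *)
Lemma hyp_cross X U V : hyp X -> ip U X = 0 -> ip V X = 0 ->
  v1 U * v2 V - v2 U * v1 V = v0 X * det3 X U V.
Proof.
case: X U V => [x0 x1 x2] [u0 u1 u2] [w0 w1 w2] [] /=; rewrite /ip /det3 /= => x _ u w.
have xx : x0 * x0 = 1 + x1 * x1 + x2 * x2 by lra.
have uu : u0 * x0 = u1 * x1 + u2 * x2 by lra.
have ww : w0 * x0 = w1 * x1 + w2 * x2 by lra.
transitivity (x0 * x0 * (u1 * w2 - u2 * w1) - u0 * x0 * (x1 * w2 - x2 * w1)
   - w0 * x0 * (x2 * u1 - x1 * u2)); first by rewrite xx uu ww; ring.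
ring.
Qed.

(** The difference of Z and W is orthogonal to X, and isotropic by the Gram
    identity. *)
Lemma tangent_ext X U Z W : hyp X -> ip U X = 0 -> ip U U = -1 ->
  ip Z X = ip W X -> ip Z U = ip W U -> det3 X U Z = det3 X U W -> Z = W.
Proof.
move=> hX ux uu zx zu zd; pose V := vadd Z (vscale (-1) W).
have vx : ip V X = 0 by rewrite /V ipDl ipZl zx; ring.
have vu : ip V U = 0 by rewrite /V ipDl ipZl zu; ring.
have vd : det3 X U V = 0 by rewrite /V det3D det3Z zd; ring.
have [xx _] := hX.
have vv : ip V V = 0.
  have := det3_gram X U V; rewrite vd (ipC U V) (ipC X V) (ipC X U) xx uu vx vu ux; lra.
have := hyp_orth hX vx vv; rewrite /V /vadd /vscale.
by case: (Z) (W) => ? ? ? [? ? ?] /= [*]; congr V3; lra.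
Qed.
End Reflection.

Section ReflectionLaw.
Variable R : realType.
Implicit Types (A B C D E F X Y Z U V W : v3 R) (s t : R).

(** The disc model is conformal. *)
Lemma dot_dproj X V W : hyp X -> ip V X = 0 -> ip W X = 0 ->
  dot (dproj X V) (dproj X W) = - ip V W / (1 + v0 X) ^+ 2.
Proof.
case: X V W => [x0 x1 x2] [u0 u1 u2] [w0 w1 w2] [] /=; rewrite /ip /= => x p u w.
rewrite /dot /dproj /=; have n : 1 + x0 != 0 by lra.
have xx : x1 * x1 + x2 * x2 = x0 * x0 - 1 by lra.
have uu : u1 * x1 + u2 * x2 = u0 * x0 by lra.
have ww : w1 * x1 + w2 * x2 = w0 * x0 by lra.
transitivity (((1 + x0) ^+ 2 * (u1 * w1 + u2 * w2)
  - (1 + x0) * (w0 * (u1 * x1 + u2 * x2) + u0 * (w1 * x1 + w2 * x2))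
  + u0 * w0 * (x1 * x1 + x2 * x2)) / (1 + x0) ^+ 4); first by field.
by rewrite xx uu ww; field.
Qed.

Lemma cross_dproj X V W : hyp X -> ip V X = 0 -> ip W X = 0 ->
  cross (dproj X V) (dproj X W) = det3 X V W / (1 + v0 X) ^+ 2.
Proof.
move=> hX vx wx; have := hyp_cross hX vx wx; move: hX vx wx.
case: X V W => [x0 x1 x2] [u0 u1 u2] [w0 w1 w2] [] /=; rewrite /ip /det3 /= => x p u w.
rewrite /cross /dproj /= => h; have n : 1 + x0 != 0 by lra.
set D := (X in _ = x0 * X) in h; rewrite -/D.
transitivity ((D + (u1 * w2 - u2 * w1)) / (1 + x0) ^+ 3).
  by rewrite /D; field.
by rewrite h; field.
Qed.

Lemma ip_tangent_pt E F t : frame E F -> ip (tangent E F t) (pt E F t) = 0.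
Proof.
move=> [[e _] [f _] ef]; rewrite !(ipDl, ipDr, ipZl, ipZr) e f (ipC F) ef.
by rewrite expRN; field; rewrite lt0r_neq0 ?expR_gt0.
Qed.

Lemma ip_tangent E F t : frame E F -> ip (tangent E F t) (tangent E F t) = -1.
Proof.
move=> [[e _] [f _] ef]; rewrite !(ipDl, ipDr, ipZl, ipZr) e f (ipC F) ef.
by rewrite expRN; field; rewrite lt0r_neq0 ?expR_gt0.
Qed.

Lemma refl_pt A B E F t :
  refl A B (pt E F t) = pt (refl A B E) (refl A B F) t.
Proof. by rewrite /pt reflD !reflZ. Qed.
Lemma refl_tangent A B E F t :
  refl A B (tangent E F t) = tangent (refl A B E) (refl A B F) t.
Proof. by rewrite /tangent reflD !reflZ. Qed.

Lemma pt_tangent_inj E F E' F' t : pt E F t = pt E' F' t ->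
  tangent E F t = tangent E' F' t -> E = E' /\ F = F'.
Proof.
rewrite /pt /tangent expRN /vadd /vscale.
have p := expR_gt0 t; have n := lt0r_neq0 p.
case: E F E' F' => ? ? ? [? ? ?] [? ? ?] [? ? ?] /= [a1 a2 a3] [b1 b2 b3].
have i0 : (expR t)^-1 != 0 by rewrite invr_eq0.
split; congr V3.
- by apply: (mulfI n); lra.
- by apply: (mulfI n); lra.
- by apply: (mulfI n); lra.
- by apply: (mulfI i0); lra.
- by apply: (mulfI i0); lra.
- by apply: (mulfI i0); lra.
Qed.

(** Since the disc model is conformal, the two conditions of the law of reflection
    fix the products of the outgoing tangent vector with the tangent vector of
    the side, and its determinant with p and this vector; the mirror image of the
    incoming vector has the same ones. *)
Lemma reflection_law A B E F E' F' s t : frame A B -> frame E F -> frame E' F' ->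
  pt A B s = pt E F t -> pt E' F' t = pt E F t ->
  let p := pt E F t in
  let u := dproj p (tangent A B s) in
  let v := dproj p (tangent E F t) in
  let w := dproj p (tangent E' F' t) in
  (dot w u = dot v u /\ cross u w = - cross u v) <->
  (E' = refl B A E /\ F' = refl B A F).
Proof.
move=> fA fE fE' eA eE' p u v w.
have hp : hyp p by exact: pt_hyp.
have ux : ip (tangent A B s) p = 0 by rewrite /p -eA ip_tangent_pt.
have vx : ip (tangent E F t) p = 0 by exact: ip_tangent_pt.
have wx : ip (tangent E' F' t) p = 0 by rewrite /p -eE' ip_tangent_pt.
have d0 : (1 + v0 p) ^+ 2 != 0 by rewrite expf_neq0 // lt0r_neq0 //; case: hp => _; lra.
have dV : ((1 + v0 p) ^+ 2)^-1 != 0 by rewrite invr_eq0.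
have [[aa _] [bb _] ab] := fA.
have abn : ip B A != 0 by rewrite ipC ab invr_eq0.
have fixA : refl B A A = A by apply: refl_r.
have fixB : refl B A B = B by apply: refl_l.
have fixX : refl B A p = p by rewrite /p -eA refl_pt fixA fixB.
have fixU : refl B A (tangent A B s) = tangent A B s.
  by rewrite refl_tangent fixA fixB.
have mx : ip (refl B A (tangent E F t)) p = 0 by rewrite -fixX ip_refl.
have mu : ip (refl B A (tangent E F t)) (tangent A B s) =
    ip (tangent E F t) (tangent A B s) by rewrite -{1}fixU ip_refl.
have md Z : det3 p (tangent A B s) (refl B A Z) = - det3 p (tangent A B s) Z.
  rewrite /refl !det3D !det3Z.
  have zz C : C = A \/ C = B -> det3 p (tangent A B s) C = 0.
    by rewrite /p -eA /pt /tangent => -[]->; rewrite /det3 /=; ring.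
  by rewrite (zz A (or_introl erefl)) (zz B (or_intror erefl)); ring.
rewrite /u /v /w !dot_dproj // !cross_dproj //; split.
  move=> [h1 h2].
  have {}h1 : ip (tangent E' F' t) (tangent A B s) = ip (tangent E F t) (tangent A B s).
    by move/(mulIf dV): h1 => /oppr_inj.
  have {}h2 : det3 p (tangent A B s) (tangent E' F' t) =
      - det3 p (tangent A B s) (tangent E F t).
    by apply: (mulIf dV); rewrite mulNr.
  have uu : ip (tangent A B s) (tangent A B s) = -1 by exact: ip_tangent.
  have e : tangent E' F' t = refl B A (tangent E F t).
    apply: (tangent_ext hp ux uu); rewrite ?wx ?mx ?h1 ?mu // h2 md //.
  rewrite refl_tangent in e; apply: pt_tangent_inj e.
  by rewrite eE' -refl_pt.
move=> [-> ->]; rewrite -refl_tangent mu md !mulNr; by split.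
Qed.
End ReflectionLaw.

(** * Sides and half-planes *)

Section Sides.
Variables (R : realType) (k : nat).
Hypothesis k3 : (3 <= k)%N.
Implicit Types (C D E F X : v3 R) (p q : hplane R).

Definition lightpt (u : R * R) : v3 R := V3 1 u.1 u.2.

(** Y represents the vertices of the polygon x by light vectors. *)
Definition reps (x : 'I_k -> R * R) (Y : nat -> v3 R) :=
  polyrep k Y /\ forall i : 'I_k, exists2 r, 0 < r & Y i = vscale r (lightpt (x i)).

Lemma lightpt_cos (t : R) : light (lightpt (cos t, sin t)).
Proof.
split=> //=; rewrite /ip /= mulr1 -!expr2; have := cos2Dsin2 t; lra.
Qed.

(** The orientation of three ideal points, by half-angle formulas. *)
Lemma det3_cos (a b c : R) : det3 (lightpt (cos a, sin a)) (lightpt (cos b, sin b))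
    (lightpt (cos c, sin c)) =
  4 * sin ((b - a) / 2) * sin ((c - b) / 2) * sin ((c - a) / 2).
Proof.
have -> : (c - a) / 2 = (b - a) / 2 + (c - b) / 2 by field.
transitivity (sin (b - a) + sin (c - b) - sin ((b - a) + (c - b))).
  have -> : b - a + (c - b) = c - a by ring.
  by rewrite /det3 /= !sinB; ring.
set x := (b - a) / 2; set y := (c - b) / 2.
have -> : b - a = x + x by rewrite /x; field.
have -> : c - b = y + y by rewrite /y; field.
have -> : x + x + (y + y) = (x + y) + (x + y) by ring.
rewrite !(sinD (x + y)) !(sinD x) !(sinD y) cosD.
have ex := cos2Dsin2 x; have ey := cos2Dsin2 y.
set cx := cos x in ex *; set sx := sin x in ex *.
set cy := cos y in ey *; set sy := sin y in ey *.
transitivity (2 * sx * cx * (cy ^+ 2 + sy ^+ 2) + 2 * sy * cy * (cx ^+ 2 + sx ^+ 2)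
   - 2 * (sx * cy + cx * sy) * (cx * cy - sx * sy)).
  by rewrite ex ey; ring.
ring.
Qed.

Lemma ideal_reps (x : 'I_k -> R * R) : ideal_polygon x -> exists Y, reps x Y.
Proof.
move=> [th [hx mono bd]]; have k0 : (0 < k)%N by lia.
pose o (p : nat) := Ordinal (ltn_pmod p k0).
pose Y (p : nat) := lightpt (x (o p)).
have per (p : nat) : Y (p + k)%N = Y p.
  by rewrite /Y; congr (lightpt (x _)); apply: val_inj; rewrite /= modnDr.
have sinp (a b : R) : a < b -> b < a + 2 * pi -> 0 < sin ((b - a) / 2).
  by move=> h1 h2; apply: sin_gt0_pi; lra.
have base (i j l : 'I_k) : (i < j < l)%N ->
    0 < det3 (lightpt (x i)) (lightpt (x j)) (lightpt (x l)).
  move=> /andP[ij jl]; rewrite !hx det3_cos.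
  have il : (i < l)%N by apply: ltn_trans ij jl.
  by rewrite !mulr_gt0 // sinp // ?mono.
have oE (m p : nat) : (m * k <= p < m.+1 * k)%N -> (o p : nat) = (p - m * k)%N.
  move=> /andP[h1 h2] /=.
  by rewrite -{1}(subnK h1) addnC modnMDl modn_small //; lia.
exists Y; split; last first.
  by move=> i; exists 1 => //; rewrite vscale1 /Y; congr (lightpt (x _));
    apply: val_inj; rewrite /= modn_small.
split => // [p|p q r /andP[pq qr] rk].
  by rewrite /Y hx; exact: lightpt_cos.
pose m := (p %/ k)%N.
have hp : (m * k <= p < m.+1 * k)%N by rewrite leq_trunc_div /= ltn_ceil.
(* up to a cyclic permutation, the indices modulo k of p, q, r are increasing *)
have [hr|hr] := ltnP r (m.+1 * k).
  by apply: base; rewrite !(oE m); lia.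
have [hq|hq] := ltnP q (m.+1 * k).
  rewrite det3_rot det3_rot; apply: base; rewrite (oE m.+1 r) ?(oE m p) ?(oE m q); lia.
rewrite det3_rot; apply: base; rewrite (oE m.+1 q) ?(oE m.+1 r) ?(oE m p); lia.
Qed.

Section Reps.
Variables (x : 'I_k -> R * R) (Y : nat -> v3 R).
Hypothesis hY : reps x Y.

Let pY : polyrep k Y. Proof. by case: hY. Qed.
Let lY (p : nat) : light (Y p). Proof. by case: pY. Qed.

Lemma reps_idp (i : 'I_k) : idp (Y i) = x i.
Proof.
case: hY => _ /(_ i) [r r0 ->]; rewrite /idp /= mulr1.
by rewrite [RHS]surjective_pairing; congr pair; rewrite mulrAC divff ?mul1r // lt0r_neq0.
Qed.

Lemma reps_ordS (i : 'I_k) : Y (ordS i) = Y i.+1.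
Proof. by rewrite /= (polyrep_mod pY). Qed.

Lemma light_idp E F : light E -> light F -> idp E = idp F ->
  exists2 r, 0 < r & E = vscale r F.
Proof.
move=> [_ e] [_ f] [h1 h2]; exists (v0 E / v0 F); first by rewrite divr_gt0.
have en := lt0r_neq0 e; have fn := lt0r_neq0 f.
move: h1 h2 en fn; case: (E) (F) => e0 e1 e2 [f0 f1 f2] /= h1 h2 en fn.
rewrite /vscale /=; congr V3; first by field.
- by rewrite -[LHS](divfK en) h1; field.
- by rewrite -[LHS](divfK en) h2; field.
Qed.

Let m_gt0 i : 0 < ip (Y i) (Y i.+1).
Proof. by rewrite -lam_gt0; exact: (lam_side_gt0 k3 pY). Qed.

(** Light vectors with the same ideal point differ by a positive factor. *)
Lemma side_frame (i : 'I_k) c : joins c (x i) (x (ordS i)) ->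
  exists A B a b, [/\ 0 < a, 0 < b, A = vscale a (Y i.+1), B = vscale b (Y i)
    & frame A B /\ forall s, lift (c s) = pt A B s].
Proof.
move=> /joins_frame [A [B [fr hc eB eA]]]; have [lA lB _] := fr.
rewrite -reps_idp in eB; rewrite -reps_idp reps_ordS in eA.
have [a a0 ea] := light_idp lA (lY _) eA.
have [b b0 eb] := light_idp lB (lY _) eB.
by exists A, B, a, b.
Qed.

(** A point p of the plane of the side has positive coordinates in the ends of
    the side; scaling the ends by these coordinates gives a frame whose geodesic
    passes through p at time 0. *)
Lemma side_sideform (i : 'I_k) p : side x i p <-> sideform Y i (lift p) = 0.
Proof.
split=> [[c [/side_frame [A [B [a [b [_ _ -> -> [fr hc]]]]]] [s _ <-]]]|h].
  by rewrite hc /pt sideformD !sideformZ /sideform det3_aba det3_abb !mulr0 addr0.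
have hC := lift_hyp p; have eC := side_span k3 pY h.
set C := lift p in h hC eC *; set m := ip (Y i) (Y i.+1) in eC.
have m0 : 0 < m := m_gt0 i; have mn := lt0r_neq0 m0.
have pa : 0 < ip C (Y i.+1) := ip_hyp_light hC (lY _).
have pb : 0 < ip C (Y i) := ip_hyp_light hC (lY _).
have [cc _] := hC.
have prod : 2 * ip C (Y i.+1) * ip C (Y i) = m.
  have : ip C C = 1 by []; rewrite {1}eC ipDl !ipZl (ipC (Y i) C) (ipC (Y i.+1) C) => e.
  by rewrite -[RHS]mulr1 -[X in _ = _ * X]e; field.
pose A := vscale (ip C (Y i) / m) (Y i.+1); pose B := vscale (ip C (Y i.+1) / m) (Y i).
have fr : frame A B.
  split; [by apply: light_scale => //; rewrite divr_gt0..|].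
  rewrite ipZl ipZr (ipC (Y i.+1)) -/m -prod.
  by field; rewrite !lt0r_neq0.
exists (seg A B); split.
  have := joins_seg fr; rewrite -(reps_idp i) -reps_idp reps_ordS.
  have idpZ r E : 0 < r -> light E -> idp (vscale r E) = idp E.
    move=> r0 [_ e0]; rewrite /idp /=; have rn := lt0r_neq0 r0; have en := lt0r_neq0 e0.
    by congr pair; field; rewrite rn en.
  by rewrite !idpZ // divr_gt0.
exists 0 => //; rewrite -[RHS]proj_lift -/C /seg; congr proj.
rewrite /pt oppr0 expR0 !vscale1 /A /B [RHS]eC.
by rewrite /vadd /=; congr V3; rewrite addrC.
Qed.

Lemma boundary_sideform p : boundary x p <-> exists i : 'I_k, sideform Y i (lift p) = 0.
Proof. by split=> -[i /side_sideform h]; exists i. Qed.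

Lemma hdist0 p q : hdist p q = 0 -> p = q.
Proof.
move=> h; have e : ip (lift p) (lift q) = 1.
  by rewrite -cosh_hdist h /cosh oppr0 expR0; field.
have [pp _] := lift_hyp p; have [qq _] := lift_hyp q.
pose Z := vadd (lift p) (vscale (-1) (lift q)).
have := @hyp_orth R (lift p) Z (lift_hyp p).
have -> : ip Z (lift p) = 0 by rewrite /Z ipDl ipZl pp ipC e; ring.
have -> : ip Z Z = 0.
  by rewrite /Z !(ipDl, ipDr, ipZl, ipZr) pp qq (ipC (lift q)) e; ring.
move=> /(_ erefl erefl) z; apply: lift_inj; move: z; rewrite /Z /vadd /vscale.
by case: (lift p) (lift q) => ? ? ? [? ? ?] /= [*]; congr V3; lra.
Qed.

Lemma hdist_ge0 p q : 0 <= hdist p q.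
Proof. by rewrite hdistE; case: (cosh_arcosh (ip_lift_ge1 p q)). Qed.

(** Along a geodesic the form is a combination of expR s and expR (- s).  It is
    interpolated from its values at the ends of a segment with nonnegative
    coefficients, which are quotients of hyperbolic sines. *)
Lemma halfplane_convex i : hconvex [set p | 0 <= sideform Y i (lift p)].
Proof.
move=> p q z /= hp hq; have [d0|dn] := eqVneq (hdist p q) 0.
  rewrite d0 => h; have : hdist p z = 0 by have := hdist_ge0 p z; have := hdist_ge0 z q; lra.
  by move/hdist0 => <-.
set d := hdist p q in dn *; set s := hdist p z => e.
have s0 : 0 <= s by exact: hdist_ge0.
have sd : 0 <= d - s by have := hdist_ge0 z q; lra.
have d0 : 0 < d by rewrite lt0r dn hdist_ge0.
have epq : ip (lift p) (lift q) = cosh (0 - d) by rewrite sub0r coshN -cosh_hdist.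
have [|E [F [fr e0 ed hz]]] := frame_through (lift_hyp p) (lift_hyp q) _ epq.
  by rewrite eq_sym.
have ez : lift z = pt E F s.
  apply: hz; first exact: lift_hyp.
    by rewrite subr0 ipC -cosh_hdist.
  by rewrite -cosh_hdist -[s - d]opprB coshN; congr cosh; lra.
clearbody d s.
rewrite ez; move: hp hq; rewrite -e0 -ed /pt !sideformD !sideformZ.
rewrite oppr0 expR0 !mul1r; set a := sideform _ _ _; set b := sideform _ _ _.
move: a b => a b h1 h2.
have key : (expR d - expR (- d)) * (expR s * a + expR (- s) * b) =
    (expR (d - s) - expR (- (d - s))) * (a + b)
    + (expR s - expR (- s)) * (expR d * a + expR (- d) * b).
  rewrite opprB !expRD !expRN; field; rewrite !lt0r_neq0 ?expR_gt0 //.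
have pd : 0 < expR d - expR (- d) by rewrite subr_gt0 ltr_expR; lra.
rewrite -(pmulr_rge0 _ pd) key addr_ge0 // mulr_ge0 //.
  by rewrite subr_ge0 ler_expR; lra.
by rewrite subr_ge0 ler_expR; lra.
Qed.

(** The half-planes are convex and contain the boundary. *)
Lemma polygon_sideform i p : polygon x p -> 0 <= sideform Y i (lift p).
Proof.
move=> /(_ _ (@halfplane_convex i)); apply=> q [j /side_sideform h] /=.
have [e|ne] := eqVneq (i %% k)%N (j %% k)%N.
  by rewrite (sideform_mod pY e) h.
exact/ltW/(side_sideform_gt0 k3 pY (lift_hyp q) h).
Qed.

Lemma boundary_polygon p : boundary x p -> polygon x p.
Proof. by move=> h C _; apply. Qed.

End Reps.
End Sides.

(** * The recursion for a given trajectory *)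

Section FromTrajectory.
Variables (R : realType) (k : nat).
Hypothesis k3 : (3 <= k)%N.

Definition lamY (Y : nat -> v3 R) p q := lam (Y p) (Y q).

Lemma polyrep_weights Y : polyrep k Y -> weights k (lamY Y).
Proof.
move=> hY; split=> [p q|p p' q e|p|p q ne]; rewrite /lamY.
- exact: lamC.
- by rewrite (polyrep_eqmod hY e).
- by apply: lamXX; case: hY.
- exact: (lam_vertex_gt0 k3 hY).
Qed.

Lemma polyrep_ptolemaic Y : polyrep k Y -> ptolemaic k (lamY Y).
Proof. by move=> hY p d; exact: (ptolemy_vertices k3 hY). Qed.

(** Labels are taken as natural numbers, so that successors and shifts are not
    reduced modulo k. *)
Definition label n (a : n.-tuple 'I_k) j : nat := nth 0%N [seq val i | i <- a] (j %% n)%N.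

Lemma label_tnth n (n0 : (0 < n)%N) (a : n.-tuple 'I_k) j :
  label a j = tnth a (Ordinal (ltn_pmod j n0)).
Proof.
have k0 : (0 < k)%N by lia.
rewrite /label (nth_map (Ordinal k0)) ?size_tuple ?ltn_pmod //.
by rewrite (tnth_nth (Ordinal k0)).
Qed.

Lemma label_per n (a : n.-tuple 'I_k) j : label a (j + n)%N = label a j.
Proof. by rewrite /label modnDr. Qed.

Lemma label_shift n (n0 : (0 < n)%N) (a : n.-tuple 'I_k) t j :
  label (shift_labels t a) j = label a j + t %[mod k].
Proof.
rewrite !(label_tnth n0) tnth_mktuple; set i := tnth a _.
elim: t => [|t IH]; first by rewrite addn0.
by rewrite /= modn_mod addnS -addn1 -modnDml IH modnDml addn1.
Qed.

Lemma hdist_refl (p : hplane R) : hdist p p = 0.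
Proof.
rewrite (@hdist_cosh R p p 0) ?normr0 //; have [-> _] := lift_hyp p.
by rewrite /cosh oppr0 expR0; field.
Qed.

(** Two points at different times determine the frame. *)
Lemma pt_inj2 (E F E' F' : v3 R) s t : s != t ->
  pt E F s = pt E' F' s -> pt E F t = pt E' F' t -> E = E' /\ F = F'.
Proof.
move=> st; have xy : expR s != expR t by apply: contra_neq st; exact: expR_inj.
rewrite /pt !expRN; have xn := lt0r_neq0 (expR_gt0 s); have yn := lt0r_neq0 (expR_gt0 t).
have xp := expR_gt0 s; have yp := expR_gt0 t.
move: (expR s) (expR t) xy xn yn xp yp => X Z xy xn yn xp yp.
have d : X ^+ 2 - Z ^+ 2 != 0.
  rewrite subr_sqr mulf_neq0 //; first by rewrite subr_eq0.
  by rewrite lt0r_neq0 // addr_gt0.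
have key e f e' f' : X * e + X^-1 * f = X * e' + X^-1 * f' ->
    Z * e + Z^-1 * f = Z * e' + Z^-1 * f' -> e = e' /\ f = f'.
  move=> h1 h2.
  have ee : e = e'.
    apply: (mulfI d).
    have g1 : X * (X * e + X^-1 * f) = X * (X * e' + X^-1 * f') by rewrite h1.
    have g2 : Z * (Z * e + Z^-1 * f) = Z * (Z * e' + Z^-1 * f') by rewrite h2.
    move: g1 g2; rewrite !mulrDr !mulrA !divff // !mul1r !expr2; lra.
  split=> //; have xi : X^-1 != 0 by rewrite invr_eq0.
  by apply: (mulfI xi); move: h1; rewrite ee; lra.
case: E F E' F' => ? ? ? [? ? ?] [? ? ?] [? ? ?]; rewrite /vadd /vscale /=.
move=> [a0 a1 a2] [b0 b1 b2].
have [-> ->] := key _ _ _ _ a0 b0; have [-> ->] := key _ _ _ _ a1 b1.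
by have [-> ->] := key _ _ _ _ a2 b2.
Qed.

Lemma pt_shift (E F : v3 R) s t : pt E F (s + t) = pt (vscale (expR t) E) (vscale (expR (- t)) F) s.
Proof. by rewrite /pt !vscaleA opprD !expRD. Qed.

Section Trajectory.
Variables (x : 'I_k -> R * R) (Y : nat -> v3 R) (gamma : R -> hplane R) (T : R).
Variables (n : nat) (a : n.-tuple 'I_k).
Hypotheses (hY : reps x Y) (closed : closed_billiard_trajectory x gamma T).
Hypothesis hits : hits_in_period x gamma T a.

Let T0 : 0 < T. Proof. by case: closed. Qed.
Let gper t : gamma (t + T) = gamma t. Proof. by case: closed. Qed.
Let gpoly t : polygon x (gamma t). Proof. by case: closed => -[]. Qed.
Let gdist s t : s < t -> (forall u, s < u < t -> ~ boundary x (gamma u)) ->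
  hdist (gamma s) (gamma t) = t - s.
Proof. by case: closed => -[_ h _ _] _ _; exact: h. Qed.
Let grefl t i : side x i (gamma t) -> reflects x gamma t i.
Proof. by case: closed => -[_ _ _ h] _ _; exact: h. Qed.

(** Without hits, the trajectory would be a geodesic of length T from gamma s to
    gamma (s + T), which are equal. *)
Lemma hits_n0 : (0 < n)%N.
Proof.
rewrite lt0n; apply/negP => /eqP n0; case: hits => s [tau [_ h _]].
have st : s < s + T by rewrite ltrDl.
have := gdist st; rewrite gper hdist_refl => /(_ _) e.
have : 0 = s + T - s.
  apply: e => u /andP[h1 h2] hu; have [[j _] _] : (exists j, u = tau j) /\ True.
    by split=> //; apply/h; split => //; rewrite h2 ltW.
  by have := ltn_ord j; rewrite [X in (_ < X)%N]n0.
by rewrite addrAC subrr add0r; have := T0; lra.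
Qed.
Let n0 := hits_n0.

(** The hitting times of one period are extended to all times; between two
    consecutive ones, the trajectory does not meet the boundary. *)
Lemma hitting_times : exists tt : nat -> R, 
  [/\ forall j, tt j < tt j.+1, forall j, tt (j + n)%N = tt j + T,
      forall j (i : 'I_k), i = label a j :> nat -> side x i (gamma (tt j))
    & forall j u, tt j < u < tt j.+1 -> ~ boundary x (gamma u)].
Proof.
case: hits => s [tau [mono hb hs]].
pose o j := Ordinal (ltn_pmod j n0).
pose tt j := tau (o j) + (j %/ n)%:R * T.
have gperm m t : gamma (t + m%:R * T) = gamma t.
  elim: m => [|m IH]; first by rewrite mul0r addr0.
  by rewrite -natr1 mulrDl mul1r addrA gper.
have tau_in i : s <= tau i < s + T.
  by have [] : s <= tau i < s + T /\ boundary x (gamma (tau i)) by apply/hb; exists i.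
have monoR i j : tau i < tau j -> (i < j)%N.
  move=> h; rewrite ltnNge leq_eqVlt; apply/negP => /orP[/eqP/val_inj e|/mono h'].
    by move: h; rewrite e ltxx.
  by move: h'; rewrite ltNge (ltW h).
have ttS j : (o j.+1 = o j + 1 :> nat)%N /\ tt j.+1 = tau (o j.+1) + (j %/ n)%:R * T \/
    [/\ (o j.+1 = 0 :> nat)%N, (o j).+1 = n
      & tt j.+1 = tau (o j.+1) + (j %/ n)%:R * T + T].
  have e := divn_eq j n; have r := ltn_pmod j n0.
  have [h|h] := ltnP (j %% n).+1 n.
    have eq : j.+1 = (j %/ n * n + (j %% n).+1)%N by rewrite {1}e addnS.
    left; split; first by rewrite /= eq modnMDl modn_small // addn1.
    by rewrite /tt {2}eq divnMDl // (divn_small h) addn0.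
  have en : (j %% n).+1 = n by apply/eqP; rewrite eqn_leq h r.
  have eq : j.+1 = ((j %/ n).+1 * n)%N by rewrite {1}e -addnS en mulSnr.
  right; split => //; first by rewrite /= eq modnMl.
  by rewrite /tt {2}eq mulnK // -natr1 mulrDl mul1r addrA.
exists tt; split.
- move=> j; have [[e ->]|[e e' ->]] := ttS j.
    by rewrite ltrD2r mono // e addn1.
  rewrite /tt addrAC ltrD2r; have := tau_in (o j); have := tau_in (o j.+1); lra.
- move=> j; rewrite /tt divnDr // divnn n0 natrD mulrDl mul1r addrA.
  by congr (tau _ + _ + _); apply: val_inj; rewrite /= modnDr.
- move=> j i; rewrite (label_tnth n0) => /val_inj ->.
  rewrite /tt gperm; exact: hs.
- move=> j u /andP[h1 h2] hu; have := ltn_ord (o j).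
  have hit t : s <= t < s + T -> boundary x (gamma t) -> exists i, t = tau i.
    by move=> h h'; apply/hb.
  pose q := (j %/ n)%:R : R.
  have eu : gamma (u - q * T) = gamma u by rewrite -[in RHS](subrK (q * T) u) gperm.
  have [l1|l1] := ltP (u - q * T) (s + T).
    have r1 : s <= u - q * T < s + T.
      by rewrite l1 andbT; have := tau_in (o j); move: h1; rewrite /tt -/q; lra.
    have [i ei] : exists i, u - q * T = tau i by apply: hit; rewrite ?eu.
    have h1' : tau (o j) < tau i by move: h1; rewrite /tt -/q -ei; lra.
    have l2 := monoR _ _ h1'; have l3 := ltn_ord i.
    have [[e E]|[e e' _]] := ttS j; last by rewrite /= in e' l2 *; lia.
    have h2' : tau i < tau (o j.+1) by move: h2; rewrite E -/q -ei; lra.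
    by have := monoR _ _ h2'; rewrite e /= in l2 *; lia.
  have [[e E]|[e e' E]] := ttS j.
    by have := tau_in (o j.+1); move: h2; rewrite E -/q; lra.
  have eu' : gamma (u - q * T - T) = gamma u by rewrite -eu -[in RHS](subrK T (u - _)) gper.
  have r1 : s <= u - q * T - T < s + T.
    by have := tau_in (o j.+1); move: h2; rewrite E -/q; lra.
  have [i ei] : exists i, u - q * T - T = tau i by apply: hit; rewrite ?eu'.
  have h2' : tau i < tau (o j.+1) by move: h2; rewrite E -/q -ei; lra.
  by have := monoR _ _ h2'; rewrite e.
Qed.

Let pY : polyrep k Y. Proof. by case: hY. Qed.
Let lY p : light (Y p). Proof. by case: pY. Qed.

(* A form that is positive inside the polygon and vanishes at the later end of a
   segment is negative at the forward end of the geodesic; if it vanishes at the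
   earlier end, it is positive there. *)
Let exp_sign (s t P Q : R) : s < t -> expR t * P + expR (- t) * Q = 0 ->
  0 < expR s * P + expR (- s) * Q -> P < 0.
Proof.
move=> st; rewrite !expRN => h0 h1; have xp := expR_gt0 s; have yp := expR_gt0 t.
have xy : expR s < expR t by rewrite ltr_expR.
move: (expR s) (expR t) xp yp xy h0 h1 => X Z xp yp xy h0 h1.
have eQ : Q = - (Z ^+ 2 * P).
  have : Z * (Z * P + Z^-1 * Q) = 0 by rewrite h0 mulr0.
  rewrite mulrDr !mulrA divff ?lt0r_neq0 // mul1r expr2; lra.
have : 0 < X * (X * P + X^-1 * Q) by rewrite mulr_gt0.
rewrite mulrDr !mulrA divff ?lt0r_neq0 // mul1r eQ -expr2 -mulrBl.
by rewrite nmulr_rgt0 // subr_lt0 ltr_pXn2r // nnegrE ltW.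
Qed.

Let exp_sign' (s t P Q : R) : t < s -> expR t * P + expR (- t) * Q = 0 ->
  0 < expR s * P + expR (- s) * Q -> 0 < P.
Proof.
move=> ts h0 h1.
have l : - s < - t by rewrite ltrN2.
have : Q < 0 by apply: (@exp_sign (- s) (- t) Q P l); rewrite opprK addrC.
have x0 := expR_gt0 t; have y0 := expR_gt0 (- t) => q0.
have : expR (- t) * Q < 0 by rewrite pmulr_rlt0.
by move=> h; rewrite -(pmulr_rgt0 _ x0); lra.
Qed.

(** Between two hits the trajectory runs along a geodesic with forward end E j,
    which lies beyond the next side.  By the law of reflection, E j.+1 is the
    mirror image of E j.  A reflection preserves the lambda lengths to the ends
    of its side, so those of E j may be computed from E j.+1, by ptolemy_arc.
    After one period the parameter is shifted by T, which scales E. *)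
Lemma trajectory_family :
  (forall j, label a j != label a j.+1 %[mod k]) /\
  exists u v, family n (lamY Y) (fun j => label a j.+1) (expR (T / 2)) u v.
Proof.
have [tt [incr ttn hside free]] := hitting_times.
have labk j : (label a j < k)%N by rewrite (label_tnth n0).
pose o j := Ordinal (labk j).
have sd j : side x (o j) (gamma (tt j)) by exact: hside.
have sdz j : sideform Y (label a j) (lift (gamma (tt j))) = 0.
  exact/(side_sideform k3 hY (o j)).
have sdpos j i u : tt j < u < tt j.+1 -> (i < k)%N -> 0 < sideform Y i (lift (gamma u)).
  move=> hu ik; rewrite lt0r (polygon_sideform k3 hY) // andbT.
  apply/negP => /eqP h; apply: (free _ _ hu).
  by exists (Ordinal ik); apply/(side_sideform k3 hY).
have dist j u v : tt j <= u -> u < v -> v <= tt j.+1 -> hdist (gamma u) (gamma v) = v - u.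
  move=> h1 h2 h3; apply: gdist => // z /andP[z1 z2]; apply: (free j); lra.
have dist' j u v : tt j <= u <= tt j.+1 -> tt j <= v <= tt j.+1 ->
    ip (lift (gamma u)) (lift (gamma v)) = cosh (u - v).
  move=> /andP[u1 u2] /andP[w1 w2]; rewrite -cosh_hdist.
  case: (ltgtP u v) => [h|h|->].
  - by rewrite (dist j) // -coshN opprB.
  - by rewrite !hdistE ipC -hdistE (dist j).
  - by rewrite subrr hdist_refl.
have frames j : exists EF : v3 R * v3 R, frame EF.1 EF.2 /\
    forall u, tt j <= u <= tt j.+1 -> lift (gamma u) = pt EF.1 EF.2 u.
  have t1 : tt j <= tt j <= tt j.+1 by rewrite lexx ltW.
  have t2 : tt j <= tt j.+1 <= tt j.+1 by rewrite lexx ltW.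
  have ne : tt j != tt j.+1 by rewrite lt_eqF.
  have [E [F [fr _ _ h]]] := frame_through (lift_hyp (gamma (tt j)))
    (lift_hyp (gamma (tt j.+1))) ne (dist' _ _ _ t1 t2).
  exists (E, F); split => // u hu; apply: h; first exact: lift_hyp.
    exact: dist' hu t1.
  exact: dist' hu t2.
have [EF hEF] := choice frames.
pose E j := (EF j).1; pose F j := (EF j).2.
have fr j : frame (E j) (F j) by case: (hEF j).
have lE j : light (E j) by case: (fr j).
have hg j u : tt j <= u <= tt j.+1 -> lift (gamma u) = pt (E j) (F j) u.
  by case: (hEF j) => _; apply.
have t1 j : tt j <= tt j <= tt j.+1 by rewrite lexx ltW.
have t2 j : tt j <= tt j.+1 <= tt j.+1 by rewrite lexx ltW.
pose md j := (tt j + tt j.+1) / 2.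
have hm j : tt j < md j < tt j.+1 by have := incr j; rewrite /md; lra.
have hm' j : tt j <= md j <= tt j.+1 by have /andP[? ?] := hm j; rewrite !ltW.
have arc j : sideform Y (label a j.+1) (E j) < 0.
  apply: (@exp_sign (md j) (tt j.+1) _ (sideform Y (label a j.+1) (F j))).
  - by case/andP: (hm j).
  - by rewrite -!sideformZ -sideformD -/(pt _ _ _) -(hg _ _ (t2 j)) sdz.
  - by rewrite -!sideformZ -sideformD -/(pt _ _ _) -(hg _ _ (hm' j)) (sdpos j).
have arc' j : 0 < sideform Y (label a j) (E j).
  apply: (@exp_sign' (md j) (tt j) _ (sideform Y (label a j) (F j))).
  - by case/andP: (hm j).
  - by rewrite -!sideformZ -sideformD -/(pt _ _ _) -(hg _ _ (t1 j)) sdz.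
  - by rewrite -!sideformZ -sideformD -/(pt _ _ _) -(hg _ _ (hm' j)) (sdpos j).
have ne j : label a j != label a j.+1 %[mod k].
  apply/negP => /eqP e; have := arc' j; rewrite (sideform_mod pY e).
  by have := arc j; lra.
have segE j u : tt j <= u <= tt j.+1 -> gamma u = seg (E j) (F j) u.
  by move=> hu; rewrite /seg -(hg _ _ hu) proj_lift.
have reflE j : E j.+1 = refl (Y (label a j.+1)) (Y (label a j.+1).+1) (E j).
  have [c [s [uu [vv [ww [[hc cs] vu vl vr law]]]]]] := grefl (sd j.+1).
  have [A [B [al [be [al0 be0 eA eB [frA hcA]]]]]] := side_frame hY hc.
  have ptA : pt A B s = pt (E j) (F j) (tt j.+1) by rewrite -hcA cs (hg _ _ (t2 j)).
  have ptE : pt (E j.+1) (F j.+1) (tt j.+1) = pt (E j) (F j) (tt j.+1).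
    by rewrite -(hg _ _ (t1 j.+1)) -(hg _ _ (t2 j)).
  have eu : uu = dproj (pt (E j) (F j) (tt j.+1)) (tangent A B s).
    rewrite -ptA; apply: velocity_unique vu _.
    have ec u : c u = seg A B u by rewrite /seg -hcA proj_lift.
    by apply: velocity_seg => //; apply: nearW.
  have ev : vv = dproj (pt (E j) (F j) (tt j.+1)) (tangent (E j) (F j) (tt j.+1)).
    apply: velocity_unique vl _; apply: velocity_seg => //.
    - by apply: within_subset => r /=; move/lt_eqF ->.
    - exact: segE.
    - near=> h; apply: segE; apply/andP; split; last first.
        have : h < 0 by near: h; exact: nbhs_left_lt.
        by lra.
      have : tt j - tt j.+1 < h by near: h; apply: nbhs_left_gt; rewrite subr_lt0.
      by lra.
  have ew : ww = dproj (pt (E j) (F j) (tt j.+1)) (tangent (E j.+1) (F j.+1) (tt j.+1)).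
    rewrite -ptE; apply: velocity_unique vr _; apply: velocity_seg => //.
    - by apply: within_subset => r /=; move/gt_eqF ->.
    - exact: segE.
    - near=> h; apply: segE; apply/andP; split.
        have : 0 < h by near: h; exact: nbhs_right_gt.
        by lra.
      have : h < tt j.+2 - tt j.+1 by near: h; apply: nbhs_right_lt; rewrite subr_gt0.
      by lra.
  rewrite eu ev ew in law.
  have [-> _] := (reflection_law frA (fr j) (fr j.+1) ptA ptE).1 law.
  rewrite eA eB refl_scale // ?lt0r_neq0 //.
  by rewrite -lam_gt0; exact: (lam_side_gt0 k3 pY).
have perE j : E (j + n)%N = vscale (expR (- T)) (E j).
  have key u : tt j <= u <= tt j.+1 ->
      pt (E (j + n)%N) (F (j + n)%N) (u + T) = pt (E j) (F j) u.
    move=> hu; rewrite -(hg _ _ hu) -(hg (j + n)%N (u + T)) ?gper //.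
    by rewrite -addSn !ttn !lerD2r.
  have := key _ (t1 j); have := key _ (t2 j); rewrite !pt_shift => k2 k1.
  have tne : tt j != tt j.+1 by rewrite lt_eqF.
  have [<- _] := pt_inj2 tne k1 k2.
  by rewrite vscaleA expRVr vscale1.
split=> //.
exists (fun j => lam (E j) (Y (label a j.+1))), (fun j => lam (E j) (Y (label a j.+1).+1)).
have m0 p : ip (Y p) (Y p.+1) != 0.
  by rewrite lt0r_neq0 // -lam_gt0; exact: (lam_side_gt0 k3 pY).
split=> j.
- exact: (arc_lam_gt0 pY).
- rewrite -addSn label_per perE /lam !ipZl !sqrtrM ?expR_ge0 //.
  suff -> : Num.sqrt (expR (- T)) = (expR (T / 2))^-1 by [].
  rewrite -expRN; have -> : - T = - (T / 2) + - (T / 2) by field.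
  by rewrite expRD -expr2 sqrtr_sqr ger0_norm ?expR_ge0.
- rewrite /lamY -(ptolemy_arc k3 pY _ (lE _) (arc _)); congr (_ * _).
  case: (lY (label a j.+1)) (lY (label a j.+1).+1) => ya _ [yb _].
  by rewrite /lam reflE ip_refl_l.
- rewrite /lamY -(ptolemy_arc k3 pY _ (lE _) (arc _)); congr (_ * _).
  case: (lY (label a j.+1)) (lY (label a j.+1).+1) => ya _ [yb _].
  by rewrite /lam reflE ip_refl_r.
Unshelve. all: by end_near.
Qed.

End Trajectory.
End FromTrajectory.

(** * Positive solutions of the recursion *)

Lemma periods_sub N j m : (j <= N * m)%N -> (N.+1 * m - j = (N * m - j) + m)%N.
Proof. by move=> h; rewrite mulSnr addnBAC. Qed.

Section Perron.
Variables (R : realType) (k n : nat).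
Hypotheses (k3 : (3 <= k)%N) (n0 : (0 < n)%N).
Variables (w : nat -> nat -> R) (b : nat -> nat).
Hypotheses (hw : weights k w) (hb : forall j, b j != b j.+1 %[mod k]).
Hypothesis bper : forall j, b (j + n)%N = b j.

(** At the labels i, i + 1, i + 2 the sequence does not alternate; there, two
    steps of the recursion make all components positive. *)
Definition turn (b : nat -> nat) i :=
  ~~ ((b i.+1 == (b i).+1 %[mod k]) && ((b i.+2).+1 == b i.+1 %[mod k])) &&
  ~~ (((b i.+1).+1 == b i %[mod k]) && (b i.+2 == (b i.+1).+1 %[mod k])).

Lemma turn_exists : (forall e, ~ alternating k b e) -> exists i, turn b i.
Proof.
move=> na; apply: contrapT => nt.
have alt i : ((b i.+1 == (b i).+1 %[mod k]) && ((b i.+2).+1 == b i.+1 %[mod k])) ||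
  (((b i.+1).+1 == b i %[mod k]) && (b i.+2 == (b i.+1).+1 %[mod k])).
  apply: contraT => h; case: nt; exists i; move: h.
  by rewrite negb_or => /andP[h1 h2]; apply/andP.
pose e := b 1%N == (b 0%N).+1 %[mod k].
have neS p q : p == q.+1 %[mod k] -> p.+1 == q %[mod k] -> False.
  move=> /eqP e1 /eqP e2; have : q.+2 = q %[mod k].
    by rewrite -e2 -(addn1 p) -(addn1 q.+1) -modnDml -e1 modnDml.
  move/eqP; rewrite -{2}(addn0 q) -addn2 eqn_modDl mod0n modn_small //; lia.
case: (na e) => j; have := j; suff h i : if odd i (+) e then b i.+1 == (b i).+1 %[mod k]
    else (b i.+1).+1 == b i %[mod k].
  by move=> _; have := h j; case: ifP => _ /eqP.
elim: i => [|i]; first by rewrite /= /e; case: ifP => // h; have := alt 0%N; rewrite h /= => /andP[].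
rewrite /= addNb; case: (odd i (+) e) => /= h; have := alt i.
  by rewrite h /= => /orP[//|/andP[h' _]]; case: (neS _ _ h h').
rewrite h /= => /orP[/andP[h' _]|//]; by case: (neS _ _ h' h).
Qed.

(** The recursion, as a linear map from the pair with index j.+1 to the one with
    index j; back j m iterates it from j + m down to j. *)
Definition step j (p : R * R) : R * R :=
  let c := b j.+1 in
  ((p.1 * w c.+1 (b j) + p.2 * w c (b j)) / w c c.+1,
   (p.1 * w c.+1 (b j).+1 + p.2 * w c (b j).+1) / w c c.+1).

Fixpoint back j m p := if m is m'.+1 then step j (back j.+1 m' p) else p.

Definition pair_scale (s : R) (p : R * R) := (s * p.1, s * p.2).
Definition pair_add (p q : R * R) := (p.1 + q.1, p.2 + q.2).

Lemma step_lin j s p q : step j (pair_add (pair_scale s p) q) = pair_add (pair_scale s (step j p)) (step j q).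
Proof. by rewrite /step /pair_add /pair_scale /=; congr pair; rewrite !mulrA -mulrDl; congr (_ / _); ring. Qed.

Lemma back_lin j m s p q : back j m (pair_add (pair_scale s p) q) = pair_add (pair_scale s (back j m p)) (back j m q).
Proof. by elim: m j => //= m IH j; rewrite IH step_lin. Qed.

Lemma back_scl j m s p : back j m (pair_scale s p) = pair_scale s (back j m p).
Proof.
have z : back j m (0, 0) = (0, 0).
  by elim: m j => //= m IH j; rewrite IH /step /= !mul0r addr0 mul0r.
have := back_lin j m s p (0, 0); rewrite z /pair_add /pair_scale /= !addr0.
by case: (back j m p) => ? ? /=.
Qed.

Lemma back_add j m1 m2 p : back j (m1 + m2) p = back j m1 (back (j + m1) m2 p).
Proof.
elim: m1 j => [|m1 IH] j /=; first by rewrite addn0.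
by rewrite IH addnS addSn.
Qed.

Lemma back_per j m p : back (j + n) m p = back j m p.
Proof.
elim: m j => //= m IH j; rewrite -addSn IH /step -addSn !bper //.
Qed.

Let nneg (p : R * R) := [/\ 0 <= p.1, 0 <= p.2 & 0 < p.1 + p.2].
Let posv (p : R * R) := 0 < p.1 /\ 0 < p.2.

Let wS p : 0 < w p p.+1. Proof. by apply: (weights_gt0 hw); apply: neqmodS. Qed.
Let wge p q : 0 <= w p q. Proof. exact: (weights_ge0 p q hw). Qed.
Let w12 j : 0 < w (b j.+1) (b j).
Proof. by apply: (weights_gt0 hw); rewrite eq_sym; apply: hb. Qed.
Let w21 j : 0 < w (b j.+1).+1 (b j).+1.
Proof.
apply: (weights_gt0 hw); rewrite -(addn1 (b j.+1)) -(addn1 (b j)) eqn_modDr eq_sym.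
exact: hb.
Qed.

Let step_nneg j p : nneg p -> nneg (step j p).
Proof.
move=> [h1 h2 h]; have ip : 0 < (w (b j.+1) (b j.+1).+1)^-1 by rewrite invr_gt0.
have a := w12 j; have c := w21 j; have s1 := wge (b j.+1).+1 (b j).
have s2 := wge (b j.+1) (b j).+1.
split; rewrite /= ?mulr_ge0 ?addr_ge0 ?mulr_ge0 ?(ltW ip) ?(ltW a) ?(ltW c) //.
rewrite -mulrDl mulr_gt0 //.
have m1 : 0 <= p.1 * w (b j.+1).+1 (b j) by rewrite mulr_ge0.
have m2 : 0 <= p.2 * w (b j.+1) (b j).+1 by rewrite mulr_ge0.
have m3 : 0 <= p.2 * w (b j.+1) (b j) by rewrite mulr_ge0 // ltW.
have m4 : 0 <= p.1 * w (b j.+1).+1 (b j).+1 by rewrite mulr_ge0 // ltW.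
have [e|ne] := eqVneq p.1 0.
  have : 0 < p.2 * w (b j.+1) (b j) by rewrite mulr_gt0 //; lra.
  lra.
have : 0 < p.1 * w (b j.+1).+1 (b j).+1 by rewrite mulr_gt0 // lt0r ne.
lra.
Qed.

Let step_fst j p : nneg p -> (b j.+1).+1 != b j %[mod k] -> 0 < (step j p).1.
Proof.
move=> [h1 h2 h] ne; rewrite /= divr_gt0 //.
have q1 : 0 < w (b j.+1).+1 (b j) by apply: (weights_gt0 hw).
have q2 := w12 j.
have m1 : 0 <= p.1 * w (b j.+1).+1 (b j) by rewrite mulr_ge0 // ltW.
have m3 : 0 <= p.2 * w (b j.+1) (b j) by rewrite mulr_ge0 // ltW.
have [e|ne'] := eqVneq p.1 0.
  have : 0 < p.2 * w (b j.+1) (b j) by rewrite mulr_gt0 //; lra.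
  lra.
have : 0 < p.1 * w (b j.+1).+1 (b j) by rewrite mulr_gt0 // lt0r ne'.
lra.
Qed.

Let step_snd j p : nneg p -> b j.+1 != (b j).+1 %[mod k] -> 0 < (step j p).2.
Proof.
move=> [h1 h2 h] ne; rewrite /= divr_gt0 //.
have q1 : 0 < w (b j.+1) (b j).+1 by apply: (weights_gt0 hw).
have q2 := w21 j.
have m1 : 0 <= p.1 * w (b j.+1).+1 (b j).+1 by rewrite mulr_ge0 // ltW.
have m3 : 0 <= p.2 * w (b j.+1) (b j).+1 by rewrite mulr_ge0 // ltW.
have [e|ne'] := eqVneq p.1 0.
  have : 0 < p.2 * w (b j.+1) (b j).+1 by rewrite mulr_gt0 //; lra.
  lra.
have : 0 < p.1 * w (b j.+1).+1 (b j).+1 by rewrite mulr_gt0 // lt0r ne'.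
lra.
Qed.

Let step_fst' j p : 0 < p.2 -> 0 <= p.1 -> 0 < (step j p).1.
Proof.
by move=> h1 h2; rewrite /= divr_gt0 // ltr_wpDl ?mulr_ge0 // mulr_gt0.
Qed.
Let step_snd' j p : 0 < p.1 -> 0 <= p.2 -> 0 < (step j p).2.
Proof.
by move=> h1 h2; rewrite /= divr_gt0 // ltr_pwDl ?mulr_ge0 // mulr_gt0.
Qed.

Let step_posv j p : posv p -> posv (step j p).
Proof. by move=> [h1 h2]; split; [apply: step_fst'|apply: step_snd'] => //; apply: ltW. Qed.

Let step_turn i p : turn b i -> nneg p -> posv (step i (step i.+1 p)).
Proof.
move=> /andP[t1 t2] hp; have hq := step_nneg i.+1 hp; have [q1 q2 _] := hq.
split.
  have [e|ne] := boolP ((b i.+1).+1 == b i %[mod k]); last exact: step_fst.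
  by apply: step_fst' => //; apply: step_snd => //; move: t2; rewrite e.
have [e|ne] := boolP (b i.+1 == (b i).+1 %[mod k]); last exact: step_snd.
by apply: step_snd' => //; apply: step_fst => //; move: t1; rewrite e.
Qed.

Let back_nneg j m p : nneg p -> nneg (back j m p).
Proof. by move=> h; elim: m j => //= m IH j; apply: step_nneg. Qed.

Let back_posv j m p : posv p -> posv (back j m p).
Proof. by move=> h; elim: m j => //= m IH j; apply: step_posv. Qed.

Let bmod i j : i = j %[mod n] -> b i = b j.
Proof.
have pm m p : b (p + m * n)%N = b p.
  by elim: m => [|m IH]; [rewrite addn0 | rewrite mulSnr addnA bper].
move=> e; rewrite (divn_eq i n) (divn_eq j n) e.
by rewrite addnC pm addnC pm.
Qed.

Let back_turn i p : turn b i -> nneg p -> posv (back 0 (n + n) p).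
Proof.
move=> t hp; pose r := (i %% n)%N.
have rn : (r < n)%N by rewrite ltn_mod.
have tr : turn b r.
  have e m : b (r + m)%N = b (i + m)%N by apply: bmod; rewrite modnDml.
  have e0 := e 0%N; have e1 := e 1%N; have e2 := e 2%N.
  rewrite !addn0 in e0; rewrite !addn1 in e1; rewrite !addn2 in e2.
  by rewrite /turn e0 e1 e2.
have -> : (n + n = r + (2 + (n + n - r - 2)))%N by lia.
rewrite back_add; apply: back_posv; rewrite add0n back_add /=.
by apply: step_turn => //; apply: back_nneg.
Qed.

(* An explicit positive eigenvector of a nonnegative matrix with positive entries
   off the diagonal, for the larger root of the characteristic polynomial. *)
Let perron (a b' c d : R) : 0 <= a -> 0 <= d -> 0 < b' -> 0 < c ->
  exists mu p1 p2, [/\ 0 < mu, 0 < p1, 0 < p2,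
    p1 * a + p2 * b' = mu * p1 & p1 * c + p2 * d = mu * p2].
Proof.
move=> a0 d0 b0 c0; pose D := (a - d) ^+ 2 + 4 * b' * c.
have D0 : 0 <= D by rewrite addr_ge0 ?sqr_ge0 // !mulr_ge0 // ltW.
have s2 := sqr_sqrtr D0; have s0 := sqrtr_ge0 D.
set s := Num.sqrt D in s2 s0.
have bc : 0 < b' * c by rewrite mulr_gt0.
have h1 : a - d < s.
  rewrite ltNge; apply/negP => h; have : s ^+ 2 <= (a - d) ^+ 2.
    by rewrite ler_pXn2r // nnegrE; lra.
  by rewrite s2 /D; lra.
exists ((a + d + s) / 2), b', ((d - a + s) / 2); split => //.
- have : d - a < s.
    rewrite ltNge; apply/negP => h; have : s ^+ 2 <= (d - a) ^+ 2.
      by rewrite ler_pXn2r // nnegrE; lra.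
    by rewrite s2 /D -sqrrN opprB; lra.
  lra.
- lra.
- by field.
- have -> : b' * c = (s ^+ 2 - (a - d) ^+ 2) / 4 by rewrite s2 /D; field.
  by field.
Qed.

(** The recursion over one period is a nonnegative matrix, whose square is
    positive because of the turn; hence its entries off the diagonal are
    positive, and it has a positive eigenvector.  The solution at the index j is
    obtained from the eigenvector by going back from any multiple of the period
    beyond j, here j * n. *)
Lemma family_exists i : turn b i -> exists mu u v, 0 < mu /\ family n w b mu u v.
Proof.
move=> t.
have ne1 : nneg (1, 0) by split => /=; lra.
have ne2 : nneg (0, 1) by split => /=; lra.
pose A := back 0 n; pose a := (A (1, 0)).1; pose c := (A (1, 0)).2.
pose b' := (A (0, 1)).1; pose d := (A (0, 1)).2.
have Alin p : A p = (p.1 * a + p.2 * b', p.1 * c + p.2 * d).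
  have -> : p = pair_add (pair_scale p.1 (1, 0)) (pair_scale p.2 (0, 1)).
    by case: p => ? ?; rewrite /pair_add /pair_scale /= !mulr1 !mulr0 addr0 add0r.
  by rewrite /A back_lin back_scl /pair_add /pair_scale /= !mulr1 !mulr0 addr0 add0r.
have AA p : back 0 (n + n) p = A (A p).
  by rewrite back_add back_per.
have [a0 c0 _] : nneg (A (1, 0)) by exact: back_nneg.
have [b0 d0 _] : nneg (A (0, 1)) by exact: back_nneg.
have [_ c1] := back_turn t ne1; have [b1 _] := back_turn t ne2.
have {}c1 : 0 < c.
  rewrite lt0r c0 andbT; apply/negP => /eqP e.
  by move: c1; rewrite AA (Alin (A _)) /= -/a -/c e; lra.
have {}b1 : 0 < b'.
  rewrite lt0r b0 andbT; apply/negP => /eqP e.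
  by move: b1; rewrite AA (Alin (A _)) /= -/b' -/d e; lra.
have [mu [p1 [p2 [mu0 h1 h2 e1 e2]]]] := perron a0 d0 b1 c1.
pose p := (p1, p2); have Ap : A p = pair_scale mu p by rewrite Alin /= e1 e2.
have mun := lt0r_neq0 mu0.
pose G j N := pair_scale (mu^-1 ^+ N) (back j (N * n - j) p).
have GS j N : (j <= N * n)%N -> G j N.+1 = G j N.
  move=> jN; rewrite /G.
  rewrite periods_sub // back_add subnKC //.
  have -> : back (N * n) n p = A p.
    by elim: N {jN} => [|N IH]; rewrite ?mul0n // mulSnr back_per.
  rewrite Ap back_scl /pair_scale /= !mulrA exprS.
  by rewrite -[_ * mu]mulrA mulrC [in X in (_, X)]mulrAC; congr pair;
    rewrite -?mulrA ?(mulrCA mu^-1) ?mulVf ?divff //; field.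
have GE j N M : (j <= N * n)%N -> (j <= M * n)%N -> G j N = G j M.
  have le N' d' : (j <= N' * n)%N -> G j (N' + d')%N = G j N'.
    move=> h; elim: d' => [|d' IH]; first by rewrite addn0.
    by rewrite addnS GS // (leq_trans h) // leq_mul2r leq_addr orbT.
  move=> hN hM; case: (leqP N M) => [/subnKC <-|/ltnW/subnKC <-]; by rewrite le.
have jn j : (j <= j * n)%N by rewrite leq_pmulr.
have Gpos j N : posv (G j N).
  have [q1 q2] : posv (back j (N * n - j) p) by exact: back_posv.
  by split; rewrite /= mulr_gt0 // exprn_gt0 // invr_gt0.
have Gstep j : G j j = step j (G j.+1 j.+1).
  have js : (j <= j.+1 * n)%N by apply: leq_trans (jn j) _; rewrite leq_mul2r leqnSn orbT.
  rewrite (GE _ _ j.+1) // /G.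
  rewrite -subSS (subSn (jn j.+1)).
  rewrite /=; set q := back _ _ _; have := step_lin j (mu^-1 ^+ j.+1) q (0, 0).
  have -> : step j (0, 0) = (0, 0) by rewrite /step /= !mul0r addr0 mul0r.
  by rewrite /pair_add /pair_scale /= !addr0 => <-.
have Gper j : G (j + n)%N (j + n)%N = pair_scale mu^-1 (G j j).
  have h : (j + n <= j.+1 * n)%N by rewrite mulSnr leq_add2r.
  rewrite (GE _ _ j.+1) // /G back_per.
  rewrite mulSnr subnDr.
  by rewrite /pair_scale /= exprS !mulrA.
exists mu, (fun j => (G j j).1), (fun j => (G j j).2); split => //.
split => j.
- by case: (Gpos j j).
- by rewrite Gper.
- by rewrite [in LHS]Gstep /= divfK // lt0r_neq0.
- by rewrite [in LHS]Gstep /= divfK // lt0r_neq0.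
Qed.
End Perron.

(** * Closed chains of geodesics *)

Section Orbit.
Variables (R : realType) (k : nat).
Hypothesis k3 : (3 <= k)%N.
Variable Y : nat -> v3 R.
Hypothesis pY : polyrep k Y.
Implicit Types (C D E F : v3 R).

Let lY p : light (Y p). Proof. by case: pY. Qed.
Let m_gt0 p : 0 < ip (Y p) (Y p.+1).
Proof. by rewrite -lam_gt0; exact: (lam_side_gt0 k3 pY). Qed.
Let yy p : ip (Y p) (Y p) = 0. Proof. by case: (lY p). Qed.
Let m_ne0 p : ip (Y p) (Y p.+1) != 0. Proof. exact: lt0r_neq0. Qed.

Definition mirror b C := refl (Y b) (Y b.+1) C.

Lemma mirrorK b C : mirror b (mirror b C) = C.
Proof. by apply: reflK; rewrite ?yy. Qed.

Lemma sideform_mirror b C : sideform Y b (mirror b C) = - sideform Y b C.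
Proof. exact: det3_refl. Qed.

Lemma mirror_fix b C : sideform Y b C = 0 -> mirror b C = C.
Proof.
move=> h; rewrite {1}(side_span k3 pY h) /mirror reflD !reflZ refl_l ?yy //.
by rewrite refl_r ?yy // -(side_span k3 pY h).
Qed.

Lemma mirror_arc b E : light E -> sideform Y b E != 0 -> light (mirror b E).
Proof.
move=> le h; have [_ _ c] := det3_ip_gt0 (lY _) (lY _) le h.
by apply: refl_light; rewrite // ipC.
Qed.

Lemma plane_ext b C D : ip C (Y b) = ip D (Y b) -> ip C (Y b.+1) = ip D (Y b.+1) ->
  sideform Y b C = sideform Y b D -> C = D.
Proof.
move=> h1 h2 h3; pose Z := vadd C (vscale (-1) D).
have z3 : sideform Y b Z = 0 by rewrite /Z sideformD sideformZ h3; ring.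
have := side_span k3 pY z3; rewrite /Z !ipDl !ipZl h1 h2 !mulN1r !subrr !mul0r.
rewrite /vadd /vscale; case: (C) (D) => ? ? ? [? ? ?] /=; rewrite !mul0r !addr0.
by move=> [*]; congr V3; lra.
Qed.

(** The two lambda lengths determine the products with the ends of the side, and
    the square of the determinant with them, whose sign is known. *)
Lemma arc_unique b E F : light E -> light F ->
  sideform Y b E < 0 -> sideform Y b F < 0 ->
  lam E (Y b) = lam F (Y b) -> lam E (Y b.+1) = lam F (Y b.+1) -> E = F.
Proof.
move=> le lf he hf h1 h2.
have e1 : ip E (Y b) = ip F (Y b) by rewrite -!lam_sqr // h1.
have e2 : ip E (Y b.+1) = ip F (Y b.+1) by rewrite -!lam_sqr // h2.
apply: (plane_ext e1 e2); case: (le) (lf) => ee _ [ff _].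
have := det3_light (yy b) (yy b.+1) ee; have := det3_light (yy b) (yy b.+1) ff.
rewrite !(ipC (Y _) E) !(ipC (Y _) F) e1 e2 => <- /eqP; rewrite -/(sideform Y b E) -/(sideform Y b F).
by rewrite eqf_sqr => /orP[/eqP //|/eqP e]; move: he; rewrite e; lra.
Qed.

(** In the basis of the two ends and a normal vector N of the plane of the side,
    the coordinates of F are determined by the conditions. *)
Lemma arc_exists b (al be : R) : 0 < al -> 0 < be -> exists F,
  [/\ light F, sideform Y b F < 0, lam F (Y b) = al & lam F (Y b.+1) = be].
Proof.
move=> al0 be0; pose m := ip (Y b) (Y b.+1).
have m0 : 0 < m by exact: m_gt0.
pose N := V3 (v1 (Y b) * v2 (Y b.+1) - v2 (Y b) * v1 (Y b.+1))
  (v0 (Y b) * v2 (Y b.+1) - v2 (Y b) * v0 (Y b.+1))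
  (- (v0 (Y b) * v1 (Y b.+1) - v1 (Y b) * v0 (Y b.+1))).
have ipN C : ip C N = sideform Y b C by rewrite /ip /N /sideform /det3 /=; ring.
have nb : ip (Y b) N = 0 by rewrite ipN /sideform det3_aba.
have nb' : ip (Y b.+1) N = 0 by rewrite ipN /sideform det3_abb.
have nn : ip N N = - m ^+ 2.
  have g := det3_gram (Y b) (Y b.+1) N.
  move: g; rewrite -/(sideform Y b N) -ipN !yy nb nb' -/m => g.
  have ne : ip N N != 0.
    apply: contraTneq (m_gt0 b) => z; rewrite -leNgt.
    have zz : sideform Y b N = 0 by rewrite -ipN.
    have := side_span k3 pY zz; rewrite (ipC N) nb' (ipC N) nb !mul0r => eN.
    have : N = V3 0 0 0 by rewrite eN /vadd /vscale /= !mul0r addr0.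
    move=> eN0; have [n0 n1 n2] : [/\ v0 N = 0, v1 N = 0 & v2 N = 0] by rewrite eN0.
    move: n0 n1 n2 => /= n0 n1 n2.
    have [yb y0] := lY b; have [yb' y0'] := lY b.+1.
    have -> : ip (Y b) (Y b.+1) = 0; last by [].
    have e : ip (Y b) (Y b.+1) * v0 (Y b) = ip (Y b) (Y b) * v0 (Y b.+1) 
        + v1 (Y b) * (v1 (Y b) * v0 (Y b.+1) - v0 (Y b) * v1 (Y b.+1)) 
        + v2 (Y b) * (v2 (Y b) * v0 (Y b.+1) - v0 (Y b) * v2 (Y b.+1)).
      by rewrite /ip; ring.
    apply: (mulIf (lt0r_neq0 y0)); rewrite e yb !mul0r add0r.
    have -> : v1 (Y b) * v0 (Y b.+1) - v0 (Y b) * v1 (Y b.+1) = 0 by lra.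
    have -> : v2 (Y b) * v0 (Y b.+1) - v0 (Y b) * v2 (Y b.+1) = 0 by lra.
    by rewrite !mulr0 addr0.
  apply: (mulIf ne); rewrite -expr2 g; ring.
clearbody N.
(* the coefficient of N that makes F isotropic *)
pose r := Num.sqrt 2 * al * be / (m * Num.sqrt m).
have s2 : Num.sqrt (2 : R) ^+ 2 = 2 by rewrite sqr_sqrtr.
have sm : Num.sqrt m ^+ 2 = m by rewrite sqr_sqrtr // ltW.
have sm0 : 0 < Num.sqrt m by rewrite sqrtr_gt0.
have r0 : 0 < r by rewrite divr_gt0 ?mulr_gt0 // sqrtr_gt0.
have r2 : r ^+ 2 = 2 * al ^+ 2 * be ^+ 2 / m ^+ 3.
  rewrite /r expr_div_n !exprMn s2 sm; field; exact: lt0r_neq0.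
pose F := vadd (vadd (vscale (be ^+ 2 / m) (Y b)) (vscale (al ^+ 2 / m) (Y b.+1))) (vscale r N).
have mn := lt0r_neq0 m0.
have Fb : ip F (Y b) = al ^+ 2.
  by rewrite !(ipDl, ipZl) yy (ipC N) nb (ipC (Y b.+1)) -/m; field.
have Fb' : ip F (Y b.+1) = be ^+ 2.
  by rewrite !(ipDl, ipZl) yy (ipC N) nb' -/m; field.
have ff : ip F F = 0.
  rewrite !(ipDl, ipDr, ipZl, ipZr) !yy (ipC N (Y b)) (ipC N (Y b.+1)) nb nb' nn.
  rewrite (ipC (Y b.+1) (Y b)) -/m.
  transitivity (2 * be ^+ 2 * al ^+ 2 / m - r ^+ 2 * m ^+ 2); first by field.
  by rewrite r2; field.
have lF : light F by apply: (light_forward (lY b)); rewrite ?Fb ?exprn_gt0.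
exists F; split => //.
- rewrite -ipN !(ipDl, ipZl) nb nb' nn !mulr0 !add0r mulrN oppr_lt0.
  by rewrite mulr_gt0 // exprn_gt0.
- by rewrite /lam Fb sqrtr_sqr gtr0_norm.
- by rewrite /lam Fb' sqrtr_sqr gtr0_norm.
Qed.

(** The numbers u j and v j determine an ideal point F j beyond the side b j.  The
    recursion says that F j and the mirror image of F j.+1 have the same lambda
    lengths to the ends of this side, so they agree. *)
Lemma arcs_of_family n b mu u v : (0 < n)%N -> (forall j, b j != b j.+1 %[mod k]) ->
  (forall j, b (j + n)%N = b j) ->
  0 < mu -> family n (lamY Y) b mu u v -> exists F : nat -> v3 R,
  [/\ forall j, light (F j), forall j, sideform Y (b j) (F j) < 0,
      forall j, F j = mirror (b j) (F j.+1)
    & forall j, F (j + n)%N = vscale (mu ^- 2) (F j)].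
Proof.
move=> n0 hb bper mu0 [pos per hu hv].
have ex j : exists F, [/\ light F, sideform Y (b j) F < 0,
    lam F (Y (b j)) = u j & lam F (Y (b j).+1) = v j].
  by have [? ?] := pos j; exact: arc_exists.
have [F hF] := choice ex; exists F.
have lF j : light (F j) by case: (hF j).
have sF j : sideform Y (b j) (F j) < 0 by case: (hF j).
have uF j : lam (F j) (Y (b j)) = u j by case: (hF j).
have vF j : lam (F j) (Y (b j).+1) = v j by case: (hF j).
have sF' j : 0 < sideform Y (b j) (F j.+1).
  by apply: (arc_sideform_gt0 k3 pY (lF _) (sF _)); exact: hb.
split => // j.
  apply: (@arc_unique (b j)) => //.
  - by apply: mirror_arc => //; apply: lt0r_neq0.
  - by rewrite sideform_mirror oppr_lt0.
  - rewrite [RHS]/lam /mirror ip_refl_l ?yy // -/(lam _ _).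
    apply: (mulIf (lt0r_neq0 (lam_side_gt0 k3 pY (b j.+1)))).
    by rewrite (ptolemy_arc k3 pY _ (lF _) (sF _)) uF uF vF; exact: hu.
  - rewrite [RHS]/lam /mirror ip_refl_r ?yy // -/(lam _ _).
    apply: (mulIf (lt0r_neq0 (lam_side_gt0 k3 pY (b j.+1)))).
    by rewrite (ptolemy_arc k3 pY _ (lF _) (sF _)) uF vF vF; exact: hv.
have mu2 : 0 < mu ^- 2 by rewrite invr_gt0 exprn_gt0.
have lams E p : light E -> lam (vscale (mu ^- 2) E) (Y p) = mu^-1 * lam E (Y p).
  move=> le; rewrite /lam ipZl sqrtrM ?(ltW mu2) // -exprVn sqrtr_sqr gtr0_norm //.
  by rewrite invr_gt0.
apply: (@arc_unique (b j)).
- exact: lF.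
- exact: light_scale.
- by rewrite -[in sideform _ _](bper j).
- by rewrite sideformZ pmulr_rlt0.
- by rewrite lams // -{1}(bper j) uF uF; case: (per j).
- by rewrite lams // -{1}(bper j) vF vF; case: (per j).
Qed.

(** The frames of the geodesics of a closed trajectory, with the same parameter
    for all of them: the j-th one is followed from the side b j to the side
    b j.+1, and over one period the parameter is shifted by ln L. *)
Definition orbit_data n (b : nat -> nat) (L : R) (E F : nat -> v3 R) :=
  [/\ forall j, frame (E j) (F j),
      forall j, E j.+1 = mirror (b j.+1) (E j) /\ F j.+1 = mirror (b j.+1) (F j),
      forall j, sideform Y (b j.+1) (E j) < 0 /\ sideform Y (b j) (F j) < 0
    & forall j, E (j + n)%N = vscale L^-1 (E j) /\ F (j + n)%N = vscale L (F j)].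

(** The forward ends come from a solution for the labels b, and the backward ends
    from one for the reversed labels.  The product of the two ends is the same for
    all j, since reflections are isometries; this shows that both solutions have
    the same factor, and allows to normalise the ends to frames. *)
Lemma orbit_exists n b : (0 < n)%N -> (forall j, b j != b j.+1 %[mod k]) ->
  (forall j, b (j + n)%N = b j) -> (exists i, turn k b i) ->
  exists (L : R) (E F : nat -> v3 R), 0 < L /\ orbit_data n b L E F.
Proof.
move=> n0 hb bper [i0 ti0].
have bm m p : b (p + m * n)%N = b p.
  by elim: m => [|m IH]; [rewrite addn0 | rewrite mulSnr addnA bper].
have bmod i j : i = j %[mod n] -> b i = b j.
  by move=> e; rewrite (divn_eq i n) (divn_eq j n) e addnC bm addnC bm.
have hw := polyrep_weights k3 pY.
have [mu [u [v [mu0 fam]]]] := family_exists k3 n0 hw hb bper ti0.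
have [G [lG sG rG pG]] := arcs_of_family n0 hb bper mu0 fam.
(* reversal is multiplication by n - 1 modulo n; the labels remain periodic and
   are indexed by natural numbers *)
pose b' i := b (n.-1 * i)%N.
have b'E i : b' i = b (n.-1 * i.+1).+1.
  by apply: bmod; rewrite mulnS addnC -addnS prednK // modnDr.
have hb' j : b' j != b' j.+1 %[mod k] by rewrite b'E eq_sym /b'; exact: hb.
have bper' j : b' (j + n)%N = b' j by rewrite /b' mulnDr bm.
have inv j : b' (n.-1 * j)%N = b j.
  apply: bmod; rewrite mulnA.
  case: (n) n0 => // n' _ /=.
  have [->|np] := posnP n'; first by rewrite !modn1.
  have -> : (n' * n' = n'.-1 * n'.+1 + 1)%N by nia.
  by rewrite mulnDl mul1n mulnAC modnMDl.
have nextb j : b' (n.-1 * j.+1).+1 = b j.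
  rewrite -[RHS]inv; rewrite -(bper' (n.-1 * j)%N); congr b'.
  by rewrite mulnS addnC -addnS prednK.
have ti' : turn k b' (n.-1 * i0.+2)%N.
  have e1 : b' (n.-1 * i0.+2).+1 = b i0.+1 by exact: nextb.
  have e2 : b' (n.-1 * i0.+2).+2 = b i0.
    have -> : b' (n.-1 * i0.+2).+2 = b' (n.-1 * i0.+1).+1.
      rewrite -(bper' (n.-1 * i0.+1).+1); congr b'.
      by rewrite mulnS addSn addnC -addnS prednK.
    exact: nextb.
  move: ti0; rewrite /turn e1 e2 inv => /andP[t1 t2]; apply/andP; split.
    by apply: contra t1 => /andP[h1 h2]; rewrite eq_sym h2 eq_sym h1.
  by apply: contra t2 => /andP[h1 h2]; rewrite eq_sym h2 eq_sym h1.
have [nu [u' [v' [nu0 fam']]]] := family_exists k3 n0 hw hb' bper' ti'.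
have [H [lH sH rH pH]] := arcs_of_family n0 hb' bper' nu0 fam'.
pose E j := G j.+1; pose F0 j := vscale (nu ^+ 2 ^+ j) (H (n.-1 * j)%N).
have nu2 : 0 < nu ^+ 2 by rewrite exprn_gt0.
have lF0 j : light (F0 j) by apply: light_scale; rewrite ?exprn_gt0.
have rE j : E j.+1 = mirror (b j.+1) (E j) by rewrite /E [G j.+1]rG mirrorK.
have rF0 j : F0 j.+1 = mirror (b j.+1) (F0 j).
  rewrite /F0 rH inv.
  have -> : (n.-1 * j.+1).+1 = (n.-1 * j + n)%N by rewrite mulnS addnC -addnS prednK.
  rewrite pH /mirror !reflZ vscaleA exprS; congr vscale.
  by field; rewrite lt0r_neq0.
have sF0 j : sideform Y (b j) (F0 j) < 0.
  by rewrite sideformZ pmulr_rlt0 ?exprn_gt0 // -inv.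
have pF0 j : F0 (j + n)%N = vscale (nu ^+ 2) (F0 j).
  rewrite /F0 mulnDr.
  have pHm m p : H (p + m * n)%N = vscale (nu ^- 2 ^+ m) (H p).
    elim: m => [|m IH]; first by rewrite addn0 vscale1.
    by rewrite mulSnr addnA pH IH vscaleA -exprS.
  rewrite pHm !vscaleA; congr vscale.
  have -> : (j + n = j.+1 + n.-1)%N by lia.
  rewrite exprD -mulrA -exprMn divff ?expr1n ?mulr1 -?exprS //.
  exact: lt0r_neq0.
(* the ends are distinct: they lie beyond different sides *)
have ke j : 0 < ip (E j) (F0 j).
  rewrite lt0r ip_light_ge0 // ?andbT; last exact: lG.
  apply/negP => /eqP z; have eF := light_ip0 (lG j.+1) (lF0 j) z.
  have p1 : 0 < v0 (F0 j) / v0 (G j.+1).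
    by case: (lF0 j) (lG j.+1) => _ ? [_ ?]; rewrite divr_gt0.
  have := arc_sideform_gt0 k3 pY (lG j.+1) (sG j.+1) (hb j).
  have := sF0 j; rewrite eF sideformZ pmulr_rlt0 //; lra.
pose ka := ip (E 0%N) (F0 0%N).
have kaE j : ip (E j) (F0 j) = ka.
  by elim: j => // j IH; rewrite rE rF0 /mirror ip_refl ?yy.
have ka0 : 0 < ka by exact: ke.
have pE j : E (j + n)%N = vscale (mu ^- 2) (E j) by rewrite /E -addSn pG.
have munu : mu ^+ 2 = nu ^+ 2.
  have := kaE (0 + n)%N; rewrite pE pF0 ipZl ipZr -/ka mulrA => h.
  have mn : mu ^+ 2 != 0 by rewrite expf_neq0 // lt0r_neq0.
  have : mu ^- 2 * nu ^+ 2 = 1 by apply: (mulIf (lt0r_neq0 ka0)); rewrite mul1r.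
  by move/(congr1 (fun z => mu ^+ 2 * z)); rewrite mulrA divff // mul1r mulr1.
pose F j := vscale ((2 * ka)^-1) (F0 j).
have c0 : 0 < (2 * ka)^-1 by rewrite invr_gt0 mulr_gt0.
exists (mu ^+ 2), E, F; split; first by rewrite exprn_gt0.
split => j.
- split; [exact: lG|exact: light_scale|].
  by rewrite /F ipZr kaE; field; rewrite lt0r_neq0.
- by split; rewrite ?rE // /F rF0 /mirror reflZ.
- by split; [exact: sG|rewrite sideformZ pmulr_rlt0].
- by split; [exact: pE | rewrite /F pF0 munu [LHS]vscaleA [RHS]vscaleA mulrC].
Qed.
End Orbit.

(** * Existence of closed billiard trajectories *)

Section Build.
Variables (R : realType) (k : nat).
Hypothesis k3 : (3 <= k)%N.
Variables (x : 'I_k -> R * R) (Y : nat -> v3 R).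
Hypothesis hY : reps x Y.
Variables (n : nat) (a : n.-tuple 'I_k).
Hypothesis n0 : (0 < n)%N.
Let b := label a.
Hypothesis hb : forall j, b j != b j.+1 %[mod k].
Variables (L : R) (E F : nat -> v3 R).
Hypotheses (L0 : 0 < L) (orb : orbit_data Y n b L E F).

Let pY : polyrep k Y. Proof. by case: hY. Qed.
Let lY p : light (Y p). Proof. by case: pY. Qed.
Let fr j : frame (E j) (F j). Proof. by case: orb. Qed.
Let lE j : light (E j). Proof. by case: (fr j). Qed.
Let lF j : light (F j). Proof. by case: (fr j). Qed.
Let sE j : sideform Y (b j.+1) (E j) < 0. Proof. by case: orb => _ _ /(_ j) []. Qed.
Let sF j : sideform Y (b j) (F j) < 0. Proof. by case: orb => _ _ /(_ j) []. Qed.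
Let bk j : (b j < k)%N. Proof. by rewrite /b (label_tnth k3 n0). Qed.

Let P j := sideform Y (b j) (E j).
Let Q j := sideform Y (b j) (F j).
Let P0 j : 0 < P j.
Proof. by apply: (arc_sideform_gt0 k3 pY (lE j) (sE j)). Qed.
Let T := ln L.
Let expT : expR T = L. Proof. by rewrite lnK. Qed.

(* the time at which the j-th geodesic meets the side b j, see at_tau *)
Let tau j := ln (- Q j / P j) / 2.

Let sfpt i j t : sideform Y i (pt (E j) (F j) t) =
  expR t * sideform Y i (E j) + expR (- t) * sideform Y i (F j).
Proof. by rewrite /pt sideformD !sideformZ. Qed.

Let at_tau j : sideform Y (b j) (pt (E j) (F j) (tau j)) = 0.
Proof.
have q : 0 < - Q j / P j by rewrite divr_gt0 // oppr_gt0; exact: sF.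
have e : expR (tau j) * expR (tau j) = - Q j / P j.
  rewrite -expRD /tau; have -> : ln (- Q j / P j) / 2 + ln (- Q j / P j) / 2 = ln (- Q j / P j).
    by field.
  by rewrite lnK.
have xn := lt0r_neq0 (expR_gt0 (tau j)); have pn := lt0r_neq0 (P0 j).
rewrite sfpt -/(P j) -/(Q j) expRN; apply: (mulfI xn).
by rewrite mulrDr !mulrA e divfK // divff //; ring.
Qed.

Let sf_mono i j t u : t < u -> sideform Y i (F j) < 0 -> 0 < sideform Y i (E j) ->
  sideform Y i (pt (E j) (F j) t) < sideform Y i (pt (E j) (F j) u).
Proof.
move=> tu f e; rewrite !sfpt; apply: ltrD; first by rewrite ltr_pM2r // ltr_expR.
by rewrite ltr_nM2r // ltr_expR ltrN2.
Qed.

Let sf_mono' i j t u : t < u -> sideform Y i (E j) < 0 -> 0 < sideform Y i (F j) ->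
  sideform Y i (pt (E j) (F j) u) < sideform Y i (pt (E j) (F j) t).
Proof.
move=> tu f e; rewrite !sfpt; apply: ltrD; first by rewrite ltr_nM2r // ltr_expR.
by rewrite ltr_pM2r // ltr_expR ltrN2.
Qed.

Let Emir j : E j.+1 = mirror Y (b j.+1) (E j). Proof. by case: orb => _ /(_ j) []. Qed.
Let Fmir j : F j.+1 = mirror Y (b j.+1) (F j). Proof. by case: orb => _ /(_ j) []. Qed.

Let ptmirror j t : pt (E j.+1) (F j.+1) t = mirror Y (b j.+1) (pt (E j) (F j) t).
Proof. by rewrite Emir Fmir /mirror refl_pt. Qed.

Let at_tauS j : sideform Y (b j.+1) (pt (E j) (F j) (tau j.+1)) = 0.
Proof.
have := at_tau j.+1; rewrite ptmirror sideform_mirror => /eqP.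
by rewrite oppr_eq0 => /eqP.
Qed.

Let joint j : pt (E j.+1) (F j.+1) (tau j.+1) = pt (E j) (F j) (tau j.+1).
Proof. by rewrite ptmirror (mirror_fix k3 pY). Qed.

Let tau_lt j : tau j < tau j.+1.
Proof.
rewrite ltNge; apply/negP => h.
have h1 : 0 < sideform Y (b j) (pt (E j) (F j) (tau j.+1)).
  by apply: (side_sideform_gt0 k3 pY (pt_hyp _ (fr j)) (at_tauS j)); exact: hb.
move: h; rewrite le_eqVlt => /orP[/eqP e|h].
  by move: h1; rewrite e at_tau ltxx.
have := @sf_mono (b j) j _ _ h (sF j) (P0 j); rewrite at_tau => h2.
by move: h1; rewrite ltNge (ltW h2).
Qed.

(* between tau j and tau j.+1, the j-th geodesic is inside the polygon: the ends
   lie beyond only one side each *)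
Let inside j u i : tau j < u < tau j.+1 -> 0 < sideform Y i (pt (E j) (F j) u).
Proof.
move=> /andP[h1 h2].
have [e|ne] := eqVneq (i %% k)%N (b j %% k)%N.
  by rewrite (sideform_mod pY e) -(at_tau j); apply: sf_mono; rewrite ?P0 //; exact: sF.
have [e|ne'] := eqVneq (i %% k)%N (b j.+1 %% k)%N.
  rewrite (sideform_mod pY e) -(at_tauS j); apply: sf_mono' => //.
  by apply: (arc_sideform_gt0 k3 pY (lF j) (sF j)); rewrite eq_sym; exact: hb.
rewrite sfpt addr_gt0 // mulr_gt0 ?expR_gt0 //.
  exact: (arc_sideform_gt0 k3 pY (lE j) (sE j)).
exact: (arc_sideform_gt0 k3 pY (lF j) (sF j)).
Qed.

Let EFper j : E (j + n)%N = vscale L^-1 (E j) /\ F (j + n)%N = vscale L (F j).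
Proof. by case: orb. Qed.

Let ptper j t : pt (E (j + n)%N) (F (j + n)%N) (t + T) = pt (E j) (F j) t.
Proof.
have [-> ->] := EFper j; rewrite pt_shift expRN expT !vscaleA.
by rewrite divff ?mulVf ?vscale1 // lt0r_neq0.
Qed.

Let tauper j : tau (j + n)%N = tau j + T.
Proof.
have q : 0 < - Q j / P j by rewrite divr_gt0 // oppr_gt0; exact: sF.
have [eE eF] := EFper j.
rewrite /tau /Q /P /b label_per -/b eE eF !sideformZ -/(P j) -/(Q j).
have Ln := lt0r_neq0 L0; have pn := lt0r_neq0 (P0 j).
have -> : - (L * Q j) / (L^-1 * P j) = L * L * (- Q j / P j).
  by field; rewrite Ln pn.
move: (- Q j / P j) q => q' q.
by rewrite !lnM ?posrE ?mulr_gt0 // /T; field.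
Qed.

Let tau_mono i j : (i < j)%N -> tau i < tau j.
Proof.
elim: j => // j IH; rewrite ltnS leq_eqVlt => /orP[/eqP ->|/IH h]; first exact: tau_lt.
exact: lt_trans h (tau_lt j).
Qed.

Let tau_mono_inv i j : tau i < tau j -> (i < j)%N.
Proof.
move=> h; rewrite ltnNge leq_eqVlt; apply/negP => /orP[/eqP e|/tau_mono h'].
  by move: h; rewrite e ltxx.
by move: h'; rewrite ltNge (ltW h).
Qed.

Let T0 : 0 < T.
Proof.
have : tau 0%N < tau (0 + n)%N by apply: tau_mono; rewrite add0n.
by rewrite tauper ltrDl.
Qed.

Let tauperm m j : tau (j + m * n)%N = tau j + m%:R * T.
Proof.
elim: m => [|m IH]; first by rewrite mul0n addn0 mul0r addr0.
by rewrite mulSnr addnA tauper IH -natr1 mulrDl mul1r addrA.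
Qed.

Let ptperm m j t : pt (E (j + m * n)%N) (F (j + m * n)%N) (t + m%:R * T) = pt (E j) (F j) t.
Proof.
elim: m => [|m IH]; first by rewrite mul0n addn0 mul0r addr0.
by rewrite mulSnr addnA -natr1 mulrDl mul1r addrA ptper IH.
Qed.

Let above (r : R) : exists m : nat, r < m%:R * T.
Proof.
exists (Num.bound `|r / T|); rewrite -ltr_pdivrMr //.
exact: le_lt_trans (ler_norm _) (archi_boundP (normr_ge0 _)).
Qed.

Let locate t : tau 0%N <= t -> exists j, tau j <= t < tau j.+1.
Proof.
move=> h; have ex : exists j, t < tau j.
  have [m hm] := above (t - tau 0%N); exists (0 + m * n)%N.
  by rewrite tauperm; lra.
case: (ex_minnP ex) => j hj min; case: j hj min => [|j] hj min.
  by move: hj; rewrite ltNge h.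
exists j; rewrite hj andbT leNgt; apply/negP => /min; by rewrite ltnn.
Qed.

Let rel t p := exists m j : nat, tau j <= t + m%:R * T <= tau j.+1 /\
   p = seg (E j) (F j) (t + m%:R * T).

Let rel_ex t : exists p, rel t p.
Proof.
have [m hm] := above (tau 0%N - t).
have [|j /andP[h1 h2]] := locate (t := t + m%:R * T); first by lra.
by exists (seg (E j) (F j) (t + m%:R * T)), m, j; rewrite h1 ltW.
Qed.

Let same t i j : tau i <= t <= tau i.+1 -> tau j <= t <= tau j.+1 ->
  pt (E i) (F i) t = pt (E j) (F j) t.
Proof.
wlog ij : i j / (i <= j)%N.
  by move=> h h1 h2; case: (leqP i j) => [/h|/ltnW/h] ->.
move: ij; rewrite leq_eqVlt => /orP[/eqP -> //|ij] /andP[_ h1] /andP[h2 _].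
have [e|ne] := eqVneq j i.+1.
  have et : t = tau i.+1 by apply/eqP; rewrite eq_le h1 -e h2.
  by rewrite e et joint.
have : tau i.+1 < tau j by apply: tau_mono; rewrite ltn_neqAle eq_sym ne.
by move=> h3; have := lt_le_trans h3 h2; rewrite ltNge h1.
Qed.

Let rel_unique t p q : rel t p -> rel t q -> p = q.
Proof.
move=> [m [i [h1 ->]]] [m' [j [h2 ->]]]; congr proj.
wlog mm : m m' i j h1 h2 / (m <= m')%N.
  move=> h; case: (leqP m m') => [l|/ltnW l]; first exact: h h1 h2 l.
  by apply/esym; exact: h h2 h1 l.
move: h2; rewrite -(subnKC mm) natrD mulrDl addrA; set d := (m' - m)%N => h2.
rewrite -(ptperm d); apply: same => //.
by rewrite -addSn !tauperm !lerD2r.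
Qed.

(** A time t before tau 0 is moved by a multiple of the period; the value does not
    depend on the choice of the multiple, nor on that of the segment if t is a
    hitting time. *)
Lemma build_trajectory : exists gamma, forall t (m j : nat),
  tau j <= t + m%:R * T <= tau j.+1 -> gamma t = seg (E j) (F j) (t + m%:R * T).
Proof.
have [g hg] := choice rel_ex; exists g => t m j h.
by apply: rel_unique (hg t) _; exists m, j.
Qed.

Let frame_shift j s : frame (vscale (expR s) (E j)) (vscale (expR (- s)) (F j)).
Proof.
split; [exact: light_scale (expR_gt0 _) (lE j)|exact: light_scale (expR_gt0 _) (lF j)|].
by rewrite ipZl ipZr mulrA expRxMexpNx_1 mul1r; case: (fr j).
Qed.

(** The law of reflection holds since the frame after a hit is the mirror image of
    the one before it.  The trajectory stays in the polygon because each segment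
    has its ends on the boundary. *)
Lemma trajectory_exists : exists gamma T',
  closed_billiard_trajectory x gamma T' /\ hits_in_period x gamma T' a.
Proof.
have [g hg] := build_trajectory; exists g, T.
have lg t m j : tau j <= t + m%:R * T <= tau j.+1 ->
    lift (g t) = pt (E j) (F j) (t + m%:R * T).
  by move=> h; rewrite (hg _ _ _ h) lift_seg.
have start t : exists m : nat, forall m', (m <= m')%N -> tau 0%N <= t + m'%:R * T.
  have [m hm] := above (tau 0%N - t); exists m => m' mm.
  have : m%:R * T <= m'%:R * T by rewrite ler_pM2r // ler_nat.
  lra.
have hit t (m : nat) : tau 0%N <= t + m%:R * T -> boundary x (g t) ->
    exists j, t + m%:R * T = tau j.
  move=> h0 /(boundary_sideform k3 hY) [i hi]; have [j /andP[h1 h2]] := locate h0.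
  exists j; apply/eqP; move: h1; rewrite le_eqVlt => /orP[/eqP -> //|h1].
  have := @inside j (t + m%:R * T) i; rewrite h1 h2 => /(_ isT).
  by rewrite -lg ?hi ?ltxx // !ltW.
have sidetau t (m j : nat) : t + m%:R * T = tau j -> side x (Ordinal (bk j)) (g t).
  move=> e; apply/(side_sideform k3 hY); rewrite (@lg _ m j) ?e ?at_tau //.
  by rewrite lexx ltW.
have bdtau t (m j : nat) : t + m%:R * T = tau j -> boundary x (g t).
  by move=> /sidetau h; exists (Ordinal (bk j)).
have sideE t (m j : nat) (i : 'I_k) : t + m%:R * T = tau j -> side x i (g t) -> i = b j :> nat.
  move=> e /(side_sideform k3 hY) h.
  have /(side_sideform k3 hY) h' := sidetau _ _ _ e.
  apply/eqP; apply: contraT => ne.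
  have : 0 < sideform Y i (lift (g t)).
    apply: (side_sideform_gt0 k3 pY (lift_hyp _) h').
    by rewrite !modn_small.
  by rewrite h ltxx.
have gper t : g (t + T) = g t.
  have [m hm] := start t; have [j /andP[h1 h2]] := locate (hm m.+1 (leqnSn m)).
  have e : t + m.+1%:R * T = t + T + m%:R * T by rewrite -natr1; ring.
  have h : tau j <= t + m.+1%:R * T <= tau j.+1 by rewrite h1 ltW.
  rewrite [RHS](hg _ _ _ h) (hg (t + T) m j) -?e //.
have dist t (m j : nat) u : tau j <= t + m%:R * T -> t < u -> u + m%:R * T <= tau j.+1 ->
    hdist (g t) (g u) = u - t.
  move=> h1 h2 h3; rewrite (hg t m j) ?h1 /=; last by lra.
  rewrite (hg u m j) ?h3 ?andbT; last by lra.
  rewrite hdist_seg // opprD addrACA subrr addr0 distrC ger0_norm //; lra.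
split; first split => //.
- split.
  + move=> t C convC bdC; have [m hm] := start t.
    have [j /andP[h1 h2]] := locate (hm m (leqnn m)).
    have e1 : tau j - m%:R * T + m%:R * T = tau j by rewrite subrK.
    have e2 : tau j.+1 - m%:R * T + m%:R * T = tau j.+1 by rewrite subrK.
    have jj := tau_lt j.
    have g1 : g (tau j - m%:R * T) = seg (E j) (F j) (tau j).
      by rewrite (hg _ m j) e1 // lexx ltW.
    have g2 : g (tau j.+1 - m%:R * T) = seg (E j) (F j) (tau j.+1).
      by rewrite (hg _ m j) e2 // lexx ltW.
    have g3 : g t = seg (E j) (F j) (t + m%:R * T) by rewrite (hg _ m j) // h1 ltW.
    apply: (convC (g (tau j - m%:R * T)) (g (tau j.+1 - m%:R * T))).
    * exact/bdC/(bdtau _ _ _ e1).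
    * exact/bdC/(bdtau _ _ _ e2).
    * have d u v : u <= v -> hdist (seg (E j) (F j) u) (seg (E j) (F j) v) = v - u.
        by move=> uv; rewrite hdist_seg // distrC ger0_norm // subr_ge0.
      by rewrite g1 g2 g3 !d ?(ltW h2) ?(ltW jj) //; lra.
  + move=> s t st free; have [m hm] := start s.
    have [j /andP[h1 h2]] := locate (hm m (leqnn m)).
    apply: (@dist s m j) => //; rewrite leNgt; apply/negP => h3.
    have e2 : tau j.+1 - m%:R * T + m%:R * T = tau j.+1 by rewrite subrK.
    by apply: (free (tau j.+1 - m%:R * T)); [lra | exact: (bdtau _ _ _ e2)].
  + move=> s t; have [m hm] := start s.
    have [M hM] := above (t + m%:R * T - tau 0%N).
    apply: (@sub_finite_set _ _ ((fun j => tau j - m%:R * T) @` `I_(M * n))).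
      move=> u /= [/andP[u1 u2] bu].
      have [|j ej] := hit u m _ bu.
        by have := hm m (leqnn m); lra.
      exists j; last by rewrite -ej addrK.
      apply: tau_mono_inv; rewrite -ej -[(M * n)%N]add0n tauperm; lra.
    exact/finite_image/finite_II.
  + move=> t i si; have [m hm] := start t.
    have [j ej] : exists j, t + m.+1%:R * T = tau j.+1.
      have [|j ej] := hit t m.+1 (hm _ (leqnSn m)); first by exists i.
      case: j ej => [|j] ej; last by exists j.
      have := hm m (leqnn m); move: ej; rewrite -natr1 mulrDl mul1r.
      by have := T0; lra.
    have ib := sideE _ _ _ _ ej si.
    case: (si) => c [hc [s _ cs]]; set r := m.+1%:R * T in ej.
    have [A [B [al [be [al0 be0 eA eB [frA hcA]]]]]] := side_frame hY hc.
    pose E1 := vscale (expR r) (E j); pose F1 := vscale (expR (- r)) (F j).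
    pose E2 := vscale (expR r) (E j.+1); pose F2 := vscale (expR (- r)) (F j.+1).
    have fr1 : frame E1 F1 by exact: frame_shift.
    have fr2 : frame E2 F2 by exact: frame_shift.
    have left u : tau j <= u + r <= tau j.+1 -> g u = seg E1 F1 u.
      by move=> h; rewrite (hg _ m.+1 _ h) /seg pt_shift.
    have right u : tau j.+1 <= u + r <= tau j.+2 -> g u = seg E2 F2 u.
      by move=> h; rewrite (hg _ m.+1 _ h) /seg pt_shift.
    have jj := tau_lt j; have jj1 := tau_lt j.+1.
    have gt1 : g t = seg E1 F1 t by apply: left; rewrite ej lexx ltW.
    have gt2 : g t = seg E2 F2 t by apply: right; rewrite ej lexx ltW.
    have pA : pt A B s = pt E1 F1 t by rewrite -hcA cs gt1 lift_seg.
    have p2 : pt E2 F2 t = pt E1 F1 t by rewrite -!lift_seg // -gt1 -gt2.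
    have law := (reflection_law frA fr1 fr2 pA p2).2.
    exists c, s, (dproj (pt E1 F1 t) (tangent A B s)),
      (dproj (pt E1 F1 t) (tangent E1 F1 t)), (dproj (pt E1 F1 t) (tangent E2 F2 t)).
    split=> //.
    * rewrite -pA; apply: velocity_seg => //.
        by rewrite /seg -hcA proj_lift.
      by apply: nearW => h; rewrite /seg -hcA proj_lift.
    * apply: velocity_seg => //.
        by apply: within_subset => z /=; move/lt_eqF ->.
      near=> h; apply: left; apply/andP; split; last first.
        have : h < 0 by near: h; exact: nbhs_left_lt.
        by lra.
      have : tau j - tau j.+1 < h by near: h; apply: nbhs_left_gt; rewrite subr_lt0.
      by lra.
    * rewrite -p2; apply: velocity_seg => //.
        by apply: within_subset => z /=; move/gt_eqF ->.
      near=> h; apply: right; apply/andP; split.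
        have : 0 < h by near: h; exact: nbhs_right_gt.
        by lra.
      have : h < tau j.+2 - tau j.+1 by near: h; apply: nbhs_right_lt; rewrite subr_gt0.
      by lra.
    * apply: law.
      have m0 : ip (Y i) (Y i.+1) != 0.
        by rewrite lt0r_neq0 // -lam_gt0; exact: (lam_side_gt0 k3 pY).
      have rf C : refl B A C = mirror Y (b j.+1) C.
        by rewrite eA eB (refl_scale _ (lt0r_neq0 be0) (lt0r_neq0 al0) m0) ib.
      by rewrite !rf /E2 /F2 Emir Fmir /mirror !reflZ.
- exists (tau 0%N), (fun i : 'I_n => tau i); split.
  + by move=> i j; exact: tau_mono.
  + move=> t; split.
      move=> [/andP[h1 h2] bd].
      have h1' : tau 0%N <= t + 0%:R * T by rewrite mul0r addr0.
      have [j ej] := hit t 0%N h1' bd; rewrite mul0r addr0 in ej.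
      have jn : (j < n)%N.
        by apply: tau_mono_inv; rewrite -ej -[n]add0n tauper.
      by exists (Ordinal jn).
    move=> [j ->]; have jn := ltn_ord j; split.
      rewrite -tauper tau_mono ?add0n // andbT.
      by case: (nat_of_ord j) => // j'; rewrite ltW // tau_mono.
    by apply: (bdtau _ 0%N j); rewrite mul0r addr0.
  + move=> j; have := sidetau (tau j) 0%N j; rewrite mul0r addr0 => /(_ erefl).
    congr (side x _ _); apply: val_inj; rewrite /= /b (label_tnth k3 n0).
    by congr (nat_of_ord (tnth a _)); apply: val_inj; rewrite /= modn_small.
Unshelve. all: by end_near.
Qed.
End Build.

(** * Symmetries of ideal polygons *)

Section Lorentz.
Variable R : rcfType.
Implicit Types (X Z W : v3 R) (A B : v3 R -> v3 R).

Definition lorentz A :=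
  [/\ forall X Z, A (vadd X Z) = vadd (A X) (A Z),
      forall c X, A (vscale c X) = vscale c (A X)
    & forall X Z, ip (A X) (A Z) = ip X Z].

(** A linear isometry may be prescribed on a basis by vectors with the same Gram
    matrix; the last clause characterises its values by products. *)
Lemma gram_map X1 X2 X3 Z1 Z2 Z3 : det3 X1 X2 X3 != 0 ->
  ip Z1 Z1 = ip X1 X1 -> ip Z2 Z2 = ip X2 X2 -> ip Z3 Z3 = ip X3 X3 ->
  ip Z1 Z2 = ip X1 X2 -> ip Z2 Z3 = ip X2 X3 -> ip Z1 Z3 = ip X1 X3 ->
  exists A, [/\ lorentz A, A X1 = Z1, A X2 = Z2 & A X3 = Z3] /\
    (det3 Z1 Z2 Z3 != 0 /\ forall X W, ip X X1 = ip W Z1 -> ip X X2 = ip W Z2 ->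
      ip X X3 = ip W Z3 -> A X = W).
Proof.
move=> d e11 e22 e33 e12 e23 e13; set D := det3 X1 X2 X3 in d.
pose A X := vadd (vadd (vscale (det3 X X2 X3 / D) Z1)
                 (vscale (det3 X1 X X3 / D) Z2)) (vscale (det3 X1 X2 X / D) Z3).
have dZ : det3 Z1 Z2 Z3 != 0.
  have : det3 Z1 Z2 Z3 ^+ 2 = D ^+ 2.
    by rewrite /D !det3_gram e11 e22 e33 e12 e23 e13.
  by move=> e; rewrite -sqrf_eq0 e sqrf_eq0.
have A1 : A X1 = Z1.
  rewrite /A -/D det3_aab det3_aba !mul0r divff //.
  by rewrite /vadd /vscale !mul0r !mul1r !addr0; case: (Z1).
have A2 : A X2 = Z2.
  rewrite /A -/D det3_aab det3_abb !mul0r divff //.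
  by rewrite /vadd /vscale !mul0r !mul1r !addr0 !add0r; case: (Z2).
have A3 : A X3 = Z3.
  rewrite /A -/D det3_aba det3_abb !mul0r divff //.
  by rewrite /vadd /vscale !mul0r !mul1r !add0r; case: (Z3).
have Aip X W : ip (A X) (A W) = ip X W.
  rewrite [in RHS](basis_coord X d) [in RHS](basis_coord W d) -/D /A.
  rewrite !(ipDl, ipDr, ipZl, ipZr) e11 e22 e33 e12 e23 e13.
  by rewrite (ipC Z2 Z1) (ipC Z3 Z1) (ipC Z3 Z2) e12 e13 e23
    (ipC X2 X1) (ipC X3 X1) (ipC X3 X2).
exists A; split; split => //.
- split=> // [X W|c X].
    by rewrite /A /det3 /vadd /vscale /=; congr V3; field.
  by rewrite /A /det3 /vadd /vscale /=; congr V3; field.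
- move=> X W h1 h2 h3; apply: (basis_ext dZ).
  + by rewrite -{1}A1 Aip.
  + by rewrite -{1}A2 Aip.
  + by rewrite -{1}A3 Aip.
Qed.

Lemma lorentz_det A : lorentz A -> exists2 d, d != 0 &
  forall X Z W, det3 (A X) (A Z) (A W) = d * det3 X Z W.
Proof.
move=> [add scale iso].
pose e0 : v3 R := V3 1 0 0; pose e1 : v3 R := V3 0 1 0; pose e2 : v3 R := V3 0 0 1.
have ex X : X = vadd (vadd (vscale (v0 X) e0) (vscale (v1 X) e1)) (vscale (v2 X) e2).
  by case: X => *; rewrite /vadd /vscale /=; congr V3; ring.
exists (det3 (A e0) (A e1) (A e2)).
  rewrite -sqrf_eq0 det3_gram !iso /ip /=.
  by rewrite !(mulr0, mul0r, mulr1, subr0, add0r, addr0, sub0r, mul1r) expr0n /= !(subr0,mulrNN, mulr1) oner_eq0.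
move=> X Z W; rewrite {1}(ex X) {1}(ex Z) {1}(ex W) !add !scale.
move: (A e0) (A e1) (A e2) => [? ? ?] [? ? ?] [? ? ?].
by rewrite /det3 /vadd /vscale /=; ring.
Qed.
End Lorentz.

Section Isometries.
Variable R : realType.
Implicit Types (f : hplane R -> hplane R) (A : v3 R -> v3 R).

(** An isometry preserves the Gram matrix of three points of the hyperboloid that
    form a basis, and any other point is determined by its products with them. *)
Lemma isometry_lorentz f : (forall p q, hdist (f p) (f q) = hdist p q) ->
  exists2 A, lorentz A & forall p, lift (f p) = A (lift p).
Proof.
move=> hf; have ipf p q : ip (lift (f p)) (lift (f q)) = ip (lift p) (lift q).
  by rewrite -!cosh_hdist hf.
pose C0 : v3 R := V3 1 0 0; pose C1 : v3 R := V3 (5 / 3) (4 / 3) 0.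
pose C2 : v3 R := V3 (5 / 3) 0 (4 / 3).
have h0 : hyp C0 by split; rewrite /ip /=; lra.
have h1 : hyp C1 by split; rewrite /ip /=; lra.
have h2 : hyp C2 by split; rewrite /ip /=; lra.
have d : det3 (lift (proj C0)) (lift (proj C1)) (lift (proj C2)) != 0.
  by rewrite !lift_proj //; apply: lt0r_neq0; rewrite /det3 /=; lra.
have [A [[lA _ _ _] [_ ext]]] := gram_map d (ipf (proj C0) (proj C0))
  (ipf (proj C1) (proj C1)) (ipf (proj C2) (proj C2)) (ipf (proj C0) (proj C1))
  (ipf (proj C1) (proj C2)) (ipf (proj C0) (proj C2)).
by exists A => // p; apply/esym/ext; rewrite ipf.
Qed.

Lemma lorentz_light f A E : lorentz A -> (forall p, lift (f p) = A (lift p)) ->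
  light E -> light (A E).
Proof.
move=> [_ _ iso] hA lE; pose p : hplane R := proj (V3 1 0 0).
apply: (null_forward (lift_hyp (f p))); first by rewrite iso; case: lE.
by rewrite hA iso ipC; apply: ip_hyp_light; first exact: lift_hyp.
Qed.

Section Symmetry.
Variable k : nat.
Hypothesis k3 : (3 <= k)%N.
Variables (x : 'I_k -> R * R) (Y : nat -> v3 R).
Hypothesis hY : reps x Y.
Let pY : polyrep k Y. Proof. by case: hY. Qed.
Let lY p : light (Y p). Proof. by case: pY. Qed.

(** The permutation of the vertices by f is i0 + i if d holds, and i0 - i, written
    with a natural number, otherwise. *)
Definition code f (i0 : 'I_k) (d : bool) := exists2 A, lorentz A &
  (forall p, lift (f p) = A (lift p)) /\
  forall i : nat, exists2 r, 0 < r &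
    A (Y i) = vscale r (Y (if d then i0 + i else i0 + k.-1 * i)%N).

Lemma exp_limit_ge0 (a c : R) : (forall s, 0 <= expR s * a + expR (- s) * c) -> 0 <= a.
Proof.
move=> h; rewrite leNgt; apply/negP => a0.
pose z := (`|c| + 1) / - a.
have z0 : 0 < z by rewrite divr_gt0 ?oppr_gt0 // ltr_wpDl.
pose s := ln z / 2; have e2 : expR s * expR s = z.
  rewrite -expRD /s; have -> : ln z / 2 + ln z / 2 = ln z by field.
  by rewrite lnK.
have := h s; rewrite expRN => hs.
have xp := expR_gt0 s; have : 0 <= expR s * (expR s * a + (expR s)^-1 * c).
  by rewrite mulr_ge0 // ltW.
rewrite mulrDr !mulrA divff ?lt0r_neq0 // mul1r e2 /z.
have -> : (`|c| + 1) / - a * a = - (`|c| + 1) by field; lra.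
by have := ler_norm c; lra.
Qed.

(** The vertex Y i is the limit of a ray on a side.  The image of the ray stays in
    the polygon, so its limit is an ideal point of the polygon, thus a vertex. *)
Lemma symmetry_vertex f A : (forall p, polygon x p -> polygon x (f p)) -> lorentz A ->
  (forall p, lift (f p) = A (lift p)) -> forall i : nat, exists q : 'I_k,
  exists2 r, 0 < r & A (Y i) = vscale r (Y q).
Proof.
move=> hf lA hA i; have [add scale iso] := lA.
have k0 : (0 < k)%N by lia.
have lAY : light (A (Y i)) by exact: lorentz_light lA hA (lY i).
suff h j : 0 <= sideform Y j (A (Y i)).
  have [q qk hq] := ideal_point_vertex k3 pY lAY h.
  by exists (Ordinal qk).
pose i' := Ordinal (ltn_pmod i k0).
have ei : Y i' = Y i by rewrite /= (polyrep_mod pY).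
have eiS : Y i'.+1 = Y i.+1.
  by apply: (polyrep_eqmod pY); apply: eqmodS; rewrite /= modn_mod.
have m0 : 0 < ip (Y i) (Y i.+1) by rewrite -lam_gt0; exact: (lam_side_gt0 k3 pY).
pose m := ip (Y i) (Y i.+1).
have c0 : 0 < (2 * m)^-1 by rewrite invr_gt0 mulr_gt0.
pose F := vscale (2 * m)^-1 (Y i.+1).
have fr : frame (Y i) F.
  split; [exact: lY|exact: light_scale|].
  by rewrite /F ipZr -/m; field; rewrite lt0r_neq0.
apply: (@exp_limit_ge0 _ (sideform Y j (A F))) => s.
have -> : expR s * sideform Y j (A (Y i)) + expR (- s) * sideform Y j (A F) =
    sideform Y j (lift (f (seg (Y i) F s))).
  by rewrite hA lift_seg // /pt add !scale sideformD !sideformZ.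
apply: (polygon_sideform k3 hY); apply: hf; apply: boundary_polygon.
exists i'; apply/(side_sideform k3 hY); rewrite lift_seg // /pt sideformD /F !sideformZ.
by rewrite /sideform ei eiS det3_aba det3_abb !mulr0 addr0.
Qed.

(** The map preserves or reverses the orientation, according to the sign of its
    determinant d, and sides are the pairs of vertices with all other vertices on
    one side; hence sg maps neighbours to neighbours in a constant sense. *)
Lemma symmetry_code f : symmetries x f -> exists c : 'I_k * bool, code f c.1 c.2.
Proof.
move=> [[_ hiso] himg].
have hf p : polygon x p -> polygon x (f p) by move=> h; rewrite -himg; exists p.
have [A lA hA] := isometry_lorentz hiso.
have [sg hsg] := choice (symmetry_vertex hf lA hA).
have [d d0 dA] := lorentz_det lA; have [_ _ iso] := lA.
have k0 : (0 < k)%N by lia.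
have lAY i : light (A (Y i)) by exact: lorentz_light lA hA (lY i).
have eqm (p q : nat) : ip (Y p) (Y q) = 0 -> p = q %[mod k].
  move=> h; apply/eqP; apply: contraT => ne.
  by have := lam_vertex_gt0 k3 pY ne; rewrite lam_gt0 h ltxx.
have inj (i j : nat) : sg i = sg j -> i = j %[mod k].
  move=> e; apply: eqm; rewrite -iso.
  have [r r0 ->] := hsg i; have [r' r'0 ->] := hsg j.
  by rewrite e ipZl ipZr; case: (lY (sg j)) => -> _; rewrite !mulr0.
have surj (l : 'I_k) : exists j, sg j = l.
  have bij : injective (fun i : 'I_k => sg i).
    by move=> i j /inj; rewrite !modn_small // => /val_inj.
  have /codomP[j ->] : l \in codom (fun i : 'I_k => sg i).
    by apply: (@inj_card_onto _ _ (fun i : 'I_k => sg i)).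
  by exists j.
(* a pair of vertices with all other vertices on one side is a side *)
have adj (p q : nat) : p != q %[mod k] -> (forall l : 'I_k, 0 <= det3 (Y p) (Y q) (Y l)) ->
    q = p.+1 %[mod k].
  move=> ne h; apply/eqP; apply: contraT => ne'.
  have h1 : 0 < sideform Y p (Y q).
    by apply: (sideform_vertex_gt0 k3 pY) => //; rewrite eq_sym.
  have := h (Ordinal (ltn_pmod p.+1 k0)); rewrite /= (polyrep_mod pY) det3_swap.
  by rewrite -/(sideform Y p (Y q)) oppr_ge0 leNgt h1.
have side_sg i (l : 'I_k) : exists2 c, 0 < c &
    d * c = det3 (Y (sg i)) (Y (sg i.+1)) (Y l) \/ 0 = det3 (Y (sg i)) (Y (sg i.+1)) (Y l).
  have [j ej] := surj l; have := sideform_vertex_ge0 k3 pY i j; rewrite le_eqVlt => hs.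
  have [r r0 e1] := hsg i; have [r' r'0 e2] := hsg i.+1; have [t t0 e3] := hsg j.
  have e : r * r' * t * det3 (Y (sg i)) (Y (sg i.+1)) (Y l) = d * sideform Y i (Y j).
    by rewrite -dA e1 e2 e3 ej /det3 /vscale /=; ring.
  have rn : r * r' * t != 0 by rewrite !mulf_neq0 ?lt0r_neq0.
  case/orP: hs => [/eqP z|p0].
    by exists 1 => //; right; apply: (mulfI rn); rewrite e -z !mulr0.
  exists (sideform Y i (Y j) / (r * r' * t)); first by rewrite divr_gt0 ?mulr_gt0.
  by left; apply: (mulfI rn); rewrite e; field; rewrite !lt0r_neq0.
have ne_sg (i : nat) : (sg i : nat) != sg i.+1 %[mod k].
  rewrite !modn_small //; apply/eqP => /val_inj /inj e.
  by have := neqmodS k3 i; rewrite e eqxx.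
have fin b0 : (forall i, sg i = (if b0 then sg 0%N + i else sg 0%N + k.-1 * i)%N
    %[mod k]) -> code f (sg 0%N) b0.
  move=> e.
  exists A => //; split => // i; have [r r0 h] := hsg i; exists r => //.
  rewrite h (polyrep_eqmod pY (e i)) {e}; by case: b0.
have [dp|dn] := ltP 0 d.
  exists (sg 0%N, true); apply: (fin true) => i.
  elim: i => [|i IH]; first by rewrite addn0.
  rewrite (adj (sg i) (sg i.+1)) //; first by rewrite addnS; exact: eqmodS.
  move=> l; have [c c0 [<-|<-]] := side_sg i l => //.
  by rewrite mulr_ge0 // ltW.
exists (sg 0%N, false); apply: (fin false) => i.
elim: i => [|i IH]; first by rewrite muln0 addn0.
have h : sg i = (sg i.+1).+1 %[mod k].
  apply: adj; first by rewrite eq_sym.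
  move=> l; rewrite det3_swap12 oppr_ge0.
  have [c c0 [<-|<-]] := side_sg i l => //.
  by rewrite mulr_le0_ge0 // ltW.
apply/eqP; rewrite -(eqn_modDr 1) !addn1 -h IH mulnS; apply/eqP.
rewrite -[RHS]/(((sg 0%N + (k.-1 + k.-1 * i)).+1 %% k)%N).
have -> : ((sg 0%N + (k.-1 + k.-1 * i)).+1 = (sg 0%N + k.-1 * i) + k)%N by lia.
by rewrite modnDr.
Qed.

(** Three vertices form a basis, and the scaling factors of their images are
    determined by the three products between them. *)
Lemma code_inj f g i0 d : code f i0 d -> code g i0 d -> f = g.
Proof.
move=> [A [Aadd Asc Aiso] [hA hAY]] [B [Badd Bsc Biso] [hB hBY]].
pose s i := (if d then i0 + i else i0 + k.-1 * i)%N.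
have d3 : 0 < det3 (Y 0) (Y 1%N) (Y 2%N) by case: pY => _ _; apply; lia.
have [p1 p2 p3] := det3_ip_gt0 (lY _) (lY _) (lY _) (lt0r_neq0 d3).
have [a0 a0p eA0] := hAY 0%N; have [a1 a1p eA1] := hAY 1%N; have [a2 a2p eA2] := hAY 2%N.
have [b0 b0p eB0] := hBY 0%N; have [b1 b1p eB1] := hBY 1%N; have [b2 b2p eB2] := hBY 2%N.
have prod i j a a' c c' : 0 < ip (Y i) (Y j) ->
   A (Y i) = vscale a (Y (s i)) -> A (Y j) = vscale a' (Y (s j)) ->
   B (Y i) = vscale c (Y (s i)) -> B (Y j) = vscale c' (Y (s j)) -> a * a' = c * c'.
  move=> h e1 e2 e3 e4; have := Aiso (Y i) (Y j); have := Biso (Y i) (Y j).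
  rewrite e1 e2 e3 e4 !ipZl !ipZr !mulrA => h1 h2.
  have ne : ip (Y (s i)) (Y (s j)) != 0.
    by apply: contraTneq h => z; move: h1; rewrite z mulr0 => <-; rewrite ltxx.
  by apply: (mulIf ne); rewrite h1 h2.
have q01 := prod _ _ _ _ _ _ p1 eA0 eA1 eB0 eB1.
have q12 := prod _ _ _ _ _ _ p2 eA1 eA2 eB1 eB2.
have q02 := prod _ _ _ _ _ _ p3 eA0 eA2 eB0 eB2.
have e0 : a0 = b0.
  have : a0 ^+ 2 = b0 ^+ 2.
    have ne : a1 * a2 != 0 by rewrite mulf_neq0 ?lt0r_neq0.
    apply: (mulIf ne); transitivity ((a0 * a1) * (a0 * a2)); first by ring.
    by rewrite q01 q02 q12; ring.
  by move/eqP; rewrite eqrXn2 ?ltW // => /eqP.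
have e1 : a1 = b1 by apply: (mulfI (lt0r_neq0 a0p)); rewrite q01 e0.
have e2 : a2 = b2 by apply: (mulfI (lt0r_neq0 a0p)); rewrite q02 e0.
have AB X : A X = B X.
  by rewrite (basis_coord X (lt0r_neq0 d3)) !Aadd !Badd !Asc !Bsc
     eA0 eA1 eA2 eB0 eB1 eB2 e0 e1 e2.
by apply: funext => p; apply: lift_inj; rewrite hA hB.
Qed.

(** The codes of symmetries are pairwise different and their number is 2k, so all
    codes occur; the code (1, true) is the rotation by one vertex. *)
Lemma regular_rotation : regular x -> exists2 A, lorentz A &
  forall i : nat, exists2 r, 0 < r & A (Y i) = vscale r (Y i.+1).
Proof.
move=> [Phi [inj rng _]].
have cd g : exists c : 'I_k * bool, code (Phi g) c.1 c.2.
  by apply: symmetry_code; rewrite -rng; exists g.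
have [c hc] := choice cd.
have cinj : injective c.
  by move=> g h e; apply: inj; apply: code_inj (hc g) _; rewrite e; exact: hc.
have card : (#|{: 'I_k * bool}| <= #|{: gsort 'D_(k.*2)}|)%N.
  rewrite card_prod card_ord card_bool muln2.
  by rewrite -cardsT card_dihedral //; lia.
have k1 : (1 < k)%N by lia.
have /codomP[g eg] : (Ordinal k1, true) \in codom c by apply: inj_card_onto.
have [A lA [_ hA]] := hc g; exists A => // i; have [r r0 h] := hA i; exists r => //.
by rewrite h -eg.
Qed.

(** The orbit of one vector under A has circulant lambda lengths.  It is periodic:
    after k steps the vector is multiplied by some nu, and nu = 1 because A
    preserves the product of two consecutive vectors. *)
Lemma rotation_reps A : lorentz A ->
  (forall i : nat, exists2 r, 0 < r & A (Y i) = vscale r (Y i.+1)) ->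
  exists Y', reps x Y' /\ circulant (lamY Y').
Proof.
move=> [_ sc iso] hA; pose Y' p := iter p A (Y 0).
have prop p : exists2 r, 0 < r & Y' p = vscale r (Y p).
  elim: p => [|p [r r0 e]]; first by exists 1; rewrite ?vscale1.
  have [r' r'0 e'] := hA p; exists (r * r'); first by rewrite mulr_gt0.
  by rewrite /Y' /= -/(Y' p) e sc e' vscaleA.
have per : Y' k = Y' 0%N.
  have [nu nu0 e] := prop k; have e0 : Y' k = vscale nu (Y' 0%N).
    by rewrite e; congr vscale; case: pY => _ /(_ 0%N) + _; rewrite add0n.
  have e1 : Y' k.+1 = vscale nu (Y' 1%N) by rewrite /Y' /= -/(Y' k) e0 sc.
  have m0 : 0 < ip (Y' 0%N) (Y' 1%N).
    have [r r0 h] := prop 1%N; rewrite h ipZr mulr_gt0 //.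
    by rewrite -lam_gt0; exact: (lam_side_gt0 k3 pY).
  have it m X Z : ip (iter m A X) (iter m A Z) = ip X Z.
    by elim: m => //= m IH; rewrite iso.
  have ek m : Y' (m + k)%N = iter k A (Y' m) by rewrite /Y' addnC iterD.
  have : ip (Y' (0 + k)%N) (Y' (1 + k)%N) = ip (Y' 0%N) (Y' 1%N) by rewrite !ek it.
  rewrite add0n add1n e0 e1 ipZl ipZr mulrA => h.
  have : nu ^+ 2 = 1 ^+ 2.
    by apply: (mulIf (lt0r_neq0 m0)); rewrite expr1n mul1r expr2.
  by move/eqP; rewrite eqrXn2 ?ltW // => /eqP ->; rewrite vscale1.
exists Y'; split; last by move=> p q; rewrite /lamY /Y' /= /lam iso.
split; last first.
  move=> i; have [r r0 ->] := prop i; case: hY => _ /(_ i) [r' r'0 ->].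
  by exists (r * r'); rewrite ?mulr_gt0 // vscaleA.
split=> [p|p|p q r h1 h2].
- by have [r r0 ->] := prop p; apply: light_scale.
- by rewrite {1}/Y' iterD -/(Y' k) per.
- have [a a0 ->] := prop p; have [b b0 ->] := prop q; have [c c0 ->] := prop r.
  have -> : det3 (vscale a (Y p)) (vscale b (Y q)) (vscale c (Y r)) =
      a * b * c * det3 (Y p) (Y q) (Y r) by rewrite /det3 /vscale /=; ring.
  by rewrite !mulr_gt0 //; case: pY => _ _; apply.
Qed.
End Symmetry.
End Isometries.

(** * Congruence of polygons with equal cross ratios *)

Section Congruence.
Variables (R : realType) (k : nat).
Hypothesis k3 : (3 <= k)%N.
Implicit Types (X Z : v3 R).

(** Congruence includes the labels of the vertices; the inverse B is part of the
    data because lorentz does not provide it. *)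
Definition congruent (Y0 Y : nat -> v3 R) := exists A B : v3 R -> v3 R,
  [/\ lorentz A, lorentz B, cancel A B /\ cancel B A
    & forall p, exists2 r, 0 < r & A (Y0 p) = vscale r (Y p)].

Section CrossRatio.
Variables Y0 Y : nat -> v3 R.
Hypotheses (p0 : polyrep k Y0) (pY : polyrep k Y) (c0 : circulant (lamY Y0)).
Let s := lamY Y0.
Let w := lamY Y.
Let l0 p : light (Y0 p). Proof. by case: p0. Qed.
Let lY p : light (Y p). Proof. by case: pY. Qed.
Let ws := polyrep_weights k3 p0.
Let ww := polyrep_weights k3 pY.

Let ne12 p : (p != p.+1 %[mod k]) * (p != p.+2 %[mod k]).
Proof. by split; apply: neqmod_small; lia. Qed.
Let ne3 p : (4 <= k)%N -> p != p.+3 %[mod k].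
Proof. by move=> k4; apply: neqmod_small; lia. Qed.

Let s1 p : 0 < s p p.+1. Proof. by apply: (weights_gt0 ws); rewrite ne12. Qed.
Let s2 p : 0 < s p p.+2. Proof. by apply: (weights_gt0 ws); rewrite ne12. Qed.
Let w1 p : 0 < w p p.+1. Proof. by apply: (weights_gt0 ww); rewrite ne12. Qed.
Let w2 p : 0 < w p p.+2. Proof. by apply: (weights_gt0 ww); rewrite ne12. Qed.

Let ipw p q : ip (Y p) (Y q) = w p q ^+ 2.
Proof. by rewrite /w /lamY lam_sqr. Qed.
Let ips p q : ip (Y0 p) (Y0 q) = s p q ^+ 2.
Proof. by rewrite /s /lamY lam_sqr. Qed.

(** Three vertices can be mapped to three vertices, after scaling them by g0, g1,
    g2 to adjust their products.  By induction, if three consecutive vertices are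
    mapped to the right rays, then so is the next one: Ptolemy's theorem and the
    cross ratio determine its products with the three. *)
Lemma cross_ratio_congruent : ((4 <= k)%N -> forall t, (t < k)%N ->
    w t t.+1 * w t.+2 t.+3 * s 0%N 2%N ^+ 2 =
    s 0%N 1%N ^+ 2 * (w t t.+2 * w t.+1 t.+3)) -> congruent Y0 Y.
Proof.
move=> cr.
have d : 0 < det3 (Y0 0%N) (Y0 1%N) (Y0 2%N) by case: p0 => _ _; apply; lia.
have dY p : 0 < det3 (Y p) (Y p.+1) (Y p.+2) by case: pY => _ _; apply; lia.
have a1 := s1 0; have a2 := s1 1; have a3 := s2 0.
have b1 := w1 0; have b2 := w1 1; have b3 := w2 0.
pose g0 := s 0%N 1%N * s 0%N 2%N * w 1%N 2%N / (w 0%N 1%N * w 0%N 2%N * s 1%N 2%N).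
pose g1 := s 0%N 1%N * s 1%N 2%N * w 0%N 2%N / (w 0%N 1%N * w 1%N 2%N * s 0%N 2%N).
pose g2 := s 0%N 2%N * s 1%N 2%N * w 0%N 1%N / (w 0%N 2%N * w 1%N 2%N * s 0%N 1%N).
have g00 : 0 < g0 by rewrite divr_gt0 ?mulr_gt0.
have g10 : 0 < g1 by rewrite divr_gt0 ?mulr_gt0.
have g20 : 0 < g2 by rewrite divr_gt0 ?mulr_gt0.
have n1 := lt0r_neq0 a1; have n2 := lt0r_neq0 a2; have n3 := lt0r_neq0 a3.
have m1 := lt0r_neq0 b1; have m2 := lt0r_neq0 b2; have m3 := lt0r_neq0 b3.
have zz c p : ip (vscale c (Y p)) (vscale c (Y p)) = ip (Y0 p) (Y0 p).
  by rewrite ipZl ipZr; case: (lY p) (l0 p) => -> _ [-> _]; rewrite !mulr0.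
have e01 : ip (vscale g0 (Y 0%N)) (vscale g1 (Y 1%N)) = ip (Y0 0%N) (Y0 1%N).
  by rewrite ipZl ipZr ipw ips /g0 /g1; field; rewrite ?n1 ?n2 ?n3 ?m1 ?m2 ?m3.
have e12 : ip (vscale g1 (Y 1%N)) (vscale g2 (Y 2%N)) = ip (Y0 1%N) (Y0 2%N).
  by rewrite ipZl ipZr ipw ips /g1 /g2; field; rewrite ?n1 ?n2 ?n3 ?m1 ?m2 ?m3.
have e02 : ip (vscale g0 (Y 0%N)) (vscale g2 (Y 2%N)) = ip (Y0 0%N) (Y0 2%N).
  by rewrite ipZl ipZr ipw ips /g0 /g2; field; rewrite ?n1 ?n2 ?n3 ?m1 ?m2 ?m3.
have [A [[lA A0 A1 A2] [dZ _]]] :=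
  gram_map (lt0r_neq0 d) (zz g0 0%N) (zz g1 1%N) (zz g2 2%N) e01 e12 e02.
have [B [[lB B0 B1 B2] [_ extB]]] := gram_map dZ (esym (zz g0 0%N)) (esym (zz g1 1%N))
  (esym (zz g2 2%N)) (esym e01) (esym e12) (esym e02).
have [Aadd Asc Aiso] := lA; have [Badd Bsc Biso] := lB.
exists A, B; split=> //.
  have AB : cancel A B.
    by move=> X; apply: extB; rewrite -?A0 -?A1 -?A2 Aiso.
  split=> // X; apply: (basis_ext dZ).
  - by rewrite -{1}A0 Aiso -B0 Biso.
  - by rewrite -{1}A1 Aiso -B1 Biso.
  - by rewrite -{1}A2 Aiso -B2 Biso.
(* with factors r ^+ 2, lambda lengths are scaled by products of the r *)
pose good p := exists2 r, 0 < r & A (Y0 p) = vscale (r ^+ 2) (Y p).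
have sq (g : R) : 0 < g -> exists2 r : R, 0 < r & g = r ^+ 2.
  by move=> h; exists (Num.sqrt g); rewrite ?sqrtr_gt0 // sqr_sqrtr // ltW.
have G0 : good 0%N by have [r r0 e] := sq _ g00; exists r; rewrite // A0 e.
have G1 : good 1%N by have [r r0 e] := sq _ g10; exists r; rewrite // A1 e.
have G2 : good 2%N by have [r r0 e] := sq _ g20; exists r; rewrite // A2 e.
have rel p q r t : 0 < r -> 0 < t -> A (Y0 p) = vscale (r ^+ 2) (Y p) ->
    A (Y0 q) = vscale (t ^+ 2) (Y q) -> s p q = r * t * w p q.
  move=> r0 t0 e1 e2; have : s p q ^+ 2 = (r * t * w p q) ^+ 2.
    by rewrite -ips -Aiso e1 e2 ipZl ipZr ipw; ring.
  have sp : 0 <= s p q by exact: (weights_ge0 p q ws).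
  have wp : 0 <= r * t * w p q by rewrite !mulr_ge0 ?(ltW r0) ?(ltW t0) // (weights_ge0 p q ww).
  by move/eqP; rewrite eqrXn2 // => /eqP.
have cs1 p : s p p.+1 = s 0%N 1%N by exact: circulant_side.
have cs2 p : s p p.+2 = s 0%N 2%N by elim: p => // p <-; apply: c0.
have step p : (p.+3 < k)%N -> good p -> good p.+1 -> good p.+2 -> good p.+3.
  move=> pk [r0 r00 e0] [r1 r10 e1] [r2 r20 e2].
  have k4 : (3 < k)%N := leq_ltn_trans (isT : (3 <= p.+3)%N) pk.
  have w3 : 0 < w p p.+3 by apply: (weights_gt0 ww); exact: ne3.
  have crp := cr k4 p (ltnW (ltnW (ltnW pk))).
  have s01 := rel _ _ _ _ r00 r10 e0 e1; rewrite cs1 in s01.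
  have s02 := rel _ _ _ _ r00 r20 e0 e2; rewrite cs2 in s02.
  have s12 := rel _ _ _ _ r10 r20 e1 e2; rewrite cs1 in s12.
  have wp1 := w1 p; have wp2 := w2 p; have wq1 := w1 p.+1; have wq2 := w2 p.+1.
  have wr1 := w1 p.+2.
  have [r0n r1n r2n] : [/\ r0 != 0, r1 != 0 & r2 != 0] by rewrite !lt0r_neq0.
  have [q1 q2] : w p p.+1 != 0 /\ w p p.+2 != 0 by rewrite !lt0r_neq0.
  have [q3 q4] : w p.+1 p.+2 != 0 /\ w p.+1 p.+3 != 0 by rewrite !lt0r_neq0.
  have q5 : w p.+2 p.+3 != 0 by rewrite lt0r_neq0.
  have cr1 : w p.+2 p.+3 * s 0%N 2%N * r2 = s 0%N 1%N * w p.+1 p.+3 * r1.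
    have ne : w p p.+1 * s 0%N 2%N != 0 by rewrite mulf_neq0.
    apply: (mulfI ne).
    transitivity (w p p.+1 * w p.+2 p.+3 * s 0%N 2%N ^+ 2 * r2); first by ring.
    by rewrite crp [in RHS]s02 [in LHS]s01 [in RHS]s01; ring.
(* the factor that is forced by the product of the vertices p.+2 and p.+3 *)
  pose r3 := s 0%N 1%N / (r2 * w p.+2 p.+3).
  have r30 : 0 < r3 by rewrite divr_gt0 ?mulr_gt0.
  have s23 : s p.+2 p.+3 = r2 * r3 * w p.+2 p.+3.
    by rewrite cs1 /r3; field; rewrite r2n q5.
  have s13 : s p.+1 p.+3 = r1 * r3 * w p.+1 p.+3.
    rewrite cs2 /r3; have ne : r2 * w p.+2 p.+3 != 0 by rewrite mulf_neq0.
    apply: (mulfI ne); transitivity (w p.+2 p.+3 * s 0%N 2%N * r2); first by ring.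
    by rewrite cr1; field; rewrite r2n q5.
  have s03 : s p p.+3 = r0 * r3 * w p p.+3.
    have := polyrep_ptolemaic k3 p0 p (leqnn 2) k4.
    have := polyrep_ptolemaic k3 pY p (leqnn 2) k4.
    rewrite -/w -/s !addn2 s13 s23 cs1 cs2 [s p.+1 p.+2]cs1 => pw ps.
    have ne : r1 * r2 * w p.+1 p.+2 != 0 by rewrite !mulf_neq0.
    apply: (mulIf ne).
    have -> : s p p.+3 * (r1 * r2 * w p.+1 p.+2) = s p p.+3 * s 0%N 1%N by rewrite -s12.
    transitivity (s 0%N 2%N * (r1 * r3 * w p.+1 p.+3) - s 0%N 1%N * (r2 * r3 * w p.+2 p.+3)).
      by rewrite ps; ring.
    rewrite [in X in X - _]s02 [in X in _ - X]s01.
    transitivity (r0 * r1 * r2 * r3 * (w p p.+2 * w p.+1 p.+3) -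
      r0 * r1 * r2 * r3 * (w p p.+1 * w p.+2 p.+3)); first by ring.
    by rewrite pw; ring.
  exists r3 => //; apply: (basis_ext (lt0r_neq0 (dY p))).
  - have : ip (A (Y0 p.+3)) (A (Y0 p)) = s p p.+3 ^+ 2 by rewrite Aiso ipC ips.
    rewrite e0 ipZr s03 => h; apply: (mulfI (expf_neq0 2 r0n)).
    by rewrite h ipZl (ipC (Y p.+3)) ipw; ring.
  - have : ip (A (Y0 p.+3)) (A (Y0 p.+1)) = s p.+1 p.+3 ^+ 2 by rewrite Aiso ipC ips.
    rewrite e1 ipZr s13 => h; apply: (mulfI (expf_neq0 2 r1n)).
    by rewrite h ipZl (ipC (Y p.+3)) ipw; ring.
  - have : ip (A (Y0 p.+3)) (A (Y0 p.+2)) = s p.+2 p.+3 ^+ 2 by rewrite Aiso ipC ips.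
    rewrite e2 ipZr s23 => h; apply: (mulfI (expf_neq0 2 r2n)).
    by rewrite h ipZl (ipC (Y p.+3)) ipw; ring.
have triple p : (p.+2 < k)%N -> [/\ good p, good p.+1 & good p.+2].
  elim: p => // p IH pk; have [h0 h1 h2] := IH (ltnW pk).
  by split=> //; apply: step.
have all p : (p < k)%N -> good p.
  by case: p => [//|[//|p]] pk; case: (triple p pk).
move=> p; have pk : (p %% k < k)%N by rewrite ltn_mod; exact: ltn_trans k3.
have [r r0] := all _ pk; rewrite !polyrep_mod // => e.
by exists (r ^+ 2); rewrite ?exprn_gt0.
Qed.
End CrossRatio.

Section Transfer.
Variables (x0 x : 'I_k -> R * R) (Y0 Y : nat -> v3 R).
Hypotheses (h0 : reps x0 Y0) (hY : reps x Y).

(** The linear isometry preserves the sheet of the hyperboloid, because it maps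
    vertices to forward vectors.  It induces an isometry of the plane that maps
    sides to sides, and conjugation by it maps one group of symmetries to the
    other. *)
Lemma congruent_regular : congruent Y0 Y -> regular x0 -> regular x.
Proof.
move=> [A [B [lA lB [AB BA] hA]]] [Phi [inj rng hom]].
have [pY0 pY] : polyrep k Y0 /\ polyrep k Y by case: h0; case: hY.
have [Aadd Asc Aiso] := lA; have [Badd Bsc Biso] := lB.
have lAY : light (A (Y0 0%N)).
  have [r r0 ->] := hA 0%N; apply: light_scale => //; by case: pY.
have forward (C : v3 R -> v3 R) (L : v3 R) X : (forall X Z, ip (C X) (C Z) = ip X Z) ->
    light L -> light (C L) -> hyp X -> hyp (C X).
  move=> Ciso lL lCL hX; have [xx _] := hX; split; first by rewrite Ciso.
  have cl : 0 < ip (C X) (C L) by rewrite Ciso; exact: ip_hyp_light.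
  rewrite ltNge; apply/negP => neg.
  have ne : v0 (C X) != 0.
    apply/negP => /eqP z; have : ip (C X) (C X) = 1 by rewrite Ciso.
    by rewrite /ip z mul0r; have := sqr_ge0 (v1 (C X)); have := sqr_ge0 (v2 (C X)); rewrite !expr2; lra.
  have hN : hyp (vscale (-1) (C X)).
    split; first by rewrite ipZl ipZr Ciso xx; ring.
    by rewrite /= mulN1r oppr_gt0 lt_neqAle ne.
  by have := ip_hyp_light hN lCL; rewrite ipZl; lra.
have l0 : light (Y0 0%N) by case: pY0.
have hypA X : hyp X -> hyp (A X) by exact: forward lAY.
have hypB X : hyp X -> hyp (B X).
  by apply: (forward B (A (Y0 0%N))); rewrite ?AB.
pose f p : hplane R := proj (A (lift p)); pose g p : hplane R := proj (B (lift p)).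
have lf p : lift (f p) = A (lift p) by rewrite lift_proj //; apply/hypA/lift_hyp.
have lg p : lift (g p) = B (lift p) by rewrite lift_proj //; apply/hypB/lift_hyp.
have fg : cancel f g by move=> p; apply: lift_inj; rewrite lg lf AB.
have gf : cancel g f by move=> p; apply: lift_inj; rewrite lf lg BA.
have df p q : hdist (f p) (f q) = hdist p q by rewrite !hdistE !lf Aiso.
have dg p q : hdist (g p) (g q) = hdist p q by rewrite -df !gf.
have [d d0 dA] := lorentz_det lA.
have sides i p : side x i (f p) <-> side x0 i p.
  have e : exists2 c, c != 0 & sideform Y i (A (lift p)) = c * sideform Y0 i (lift p).
    have [r r0 e] := hA i; have [r' r'0 e'] := hA i.+1.
    exists (d / (r * r')); first by rewrite mulf_neq0 // invr_eq0 mulf_neq0 ?lt0r_neq0.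
    have : r * r' * sideform Y i (A (lift p)) = d * sideform Y0 i (lift p).
      by rewrite /sideform -dA e e' /det3 /vscale /=; ring.
    have rn : r * r' != 0 by rewrite mulf_neq0 ?lt0r_neq0.
    by move=> h; apply: (mulfI rn); rewrite h; field; rewrite !lt0r_neq0.
  have [c cn e1] := e; split=> [/(side_sideform k3 hY)|/(side_sideform k3 h0)] h.
    apply/(side_sideform k3 h0); apply: (mulfI cn); rewrite mulr0 -e1 -lf; exact: h.
  by apply/(side_sideform k3 hY); rewrite lf e1 h mulr0.
have bd p : boundary x (f p) <-> boundary x0 p.
  by split=> -[i /sides h]; exists i.
have poly p : polygon x (f p) <-> polygon x0 p.
  split=> h C convC bdC.
    have : (g @^-1` C) (f p); last by rewrite /= fg.
    apply: h => [p1 q1 z1 /= c1 c2 e|q /= hq].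
      by apply: (convC (g p1) (g q1)); rewrite ?dg.
    by apply: bdC; apply/bd; rewrite gf.
  have : (f @^-1` C) p; last by [].
  apply: h => [p1 q1 z1 /= c1 c2 e|q /= hq].
    by apply: (convC (f p1) (f q1)); rewrite ?df.
  by apply: bdC; apply/bd.
have poly' p : polygon x p <-> polygon x0 (g p) by rewrite -poly gf.
exists (fun z => f \o Phi z \o g); split.
- move=> z z' /funeqP e; apply: inj; apply: funext => p.
  by have := e (f p); rewrite /= !fg => /(can_inj fg).
- apply/seteqP; split => [_ [z _ <-]|h [[[h' hh' h'h] hd] himg]].
    have : symmetries x0 (Phi z) by rewrite -rng; exists z.
    move=> [[[h' hh' h'h] hd] himg]; split; first split.
    + by exists (f \o h' \o g) => p; rewrite /= ?fg ?hh' ?h'h ?gf.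
    + by move=> p q /=; rewrite df hd dg.
    + apply/seteqP; split=> [_ [p hp <-] /=|p hp].
        by apply/poly; rewrite -himg; exists (g p) => //; apply/poly'.
      have : (Phi z @` polygon x0) (g p) by rewrite himg; apply/poly'.
      move=> [q hq e]; exists (f q); first by apply/poly.
      by rewrite /= fg e gf.
  have : symmetries x0 (g \o h \o f).
    split; first split.
    + by exists (g \o h' \o f) => p; rewrite /= ?gf ?hh' ?h'h ?fg.
    + by move=> p q /=; rewrite dg hd df.
    + apply/seteqP; split=> [_ [p hp <-] /=|p hp].
        apply/poly'; rewrite -himg; exists (f p) => //; exact/poly.
      have : (h @` polygon x) (f p) by rewrite himg; apply/poly.
      move=> [q hq e]; exists (g q); first exact/poly'.
      by rewrite /= gf e fg.
  rewrite -rng => -[z _ e]; exists z => //; rewrite e.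
  by apply: funext => p; rewrite /= !gf.
- move=> z z'; rewrite hom; apply: funext => p; by rewrite /= fg.
Qed.
End Transfer.
End Congruence.

(** * Comparison of average lengths *)

Section Lengths.
Variables (R : realType) (k n : nat).
Hypotheses (k3 : (3 <= k)%N) (n0 : (0 < n)%N).
Implicit Types (w s : nat -> nat -> R) (b : nat -> nat).

Lemma family_mod w b b' (mu : R) u v : weights k w ->
  (forall j, b j = b' j %[mod k]) -> family n w b mu u v -> family n w b' mu u v.
Proof.
move=> hw e [h1 h2 h3 h4].
have W p p' q q' : p = p' %[mod k] -> q = q' %[mod k] -> w p' q' = w p q.
  by move=> ep eq; rewrite (weights_mod hw q' (esym ep)) (weights_modr p hw (esym eq)).
have e' j := eqmodS (e j).
split=> // j.
  by rewrite (W _ _ _ _ (e j.+1) (e' j.+1)) (W _ _ _ _ (e' j.+1) (e j)) (W _ _ _ _ (e j.+1) (e j)).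
by rewrite (W _ _ _ _ (e j.+1) (e' j.+1)) (W _ _ _ _ (e' j.+1) (e' j)) (W _ _ _ _ (e j.+1) (e' j)).
Qed.

(** Each of the two solutions is a supersolution for the other one. *)
Lemma family_unique s b (mu mu' : R) u v u' v' : weights k s -> 0 < mu -> 0 < mu' ->
  family n s b mu u v -> family n s b mu' u' v' -> mu = mu'.
Proof.
move=> hs m0 m0' f f'; apply/eqP; rewrite eq_le; apply/andP; split.
- apply: (family_le k3 hs m0 m0' f (fun p q => lexx _) (family_gt0 f') (family_per f')).
  + by move=> j; rewrite (family_u f').
  + by move=> j; rewrite (family_v f').
- apply: (family_le k3 hs m0' m0 f' (fun p q => lexx _) (family_gt0 f) (family_per f)).
  + by move=> j; rewrite (family_u f).
  + by move=> j; rewrite (family_v f).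
Qed.

Lemma circulant_family s b (mu : R) u v t : circulant s ->
  family n s (fun j => b j + t)%N mu u v -> family n s b mu u v.
Proof.
move=> cs [h1 h2 h3 h4].
have S p q : s (p + t)%N (q + t)%N = s p q.
  by elim: t {h3 h4} => [|t IH]; rewrite ?addn0 // !addnS cs.
by split=> // j; [have := h3 j|have := h4 j]; rewrite -!addSn !S.
Qed.

Lemma alternating_shift t b b' e : (forall j, b j = b' j + t %[mod k]) ->
  alternating k b e -> alternating k b' e.
Proof.
move=> h alt j; have := alt j; case: (odd j (+) e) => E; apply/eqP; rewrite -(eqn_modDr t).
  by rewrite addSn -h E; apply/eqP; apply: eqmodS.
by rewrite -h -E addSn; apply/eqP; apply: eqmodS.
Qed.

Section Sequence.
Variable a : n.-tuple 'I_k.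
Hypothesis hb : forall j, label a j != label a j.+1 %[mod k].
Hypothesis na : forall e, ~ alternating k (fun j => label a j.+1) e.

(** The shifted labels have the same turns, so they are the labels of a
    trajectory; thus billiard_length is the length of some trajectory, and the
    latter provides a solution. *)
Lemma billiard_length_family (x : 'I_k -> R * R) (Y : nat -> v3 R) t : reps x Y -> exists u v,
  family n (lamY Y) (fun j => label a j.+1 + t)%N
    (expR (billiard_length x (shift_labels t a) / 2)) u v.
Proof.
move=> hY; have [pY _] := hY; pose c := shift_labels t a.
have hc j : label c j = label a j + t %[mod k] by exact: (label_shift k3 n0).
have hcb j : label c j != label c j.+1 %[mod k] by rewrite !hc eqn_modDr hb.
have [i ti] : exists i, turn k (fun j => label c j.+1) i.
  by apply: (turn_exists k3) => e /(alternating_shift (fun j => hc j.+1)); exact: na.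
have [L [E [F [L0 orb]]]] := orbit_exists k3 pY n0 hcb (label_per c) (ex_intro _ i.+1 ti).
have [g [T hT]] := trajectory_exists k3 hY n0 hcb L0 orb.
have [g' [h1 h2]] : exists gamma, closed_billiard_trajectory x gamma (billiard_length x c)
    /\ hits_in_period x gamma (billiard_length x c) c.
  by apply: (@xgetPex _ 0 [set T | exists gamma, closed_billiard_trajectory x gamma T
    /\ hits_in_period x gamma T c]); exists T, g.
have [_ [u [v f]]] := trajectory_family k3 hY h1 h2.
by exists u, v; apply: family_mod f => //; exact: (polyrep_weights k3 pY).
Qed.

Lemma gmean_lengths (T : nat -> R) :
  gmean k (fun t => expR (T t / 2)) = expR (k%:R^-1 * (\sum_(t < k) T t) / 2).
Proof.
rewrite /gmean -expR_sum /powR gt_eqF ?expR_gt0 // expRK; congr expR.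
by rewrite -mulr_suml mulrA.
Qed.

Section Comparison.
Variables (x0 x : 'I_k -> R * R) (Y0 Y : nat -> v3 R).
Hypotheses (h0 : reps x0 Y0) (hY : reps x Y) (c0 : circulant (lamY Y0)).

Let mu t := expR (billiard_length x (shift_labels t a) / 2).
Let mu0 := expR (average_length x0 a / 2).
Let ws : weights k (lamY Y0). Proof. by apply: polyrep_weights => //; case: h0. Qed.
Let ww : weights k (lamY Y). Proof. by apply: polyrep_weights => //; case: hY. Qed.
Let ps : ptolemaic k (lamY Y0). Proof. by apply: polyrep_ptolemaic => //; case: h0. Qed.
Let pw : ptolemaic k (lamY Y). Proof. by apply: polyrep_ptolemaic => //; case: hY. Qed.

(** For circulant weights, the solutions for shifted labels are solutions for the
    original labels, so by uniqueness all trajectories of the family have the same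
    length. *)
Lemma circulant_average : exists u v,
  family n (lamY Y0) (fun j => label a j.+1) (expR (average_length x0 a / 2)) u v.
Proof.
have fam t : exists u v, family n (lamY Y0) (fun j => label a j.+1)
    (expR (billiard_length x0 (shift_labels t a) / 2)) u v.
  by have [u [v f]] := billiard_length_family t h0; exists u, v; apply: circulant_family f.
have [u [v f]] := fam 0%N; exists u, v; suff -> : average_length x0 a =
    billiard_length x0 (shift_labels 0 a) by [].
rewrite /average_length.
under eq_bigr => t _.
  have -> : billiard_length x0 (shift_labels t a) = billiard_length x0 (shift_labels 0 a).
    have [u' [v' f']] := fam t.
    have := family_unique ws (expR_gt0 _) (expR_gt0 _) f' f.
    by move/expR_inj/(mulIf _) => -> //; rewrite invr_eq0 pnatr_eq0.
  over.
rewrite sumr_const card_ord -[X in _ * X]mulr_natl mulrA mulVf ?mul1r //.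
by rewrite pnatr_eq0; case: (k) k3.
Qed.

Let shifted : exists U V : nat -> nat -> R, forall t,
  family n (lamY Y) (fun j => label a j.+1 + t)%N (mu t) (U t) (V t).
Proof.
have h t : exists uv : (nat -> R) * (nat -> R), family n (lamY Y)
    (fun j => label a j.+1 + t)%N (mu t) uv.1 uv.2.
  by have [u [v f]] := billiard_length_family t hY; exists (u, v).
have [f hf] := choice h; by exists (fun t => (f t).1), (fun t => (f t).2).
Qed.

Let gmu : gmean k mu = expR (average_length x a / 2).
Proof. exact: gmean_lengths. Qed.

Lemma average_le : average_length x0 a <= average_length x a.
Proof.
have [u [v f]] := circulant_average; have [U [V fs]] := shifted.
have := mean_family_le k3 n0 ww pw ws c0 ps (expR_gt0 _) (fun t => expR_gt0 _) f fs.
by rewrite gmu ler_expR ler_pM2r // invr_gt0.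
Qed.

Lemma average_eq : average_length x a = average_length x0 a -> congruent Y0 Y.
Proof.
move=> e; have [u [v f]] := circulant_average; have [U [V fs]] := shifted.
have [p0 pY] : polyrep k Y0 /\ polyrep k Y by case: h0; case: hY.
apply: (cross_ratio_congruent k3 p0 pY c0) => k4.
have eg : gmean k mu = mu0 by rewrite gmu e /mu0; exact: erefl.
exact: (mean_family_eq k3 n0 ww pw ws c0 ps (fun j => hb j.+1) (expR_gt0 _)
  (fun t => expR_gt0 _) f fs k4 eg na).
Qed.
End Comparison.
End Sequence.
End Lengths.

Theorem theorem1p1 (R : realType) (k n : nat) (a : n.-tuple 'I_k)
    (x0 x : 'I_k -> R * R) :
  (3 <= k)%N -> billiard_sequence R a ->
  ideal_polygon x0 -> regular x0 -> ideal_polygon x ->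
  average_length x0 a <= average_length x a /\
  (average_length x a = average_length x0 a <-> regular x).
Proof.
move=> k3 [x1 [g [T [i1 closed hits]]]] i0 r0 ix.
have n0 := hits_n0 closed hits; have [Y1 h1] := ideal_reps k3 i1.
have [hb [u [v f]]] := trajectory_family k3 h1 closed hits.
have na e : ~ alternating k (fun j => label a j.+1) e.
  apply: (family_not_alternating k3 _ _ f); last first.
    by rewrite -expR0 ltr_expR divr_gt0 //; case: closed.
  by apply: (polyrep_weights k3); case: h1.
have circ (z : 'I_k -> R * R) : ideal_polygon z -> regular z -> exists Y, reps z Y /\ circulant (lamY Y).
  move=> iz rz; have [Z hZ] := ideal_reps k3 iz.
  have [A lA hA] := regular_rotation k3 hZ rz; exact: (rotation_reps k3 hZ lA hA).
have [Y0 [h0 c0]] := circ _ i0 r0; have [Y hY] := ideal_reps k3 ix.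
have le := average_le k3 n0 hb na h0 hY c0; split=> //; split=> [e|rx].
  exact: (congruent_regular k3 h0 hY (average_eq k3 n0 hb na h0 hY c0 e) r0).
have [Y' [hY' c']] := circ _ ix rx.
by apply/eqP; rewrite eq_le le (average_le k3 n0 hb na hY' h0 c').
Qed.
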